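(* Let $\mathcal P(v,\mathcal O)=\int_{\mathcal O}\Psi(x,|Dv|)\,dx$ with $\Psi(x,t)=G(t)+a(x)H_a(t)+b(x)H_b(t)$, $0\le a\in C^{\omega_a}(\Omega)$, $0\le b\in C^{\omega_b}(\Omega)$, where $\omega_a,\omega_b:[0,\infty)\to[0,\infty)$ are concave and vanish at $0$. (1) If $\sup_{t>0}\Lambda(t,G^{-1}(t^{-n}))<\infty$, then for any $v\in W^{1,\Psi}_{\rm loc}(\Omega)$ and balls $B_R\Subset\tilde B\Subset\Omega$ with $\mathcal P(v,\tilde B)<\infty$ there exists a sequence $\{v_k\}_{k\ge1}\subset W^{1,\infty}(B_R)$ such that $v_k\to v$ in $W^{1,G}(B_R)$ and $\mathcal P(v_k,B_R)\to\mathcal P(v,B_R)$. (2) If $\sup_{t>0}\Lambda(t,\frac1t)<\infty$, then for any $v\in W^{1,\Psi}_{\rm loc}(\Omega)\cap L^\infty_{\rm loc}(\Omega)$ and balls $B_R\Subset\tilde B\Subset\Omega$ with $\mathcal P(v,\tilde B)<\infty$ there exists a sequence $\{v_k\}_{k\ge1}\subset W^{1,\infty}(B_R)$ such that $v_k\to v$ in $W^{1,G}(B_R)$, $\mathcal P(v_k,B_R)\to\mathcal P(v,B_R)$ and $\limsup_{k\to\infty}\|v_k\|_{L^\infty(B_R)}\le\|v\|_{L^\infty(B_R)}$. (3) Let $v\in W^{1,\Psi}(\Omega)\cap C^{0,\gamma}(\Omega)$ with some $\gamma\in(0,1)$ be a local $Q$-minimizer of $\mathcal P$, and suppose $\sup_{t>0}\Lambda(t^{\frac1{1-\gamma}},\frac1t)<\infty$.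 Then for every ball $B_R\Subset\Omega$ there exists a sequence $\{v_k\}_{k\ge1}\subset W^{1,\infty}(B_R)$ such that $v_k\to v$ in $W^{1,G}(B_R)$ and $\mathcal P(v_k,B_R)\to\mathcal P(v,B_R)$.
   Context: $\Omega\subset\mathbb R^n$, $n\ge2$, is a bounded open domain. $\mathcal N$ is the set of functions $\Phi:[0,\infty)\to[0,\infty)$, increasing and convex, with $\Phi(0)=0$, $\lim_{t\to\infty}\Phi(t)=\infty$, $\lim_{t\to0^+}\Phi(t)/t=0$, $\lim_{t\to\infty}\Phi(t)/t=\infty$, $\Phi\in C^1([0,\infty))\cap C^2((0,\infty))$, for which there is a constant $s(\Phi)\ge1$ with $\frac1{s(\Phi)}\le\frac{\Phi''(t)t}{\Phi'(t)}\le s(\Phi)$ for all $t>0$. $G,H_a,H_b\in\mathcal N$ are fixed; $G^{-1}$ is the inverse of $G$. $C^\sigma(\Omega)$ is the space of uniformly continuous $f$ with $\|f\|_{L^\infty(\Omega)}+\sup_{x\ne y}\frac{|f(x)-f(y)|}{\sigma(|x-y|)}<\infty$. $$\Lambda(s,t)=\frac{\omega_a(s)}{1+\omega_a(s)}\frac{H_a(t)}{G(t)}+\frac{\omega_b(s)}{1+\omega_b(s)}\frac{H_b(t)}{G(t)}\qquad(s,t>0).$$ $W^{1,\Psi}$ (resp. $W^{1,G}$) denotes the Musielak–Orlicz–Sobolev (resp. Orlicz–Sobolev) space with the Luxemburg norms of $v$ and $Dv$. For $Q\ge1$, $v\in W^{1,1}_{\rm loc}(\Omega)$ is a local $Q$-minimizer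 of $\mathcal P$ if $\Psi(x,|Dv|)\in L^1(\Omega)$ and $\mathcal P(v,{\rm supp}(v-w))\le Q\,\mathcal P(w,{\rm supp}(v-w))$ for all $w\in W^{1,1}_{\rm loc}(\Omega)$ with ${\rm supp}(v-w)\Subset\Omega$. *)

(* Defs.v *)
From HB Require Import structures.
From mathcomp Require Import all_boot all_order all_algebra.
From mathcomp Require Import all_classical all_reals all_analysis.

Set Implicit Arguments.
Unset Strict Implicit.
Unset Printing Implicit Defensive.

Import Order.TTheory GRing.Theory Num.Theory.
Import numFieldNormedType.Exports.

Local Open Scope classical_set_scope.
Local Open Scope ring_scope.

(* The sigma-algebra on row vectors is the one generated by the coordinates;
   for real entries it is the Borel sigma-algebra. *)
Definition measure_rV_display : measure_display -> measure_display.
Proof. exact. Qed.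

Section measurable_rV.
Context {d} {T : measurableType d}.
Variable n : nat.

Let coors : 'I_n -> 'rV[T]_n -> T := fun i x => x ord0 i.

Let rV_set0 : g_sigma_preimage coors set0.
Proof. exact: sigma_algebra0. Qed.

Let rV_setC A : g_sigma_preimage coors A -> g_sigma_preimage coors (~` A).
Proof. exact: sigma_algebraC. Qed.

Let rV_bigcup (F : _^nat) : (forall i, g_sigma_preimage coors (F i)) ->
  g_sigma_preimage coors (\bigcup_i (F i)).
Proof. exact: sigma_algebra_bigcup. Qed.

HB.instance Definition _ := @isMeasurable.Build (measure_rV_display d)
  'rV[T]_n (g_sigma_preimage coors) rV_set0 rV_setC rV_bigcup.

End measurable_rV.

Lemma measurable_coord d (T : measurableType d) n (i : 'I_n) :
  measurable_fun [set: 'rV[T]_n] (fun x : 'rV[T]_n => x ord0 i).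
Proof.
move=> _ Y mY; rewrite setTI; apply: sub_sigma_algebra => /=.
rewrite -bigcup_seq/=; exists i => /=; first by rewrite mem_index_enum.
by exists Y => //; rewrite setTI.
Qed.

Lemma measurable_fun_rVP d1 d2 (T1 : measurableType d1)
    (T2 : measurableType d2) n (f : T1 -> 'rV[T2]_n) :
  (forall i, measurable_fun [set: T1] (fun x => f x ord0 i)) ->
  measurable_fun [set: T1] f.
Proof.
move=> mf; pose G := \big[setU/set0]_(i < n)
  preimage_set_system setT (fun x : 'rV[T2]_n => x ord0 i) measurable.
apply: (@measurability _ _ _ _ _ _ G) => // A.
rewrite /G => -[B]; rewrite -bigcup_seq => -[i _ [C mC <-]] <-.
by have := mf i measurableT C mC; rewrite !setTI.
Qed.

Section lebesgue_measure_rV.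
Variable R : realType.

Definition rV_cons n (p : measurableTypeR R * 'rV[R]_n) : 'rV[R]_n.+1 :=
  \row_i if unlift ord0 i is Some j then p.2 ord0 j else p.1.

Lemma measurable_rV_cons n : measurable_fun setT (@rV_cons n).
Proof.
apply: measurable_fun_rVP => i.
under eq_fun do rewrite mxE.
case: unliftP => [j|] _; last exact: measurable_fst.
exact: measurableT_comp (measurable_coord j) measurable_snd.
Qed.

Section step.
Variables (n : nat) (mu : {sigma_finite_measure set 'rV[R]_n -> \bar R}).

Definition lebesgue_rV_step : set 'rV[R]_n.+1 -> \bar R :=
  pushforward (lebesgue_measure \x mu)%E (@rV_cons n).

Let step0 : lebesgue_rV_step set0 = 0%E.
Proof. by rewrite /lebesgue_rV_step /pushforward preimage_set0 measure0. Qed.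

Let step_ge0 A : (0 <= lebesgue_rV_step A)%E.
Proof. by rewrite /lebesgue_rV_step /pushforward; exact: measure_ge0. Qed.

Let step_sigma_additive : semi_sigma_additive lebesgue_rV_step.
Proof.
move=> F mF tF mUF; rewrite /lebesgue_rV_step /pushforward preimage_bigcup.
have mcons B : measurable B -> measurable (@rV_cons n @^-1` B).
  by move=> mB; rewrite -[X in measurable X]setTI; exact: measurable_rV_cons.
apply: measure_semi_sigma_additive => //.
- by move=> k; exact: mcons.
- apply/trivIsetP => /= i j _ _ ij; rewrite -preimage_setI.
  by move/trivIsetP : tF => /(_ _ _ _ _ ij) ->//; rewrite preimage_set0.
- by rewrite -preimage_bigcup; exact: mcons.
Qed.

HB.instance Definition _ := isMeasure.Build _ _ _ lebesgue_rV_step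
  step0 step_ge0 step_sigma_additive.

Let rV_uncons (x : 'rV[R]_n.+1) : measurableTypeR R * 'rV[R]_n :=
  (x ord0 ord0, \row_j x ord0 (lift ord0 j)).

Let rV_consK : cancel (@rV_cons n) rV_uncons.
Proof.
move=> [a x]; rewrite /rV_uncons /rV_cons mxE unlift_none; congr pair.
by apply/rowP => j; rewrite !mxE liftK.
Qed.

Let measurable_rV_uncons : measurable_fun setT rV_uncons.
Proof.
apply/measurable_fun_pairP; split; first exact: measurable_coord.
apply: measurable_fun_rVP => i.
under eq_fun do rewrite mxE.
exact: measurable_coord.
Qed.

Let step_sigma_finite : sigma_finite setT lebesgue_rV_step.
Proof.
have /sigma_finiteP[F [TF ndF Foo]] := sigma_finiteT (@lebesgue_measure R).
have /sigma_finiteP[G [TG ndG Goo]] := sigma_finiteT mu.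
exists (fun k => rV_uncons @^-1` (F k `*` G k)).
  rewrite -preimage_bigcup; apply/esym/seteqP; split => // x _ /=.
  have [i _ Fi] : (\bigcup_i F i) (rV_uncons x).1 by rewrite -TF.
  have [j _ Gj] : (\bigcup_i G i) (rV_uncons x).2 by rewrite -TG.
  exists (maxn i j) => //; split.
    by move: Fi; exact/subsetPset/ndF/leq_maxl.
  by move: Gj; exact/subsetPset/ndG/leq_maxr.
move=> k; have [mFk Fkoo] := Foo k; have [mGk Gkoo] := Goo k; split.
  rewrite -[X in measurable X]setTI; apply: measurable_rV_uncons => //.
  exact: measurableX.
rewrite /lebesgue_rV_step /pushforward -comp_preimage.
rewrite (_ : rV_uncons \o _ = id); last first.
  by apply/funext => p /=; exact: rV_consK.
rewrite preimage_id product_measure1E//.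
by rewrite lte_mul_pinfty// ge0_fin_numE.
Qed.

HB.instance Definition _ := Measure_isSigmaFinite.Build _ _ _ lebesgue_rV_step
  step_sigma_finite.

End step.

Fixpoint lebesgue_rV n : {sigma_finite_measure set 'rV[R]_n -> \bar R} :=
  match n with
  | 0 => \d_(0 : 'rV[R]_0)
  | k.+1 => lebesgue_rV_step (lebesgue_rV k)
  end.

Lemma lebesgue_rV_box n (A : 'I_n -> set R) : (forall i, measurable (A i)) ->
  lebesgue_rV n [set x | forall i, A i (x ord0 i)] =
  (\prod_(i < n) lebesgue_measure (A i))%E.
Proof.
elim: n A => [|n IH] A mA.
  rewrite big_ord0 /= diracE mem_set//; by case.
rewrite big_ord_recl -IH// /= /lebesgue_rV_step /pushforward.
rewrite -product_measure1E//; last first.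
- rewrite (_ : (fun x : _ => _) = \big[setI/setT]_(i < n)
      ((fun x : 'rV[R]_n => x ord0 i) @^-1` A (lift ord0 i))).
    apply: bigsetI_measurable => i _; rewrite -[X in measurable X]setTI.
    exact: measurable_coord.
  rewrite -bigcap_seq; apply/seteqP; split => x /= H i.
    by move=> _; exact: H.
  by apply: (H i); rewrite /= mem_index_enum.
- exact: (mA ord0).
apply: (congr1 (product_measure1 lebesgue_measure (lebesgue_rV n))).
apply/seteqP; split => -[u x] /=.
  move=> H; split=> [|i].
    by have := H ord0; rewrite mxE unlift_none.
  by have := H (lift ord0 i); rewrite mxE liftK.
move=> [H0 H] i; rewrite mxE; case: unliftP => [j ->|->] //; exact: H.
Qed.

End lebesgue_measure_rV.

Section orlicz_functions.
Variable R : realType.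
Implicit Types (Phi w : R -> R) (s t : R).

(* Functions on [0, +oo) are represented by functions on R; their values on
   negative reals never matter. *)

(* The function df is the derivative on [0, +oo), one-sided at 0. *)
Definition C1_halfline Phi : Prop := exists df : R -> R,
  [/\ {within `[0, +oo[%classic, continuous df},
      h^-1 * (Phi h - Phi 0) @[h --> 0^'+] --> df 0 &
      forall t, 0 < t -> is_derive t 1 Phi (df t)].

Definition C2_open_halfline Phi : Prop := forall t, 0 < t ->
  [/\ derivable Phi t 1, derivable (derive1 Phi) t 1 &
      {for t, continuous (derive1n 2 Phi)}].

Record orlicz_function Phi : Prop := OrliczFunction {
  orlicz_ge0 : forall t, 0 <= t -> 0 <= Phi t ;
  orlicz_increasing : {in `[0, +oo[ &, {homo Phi : s t / s < t}} ;
  orlicz_convex : convex_function (`[0, +oo[%classic : set R) Phi ;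
  orlicz0 : Phi 0 = 0 ;
  orlicz_pinfty : Phi t @[t --> +oo] --> +oo ;
  orlicz_div0 : Phi t / t @[t --> 0^'+] --> 0 ;
  orlicz_div_pinfty : Phi t / t @[t --> +oo] --> +oo ;
  orlicz_C1 : C1_halfline Phi ;
  orlicz_C2 : C2_open_halfline Phi ;
  orlicz_index : exists2 s : R, 1 <= s &
    forall t, 0 < t -> s^-1 <= derive1n 2 Phi t * t / derive1 Phi t <= s }.

Definition orlicz_inv Phi : R -> R := 'pinv_(fun=> 0) `[0, +oo[%classic Phi.

Record concave_modulus w : Prop := ConcaveModulus {
  modulus_ge0 : forall t, 0 <= t -> 0 <= w t ;
  modulus0 : w 0 = 0 ;
  modulus_concave :
    convex_function (`[0, +oo[%classic : set R) (fun t => - w t) }.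

Definition Lambda (G Ha Hb wa wb : R -> R) (s t : R) : R :=
  wa s / (1 + wa s) * (Ha t / G t) + wb s / (1 + wb s) * (Hb t / G t).

End orlicz_functions.

Section function_spaces.
Variables (R : realType) (n : nat).
Local Notation V := 'rV[R]_n.
Local Notation mu := (lebesgue_rV R n).
Implicit Types (U O A B K : set V) (f u v w : V -> R) (g : V -> V).
Implicit Types (Psi : V -> R -> R) (x y : V).

(* The library norm on 'rV is the sup norm, hence the Euclidean norm and balls
   are defined here; both norms induce the same topology. *)
Definition enorm (x : V) : R := Num.sqrt (\sum_(i < n) x ord0 i ^+ 2).

Definition eball (x : V) (r : R) : set V := [set y | enorm (y - x) < r].

Definition bounded_domain U : Prop :=
  [/\ open U, connected U, U !=set0 & bounded_set U].

Definition compactly_contained A B : Prop :=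
  compact (closure A) /\ closure A `<=` B.

Definition Linfty_norm U f : \bar R := 'N[mu]_+oo[EFin \o (f \_ U)].

Definition Linfty_loc U f : Prop :=
  forall A, open A -> compactly_contained A U -> (Linfty_norm A f < +oo)%E.

(* The space C^sigma(U). The bound on the difference quotients is multiplied
   out, so that for sigma = 0 (a degenerate concave modulus) only constant
   functions qualify, instead of all functions through division by 0. *)
Definition C_modulus U (sigma : R -> R) f : Prop :=
  [/\ forall e, 0 < e -> exists2 d, 0 < d &
        forall x y, U x -> U y -> enorm (x - y) < d -> `|f x - f y| < e,
      (Linfty_norm U f < +oo)%E &
      exists M, forall x y, U x -> U y -> x != y ->
        `|f x - f y| <= M * sigma (enorm (x - y))].

Definition partial_derive (i : 'I_n) f : V -> R := 'D_(delta_mx ord0 i) f.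

Fixpoint C_k (k : nat) f : Prop :=
  continuous f /\
  if k is k'.+1 then
    forall i, (forall x, derivable f x (delta_mx ord0 i)) /\ C_k k' (partial_derive i f)
  else True.

Definition test_function U f : Prop :=
  (forall k, C_k k f) /\ compactly_contained [set x | f x != 0] U.

Definition L1_loc U f : Prop := measurable_fun U f /\
  forall K, K `<=` U -> compact K -> (\int[mu]_(x in K) `|f x|%:E < +oo)%E.

Definition is_weak_grad U f g : Prop :=
  [/\ L1_loc U f, forall i, L1_loc U (fun x => g x ord0 i) &
      forall phi, test_function U phi -> forall i,
        (\int[mu]_(x in U) (f x * partial_derive i phi x)%:E =
         - \int[mu]_(x in U) (g x ord0 i * phi x)%:E)%E].

Definition W11_loc U f : Prop := exists g, is_weak_grad U f g.

(* Meaningful when W11_loc U f holds; it is then unique a.e. in U. *)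
Definition weak_grad U f : V -> V := xget (fun=> 0) [set g | is_weak_grad U f g].

Definition weak_grad_norm U f (x : V) : R := enorm (weak_grad U f x).

Definition luxemburg_norm U Psi f : \bar R :=
  ereal_inf [set l%:E | l in [set l : R | 0 < l /\
    (\int[mu]_(x in U) (Psi x (`|f x| / l))%:E <= 1)%E]].

Definition W1_norm U Psi f : \bar R :=
  (luxemburg_norm U Psi f + luxemburg_norm U Psi (weak_grad_norm U f))%E.

Definition W1 U Psi f : Prop := W11_loc U f /\ (W1_norm U Psi f < +oo)%E.

Definition W1_loc U Psi f : Prop := W11_loc U f /\
  forall A, open A -> compactly_contained A U -> W1 A Psi f.

Definition W1_cvg U Psi (f_ : nat -> V -> R) f : Prop :=
  [/\ forall k, W1 U Psi (f_ k), W1 U Psi f &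
      W1_norm U Psi (f_ k \- f) @[k --> \oo] --> 0%E].

Definition W1_infty U f : Prop :=
  [/\ W11_loc U f, (Linfty_norm U f < +oo)%E &
      (Linfty_norm U (weak_grad_norm U f) < +oo)%E].

(* Meant for O included in U and f in W11_loc U. *)
Definition energy Psi U f O : \bar R :=
  \int[mu]_(x in O) (Psi x (weak_grad_norm U f x))%:E.

(* The support of f, defined up to a.e. equality: the complement in U of the
   largest open set on which f vanishes a.e. *)
Definition ess_support U f : set V :=
  [set x | U x /\ forall A, open A -> A x ->
    ~ mu.-negligible [set y | [/\ A y, U y & f y != 0]]].

Definition local_Qminimizer Psi U (Q : R) v : Prop :=
  [/\ W11_loc U v,
      mu.-integrable U (fun x => (Psi x (weak_grad_norm U v x))%:E) &
      forall w, W11_loc U w ->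
        let S := ess_support U (v \- w) in
        compactly_contained S U -> (energy Psi U v S <= Q%:E * energy Psi U w S)%E].

End function_spaces.

Definition multi_phase (R : realType) (n : nat) (G Ha Hb : R -> R)
    (a b : 'rV[R]_n -> R) (x : 'rV[R]_n) (t : R) : R :=
  G t + a x * Ha t + b x * Hb t.

(* Main.v *)
(* Let rho be a smooth kernel of mass one supported in B = B_R, and for small e
   put v_e(x) = int v((1 - e) x + e w) rho(w) dw.  Since B is convex, v_e only
   sees the values of v in B; it is Lipschitz there, its gradient is (1 - e)
   times the same average of Dv, and it only involves points at distance at
   most 2 R e from x.  Jensen's inequality, with a(x) replaced by its lower
   bound a(x) - C omega_a(2 R e) near x, gives
   Psi(x, |Dv_e|) <= C avg(Psi(., |Dv|))(x) + C omega_a(2 R e) H_a(|Dv_e|) + ...,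
   and the last terms are at most C G(|Dv_e|) as soon as
   Lambda(d, |Dv_e| / K) is bounded for some d >= 2 R e.  The three hypotheses
   on Lambda match three a priori bounds on t = |Dv_e(x)|: G(t) <= C e^-n from
   the finite energy, t <= C / e from the bound on v, and t <= C e^(gamma - 1)
   from its Hoelder continuity.  Hence Psi(., |Dv_e|) is dominated by averages
   which converge in L1, and along a sequence e_j with summable errors the
   dominated convergence theorem applies. *)
From HB Require Import structures.
Require Import Defs.
From mathcomp Require Import all_boot all_order all_algebra.
From mathcomp Require Import all_classical all_reals all_analysis.
From mathcomp Require Import measurable_realfun ess_sup_inf.
From mathcomp Require Import ring lra.

Set Implicit Arguments.
Unset Strict Implicit.
Unset Printing Implicit Defensive.

Import Order.TTheory GRing.Theory Num.Theory.
Import numFieldNormedType.Exports.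

Local Open Scope classical_set_scope.
Local Open Scope ring_scope.

(** * Orlicz functions *)

(** Dilating toward [w], rather than convolving, avoids any cut-off or extension of [v] and gives an
    approximation up to the boundary of [B]. For fixed [w] the map is affine with constant Jacobian
    (1 - e)^n, at least 2^-n for e <= 1/2: averages are controlled in L1 uniformly in e, and weak
    derivatives are computed by moving the map onto the test function. The obstacle is that each
    hypothesis bounds Lambda only along a curve, while the pair formed by 2 R e and |Dv_e(x)| is
    compared with that curve only up to an a priori constant. Hence the number [K]: the curve is met
    at |Dv_e(x)| / K and solved for a scale d >= 2 R e. Monotonicity of the moduli, a consequence of
    concavity, passes from d to 2 R e, and the doubling condition, a consequence of the upper index
    bound, removes [K]. The bounded case is treated as the Hoelder case of exponent 0. In both,
    |Dv_e| is controlled by the oscillation of v; this rests on the symmetry of the kernel about the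
    centre of [B], which gives its partial derivatives mean zero. *)

Section orlicz_theory.
Context {R : realType}.

Lemma gt0_derive_ndecr (f df : R -> R) :
  (forall t : R, 0 < t -> is_derive t 1 f (df t)) ->
  (forall t : R, 0 < t -> 0 <= df t) ->
  forall s t : R, 0 < s -> s <= t -> f s <= f t.
Proof.
move=> fdf df0 s t s0 st; rewrite -subr_ge0.
have [||c /itvP cst ->] := @MVT_segment R f df s t st.
- by move=> x /itvP xst; apply: fdf; apply: lt_trans s0 _; rewrite xst.
- apply: derivable_within_continuous => x /itvP xst.
  have x0 : 0 < x by apply: lt_le_trans s0 _; rewrite xst.
  by have [] := fdf _ x0.
by rewrite mulr_ge0 ?subr_ge0// df0// (lt_le_trans s0)// cst.
Qed.

Variables (Phi : R -> R) (P : orlicz_function Phi).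
Local Notation D := (derive1 Phi).

Lemma orlicz_convexE (l s t : R) : 0 <= l -> l <= 1 -> 0 <= s -> 0 <= t ->
  Phi (l * s + (1 - l) * t) <= l * Phi s + (1 - l) * Phi t.
Proof.
move=> l0 l1 s0 t0.
have /andP : (0 <= l) && (l <= 1) by rewrite l0 l1.
move=> /andP l01.
have := @orlicz_convex _ _ P (Itv01 l0 l1) s t.
rewrite !inE/= !in_itv/= !andbT => /(_ s0 t0).
by rewrite !convRE.
Qed.

Lemma orlicz_le (s t : R) : 0 <= s -> s <= t -> Phi s <= Phi t.
Proof.
move=> s0; rewrite le_eqVlt => /predU1P[->//|st].
apply: ltW; apply: (orlicz_increasing P) => //; rewrite in_itv/= andbT//.
exact: le_trans s0 (ltW st).
Qed.

Lemma orlicz_gt0 (t : R) : 0 < t -> 0 < Phi t.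
Proof.
move=> t0; rewrite -(orlicz0 P); apply: (orlicz_increasing P) => //.
  by rewrite in_itv/= lexx.
by rewrite in_itv/= andbT ltW.
Qed.

Lemma orlicz_divr (K t : R) : 1 <= K -> 0 <= t -> Phi (t / K) <= Phi t / K.
Proof.
move=> K1 t0; have K0 : 0 < K by exact: lt_le_trans K1.
have := @orlicz_convexE K^-1 t 0; rewrite invr_ge0 (ltW K0) invf_le1// K1.
by rewrite mulr0 addr0 (orlicz0 P) mulr0 addr0 ![K^-1 * _]mulrC; exact.
Qed.

Lemma orlicz_invK (t : R) : 0 <= t -> orlicz_inv Phi (Phi t) = t.
Proof.
move=> t0; rewrite /orlicz_inv pinvKV//; last by rewrite inE/= in_itv/= t0.
move=> x y; rewrite !inE/= => x0 y0 xy.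
have [h|h|//] := ltgtP x y.
  by have := orlicz_increasing P x0 y0 h; rewrite xy ltxx.
by have := orlicz_increasing P y0 x0 h; rewrite xy ltxx.
Qed.

Lemma orlicz_small : \forall t \near 0^'+, Phi t <= t.
Proof.
have /cvgrPdist_le /(_ 1 ltr01) := orlicz_div0 P.
apply: filter_app; near=> t; rewrite sub0r normrN => h.
have t0 : 0 < t by [].
by have := le_trans (ler_norm _) h; rewrite ler_pdivrMr// mul1r.
Unshelve. all: by end_near. Qed.

Lemma orlicz_is_derive (t : R) : 0 < t -> is_derive t 1 Phi (D t).
Proof.
by move=> /(orlicz_C2 P)[d1 _ _]; rewrite derive1E; exact: derivableP.
Qed.

Lemma orlicz_derive_ge0 (t : R) : 0 < t -> 0 <= D t.
Proof.
move=> t0; apply: (@incr_derive1_ge0_itvy _ Phi true 0).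
- by move=> x; rewrite inE/= in_itv/= andbT => /(orlicz_C2 P)[].
- exact: (orlicz_increasing P).
- by rewrite in_itv/= andbT.
Qed.

Lemma orlicz_is_derive2 (t : R) : 0 < t -> is_derive t 1 D (derive1n 2 Phi t).
Proof.
move=> /(orlicz_C2 P)[_ d2 _].
by rewrite /derive1n/= derive1E; exact: derivableP.
Qed.

Lemma orlicz_derive_index : exists2 s : R, 1 <= s &
  forall t, 0 < t -> 0 <= derive1n 2 Phi t /\ derive1n 2 Phi t * t <= s * D t.
Proof.
have [s s1 h] := orlicz_index P; exists s => // t t0.
have /andP[h1 h2] := h t t0.
(* Division by 0 yields 0, so a zero of [D] would make the quotient in the index condition vanish,
   against its positive lower bound [s^-1]. *)
have Dn0 : D t != 0.
  apply/negP => /eqP D0; move: h1; rewrite D0 invr0 mulr0 leNgt invr_gt0.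
  by rewrite (lt_le_trans _ s1).
have D0 : 0 < D t by rewrite lt_neqAle eq_sym Dn0 orlicz_derive_ge0.
split; last by rewrite -ler_pdivrMr.
rewrite -(pmulr_lge0 _ t0) -(@pmulr_lge0 _ (D t)^-1) ?invr_gt0//.
by apply: le_trans h1; rewrite invr_ge0 (le_trans _ s1).
Qed.

Lemma orlicz_derive_ndecr (s t : R) : 0 < s -> s <= t -> D s <= D t.
Proof.
apply: gt0_derive_ndecr; first exact: orlicz_is_derive2.
by move=> x x0; have [s' _ /(_ _ x0)[]] := orlicz_derive_index.
Qed.

(** Even extension. [Phi] is unconstrained on negative reals, whereas limits, measurability and the
    mean value theorem on an interval starting at 0 call for a function continuous on the whole
    line. *)
Definition orlicz_sym (t : R) := Phi `|t|.

Lemma orlicz_symE (t : R) : 0 <= t -> orlicz_sym t = Phi t.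
Proof. by move=> t0; rewrite /orlicz_sym ger0_norm. Qed.

Lemma continuous_orlicz_sym : continuous orlicz_sym.
Proof.
move=> t; have [->|t0] := eqVneq t 0; last first.
  apply: (@continuous_comp _ _ _ (fun x : R => `|x|) Phi); first exact: norm_continuous.
  have [/derivable1_diffP/differentiable_continuous //] : is_derive `|t| 1 Phi (D `|t|).
  by apply: orlicz_is_derive; rewrite normr_gt0.
apply/cvgrPdist_le => e e0; rewrite /orlicz_sym normr0 (orlicz0 P).
have := orlicz_small; move=> [d /= d0 dP].
near=> x; rewrite sub0r normrN.
have xd : `|x| < Num.min d e.
  near: x; apply/nbhs_ballP; exists (Num.min d e) => /=; first by rewrite lt_min d0 e0.
  by move=> x; rewrite /ball/= sub0r normrN.
have [->|x0] := eqVneq x 0; first by rewrite normr0 (orlicz0 P) normr0 ltW.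
rewrite ger0_norm; last exact: (orlicz_ge0 P).
apply: (@le_trans _ _ `|x|).
  apply: dP => /=; last by rewrite normr_gt0.
  by rewrite sub0r normrN normr_id; apply: lt_le_trans xd _; rewrite ge_min lexx.
by apply: (le_trans (ltW xd)); rewrite ge_min lexx orbT.
Unshelve. all: by end_near. Qed.

(** The slope [D] is nondecreasing, so the mean value theorem puts the chord from [m] to [s] above
    the tangent at [m]. Passing to [orlicz_sym] admits [s = 0], where [Phi] itself need not be
    continuous from the left. *)
Lemma orlicz_tangent_derive (m s : R) : 0 < m -> 0 <= s ->
  Phi m + D m * (s - m) <= Phi s.
Proof.
move=> m0 s0.
have symd (x : R) : 0 < x -> is_derive x 1 orlicz_sym (D x).
  move=> x0; apply: (@near_eq_is_derive _ _ _ Phi _ x 1 (D x)).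
  - near=> y; rewrite orlicz_symE//; apply: ltW.
    by near: y; exact: lt_nbhsr.
  - exact: orlicz_is_derive.
have symc (x y : R) : {within `[x, y], continuous orlicz_sym}.
  by apply: continuous_subspaceT; exact: continuous_orlicz_sym.
rewrite -!orlicz_symE// ?(ltW m0)//.
have [sm|ms|->] := ltgtP s m; last by rewrite subrr mulr0 addr0.
- have [x /itvP xsm|c /itvP csm E] := @MVT _ orlicz_sym D s m sm _ (symc _ _).
    by apply: symd; apply: le_lt_trans s0 _; rewrite xsm.
  have : D c <= D m.
    by apply: orlicz_derive_ndecr; [apply: le_lt_trans s0 _|]; rewrite csm.
  by move/(ler_wpM2r (_ : 0 <= m - s)); rewrite subr_ge0 (ltW sm) => /(_ isT); lra.
- have [x /itvP xsm|c /itvP csm E] := @MVT _ orlicz_sym D m s ms _ (symc _ _).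
    by apply: symd; apply: lt_trans m0 _; rewrite xsm.
  have : D m <= D c.
    by apply: orlicz_derive_ndecr => //; rewrite csm.
  by move/(ler_wpM2r (_ : 0 <= s - m)); rewrite subr_ge0 (ltW ms) => /(_ isT); lra.
Unshelve. all: by end_near. Qed.

(** The supporting line needed for Jensen's inequality; at [m = 0] the slope 0 works because [Phi]
    is nonnegative and vanishes there. *)
Lemma orlicz_tangent (m : R) : 0 <= m -> exists p : R,
  forall s, 0 <= s -> Phi m + p * (s - m) <= Phi s.
Proof.
rewrite le_eqVlt => /predU1P[<-|m0].
  by exists 0 => s s0; rewrite mul0r addr0 (orlicz0 P) (orlicz_ge0 P).
by exists (D m) => s; exact: orlicz_tangent_derive.
Qed.

(* The upper index bound makes N Phi - t Phi' nondecreasing, and it vanishes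
   at 0. *)
Lemma orlicz_derive_le : exists2 N : nat, (0 < N)%N &
  forall t, 0 < t -> t * D t <= N%:R * Phi t.
Proof.
have [s s1 hs] := orlicz_derive_index.
have [N NE] : exists N : nat, s + 1 <= N%:R.
  exists (Num.truncn (s + 1)).+1; apply: ltW.
  by rewrite truncnS_gt.
have N1 : 1 < (N%:R : R) by apply: lt_le_trans NE; lra.
exists N; first by move: N1; rewrite ltr1n; case: N {NE}.
move=> t t0.
pose h x := N%:R * Phi x - x * D x.
have hd (x : R) : 0 < x ->
    is_derive x 1 h (N%:R * D x - (x * derive1n 2 Phi x + D x)).
  move=> x0; have := orlicz_is_derive x0; have := orlicz_is_derive2 x0 => d1 d2.
  apply: is_deriveB.
  rewrite -[X in is_derive _ _ _ (_ + X)]mulr1 -[D x * 1]/(D x *: (1:R)).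
  exact: is_deriveM.
have hmono : forall u v, 0 < u -> u <= v -> h u <= h v.
  apply: gt0_derive_ndecr hd _ => x x0; have [_ +] := hs _ x0.
  have := orlicz_derive_ge0 x0; nra.
(* Behaviour of [h] at 0: the tangent at [u], evaluated at [2 * u], bounds [u * D u] by
   [Phi (2 * u)], which is at most [2 * u] near 0. *)
have near0 : \forall u \near 0^'+, - (2 * u) <= h t.
  have sm2 : \forall u \near 0^'+, Phi (2 * u) <= 2 * u.
    have [d /= d0 dP] := orlicz_small.
    exists (d / 2) => /=; first by rewrite divr_gt0.
    move=> u /=; rewrite sub0r normrN => ud u0; apply: dP => /=.
      rewrite sub0r normrN gtr0_norm; last by rewrite mulr_gt0.
      by move: ud; rewrite gtr0_norm//; lra.
    by rewrite mulr_gt0.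
  apply: filter_app sm2; near=> u => Pu.
  have u0 : 0 < u by [].
  have ut : u <= t by near: u; exact: nbhs_right_le.
  apply: le_trans (hmono _ _ u0 ut).
  have : Phi u + D u * (2 * u - u) <= Phi (2 * u).
    have u2 : 0 < 2 * u by rewrite mulr_gt0.
    by apply: orlicz_tangent_derive => //; rewrite mulr_ge0// ltW.
  rewrite /h; have := orlicz_ge0 P (ltW u0); nra.
rewrite -subr_ge0; apply/ler_addgt0Pr => e e0; rewrite -lerBlDr sub0r.
near (0 : R)^'+ => u.
apply: le_trans (near near0 u _) => //.
rewrite lerN2; suff : u <= e / 2 by lra.
by near: u; apply: nbhs_right_le; rewrite divr_gt0.
Unshelve. all: by end_near. Qed.

(** The Delta_2 condition. By [orlicz_derive_le] the quotient Phi(t) / t^N is nonincreasing on the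
    positive reals; the function [h] below is its opposite. *)
Lemma orlicz_double : exists2 N : nat, (0 < N)%N &
  forall t, 0 <= t -> Phi (2 * t) <= 2 ^+ N * Phi t.
Proof.
have [N N0 hN] := orlicz_derive_le; exists N => // t.
rewrite le_eqVlt => /predU1P[<-|t0].
  by rewrite mulr0 (orlicz0 P) mulr0.
pose h (x : R) := - (Phi x * x ^- N).
have hd (x : R) : 0 < x ->
    is_derive x 1 h (x ^- N.+1 * (N%:R * Phi x - x * D x)).
  move=> x0; have d1 := orlicz_is_derive x0.
  have xn0 : x ^+ N != 0 by rewrite expf_neq0// gt_eqF.
  rewrite (_ : _ * _ = - (Phi x *: (- (x ^- N) ^+ 2 *: ((x ^+ N.-1 *+ N) *: (1 : R))) +
    x ^- N *: D x)); last first.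
    rewrite /GRing.scale/= mulr1 -[N in x ^- N.+1](prednK N0) -mulr_natr.
    have -> : x ^- N = x^-1 * (x ^- N.-1) by rewrite -[in LHS](prednK N0) exprS invfM.
    rewrite !exprS -mulr_natr mul1r.
    have : x ^+ N.-1 != 0 by rewrite expf_neq0// gt_eqF.
    have : x != 0 by rewrite gt_eqF.
    by move: (x ^+ N.-1) (Phi x) (D x) => z p d' xn zn; field; rewrite zn xn.
  have d2 : is_derive x 1 (fun y : R => (y ^+ N)^-1)
      (- (x ^- N) ^+ 2 *: ((x ^+ N.-1 *+ N) *: (1 : R))).
    have dX : is_derive x 1 (fun y : R => y ^+ N) ((x ^+ N.-1 *+ N) *: (1 : R)).
      have : is_derive x (1 : R) ((id : R -> R) ^+ N) ((N%:R * x ^+ N.-1) *: (1 : R)).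
        exact: is_deriveX.
      by rewrite exprfctE mulr_natl.
    apply: DeriveDef; first by apply: derivableV => //; case: dX.
    rewrite deriveV//.
    by rewrite (@derive_val _ _ _ _ _ _ _ dX) exprVn.
  exact/is_deriveN/is_deriveM.
have : h t <= h (2 * t).
  apply: (gt0_derive_ndecr hd) => //; last by rewrite ler_peMl ?ler1n// ltW.
  move=> x x0; rewrite mulr_ge0 ?invr_ge0 ?exprn_ge0 ?(ltW x0)// subr_ge0.
  exact: hN.
rewrite /h lerN2 ler_pdivrMr ?exprn_gt0 ?mulr_gt0// => /le_trans; apply.
rewrite exprMn mulrCA -mulrA [X in _ * (_ * X)]mulVf ?mulr1//.
by rewrite expf_neq0// gt_eqF.
Qed.

(** Doubling iterated until 2^m exceeds [K]. Every constant multiplying an argument is absorbed in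
    this way. *)
Lemma orlicz_mul (K : R) : 0 <= K -> exists2 C : R, 1 <= C &
  forall t, 0 <= t -> Phi (K * t) <= C * Phi t.
Proof.
move=> K0; have [N _ hN] := orlicz_double.
have h2 (m : nat) (t : R) : 0 <= t -> Phi (2 ^+ m * t) <= 2 ^+ N ^+ m * Phi t.
  move=> t0; elim: m => [|m IH]; first by rewrite !expr0 !mul1r.
  rewrite !exprS -!mulrA; apply: le_trans (hN _ _) _.
    by rewrite mulr_ge0 ?exprn_ge0.
  by rewrite ler_wpM2l ?exprn_ge0.
have [m Km] : exists m : nat, K <= 2 ^+ m.
  exists (Num.truncn K).+1; apply: ltW; apply: lt_le_trans (truncnS_gt _) _.
  by rewrite -natrX ler_nat ltnW// ltn_expl.
exists (2 ^+ N ^+ m); first by rewrite -!natrX ler1n !expn_gt0.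
move=> t t0; apply: le_trans (h2 m t t0).
by rewrite orlicz_le ?mulr_ge0// ler_wpM2r.
Qed.

(** On a set of finite measure this turns integrability of Phi(|u|) into integrability of u. *)
Lemma orlicz_superlinear : exists2 C : R, 0 <= C &
  forall t, 0 <= t -> t <= C + Phi t.
Proof.
have /cvgryPge /(_ 1)[M [Mr hM]] := orlicz_div_pinfty P.
exists (Num.max M 0 + 1); first by rewrite addr_ge0// le_max lexx orbT.
move=> t t0; have [tM|Mt] := leP t (Num.max M 0 + 1).
  by apply: le_trans tM _; rewrite lerDl (orlicz_ge0 P).
have t1 : 0 < t by apply: le_lt_trans Mt; rewrite addr_ge0// le_max lexx orbT.
have : 1 <= Phi t / t.
  apply: hM; apply: le_lt_trans Mt.
  by apply: (@le_trans _ _ (Num.max M 0)); [rewrite le_max lexx|rewrite lerDl].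
rewrite ler_pdivlMr// mul1r => /le_trans; apply.
by rewrite lerDr addr_ge0// le_max lexx orbT.
Qed.

End orlicz_theory.

(** * Euclidean balls and affine maps on row vectors *)

Section rV_topology.
Context {R : realType} {n : nat}.
Local Notation V := 'rV[R]_n.

Lemma rV_ballP (x : V) (e : R) (y : V) : 0 < e ->
  (ball x e y <-> forall i, `|x ord0 i - y ord0 i| < e).
Proof.
move=> e0; split => [[_ H] i|H]; first exact: H.
by split => // i j; rewrite (ord1 i); exact: H.
Qed.

(** The sigma-algebra is generated by the coordinates, so boxes are measurable; an open set is the
    union of the countably many boxes with rational centre and half-side 1/(k+1) that it
    contains. *)
Lemma open_measurable_rV (U : set V) : open U -> measurable U.
Proof.
move=> oU.
pose box (p : 'rV[rat]_n * nat) : set V :=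
  [set x | forall i, `|ratr (p.1 ord0 i) - x ord0 i| < (p.2.+1%:R)^-1].
have mbox p : measurable (box p).
  rewrite (_ : box p = \big[setI/setT]_(i < n)
      ((fun x : V => x ord0 i) @^-1` ball (ratr (p.1 ord0 i) : R) (p.2.+1%:R)^-1)).
    apply: bigsetI_measurable => i _; rewrite -[X in measurable X]setTI.
    by apply: measurable_coord => //; exact: measurable_ball.
  rewrite -bigcap_seq; apply/seteqP; split => x /= H i.
    by move=> _; exact: H.
  by apply: (H i); rewrite /= mem_index_enum.
have -> : U = \bigcup_p (if `[< box p `<=` U >] then box p else set0).
  apply/seteqP; split => [x Ux|x [p _]]; last first.
    by case: asboolP => // + bx; exact.
  have /nbhs_ballP[e /= e0 xe] : nbhs x U by exact: open_nbhs_nbhs.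
  have [k ke] : exists k : nat, (k.+1%:R)^-1 < e / 2.
    have [k] := ltr_add_invr (divr_gt0 e0 (ltr0n R 2)).
    by rewrite add0r; exists k.
  have kk : 0 < (k.+1%:R)^-1 :> R by rewrite invr_gt0.
  have q_ i : exists q : rat, `|ratr q - x ord0 i| < (k.+1%:R)^-1.
    have : x ord0 i < x ord0 i + (k.+1%:R)^-1 by rewrite ltrDl.
    move=> /rat_in_itvoo[q]; rewrite in_itv/= => /andP[q1 q2]; exists q.
    by rewrite ger0_norm ?subr_ge0 ?ltrBlDl// ltW.
  have [q hq] := choice q_.
  exists (\row_i q i, k) => //; rewrite asboolT => [|y hy].
    by move=> i /=; rewrite mxE.
  apply: xe; apply/rV_ballP => // i.
  have := hq i; have := hy i; rewrite /= mxE => h1 h2.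
  rewrite -(subrKA (ratr (q i))) (le_lt_trans (ler_normD _ _))//.
  by rewrite (splitr e) distrC ltrD// (lt_trans _ ke).
apply: countable_bigcupT_measurable => [|p].
  exact: countableP.
by case: asboolP.
Qed.

(** Allows a Dynkin induction to start from the open sets. *)
Lemma measurable_rV_open : @measurable _ V = <<s open >>.
Proof.
apply/seteqP; split => [A|]; last first.
  by apply: smallest_sub; [exact: sigma_algebra_measurable|exact: open_measurable_rV].
apply: smallest_sub; first exact: smallest_sigma_algebra.
move=> B; rewrite -bigcup_seq/= => -[i _ [C mC <-]].
pose aT := g_sigma_algebraType (@open V).
suff /(_ measurableT C mC) : @measurable_fun _ _ aT (measurableTypeR R) setT (fun x : V => x ord0 i).
  by [].
apply: (measurability _ (RGenOpens.measurableE R)) => _ [_ [a [b ->] <-]].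
rewrite setTI; apply: sub_sigma_algebra.
by apply: open_comp => [x _|]; [exact: coord_continuous|exact: interval_open].
Qed.

Lemma continuous_measurable_rV (D : set V) (f : V -> R) : open D ->
  {in D, continuous f} -> measurable_fun D f.
Proof.
move=> oD cf; apply: (measurability _ (RGenOpens.measurableE R)) => _ [_ [a [b ->] <-]].
apply: open_measurable_rV.
rewrite openE => x [Dx fx]; apply: filterI; first exact: open_nbhs_nbhs.
apply: (cf x); first by rewrite inE.
by apply: open_nbhs_nbhs; split => //; exact: interval_open.
Qed.

End rV_topology.

Section enorm_theory.
Context {R : realType} {n : nat}.
Local Notation V := 'rV[R]_n.
Implicit Types (x y : V).

Lemma enorm_ge0 x : 0 <= enorm x. Proof. exact: sqrtr_ge0. Qed.

Lemma enorm_sqr x : enorm x ^+ 2 = \sum_(i < n) x ord0 i ^+ 2.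
Proof. by rewrite sqr_sqrtr// sumr_ge0// => i _; exact: sqr_ge0. Qed.

Lemma enormZ (c : R) x : enorm (c *: x) = `|c| * enorm x.
Proof.
rewrite /enorm -sqrtr_sqr -sqrtrM ?sqr_ge0// mulr_sumr.
by under eq_bigr do rewrite mxE exprMn.
Qed.

Lemma enormN x : enorm (- x) = enorm x.
Proof. by rewrite -scaleN1r enormZ normrN1 mul1r. Qed.

Lemma enorm0 : enorm (0 : V) = 0.
Proof. by rewrite -(scale0r (0 : V)) enormZ normr0 mul0r. Qed.

Lemma enorm0_eq0 x : enorm x = 0 -> x = 0.
Proof.
move=> x0; apply/rowP => i; rewrite mxE.
have : enorm x ^+ 2 = 0 by rewrite x0 expr0n.
rewrite enorm_sqr => /eqP; rewrite psumr_eq0 => [/allP/(_ i)|j _]; last exact: sqr_ge0.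
by rewrite mem_index_enum sqrf_eq0 => /(_ isT)/eqP.
Qed.

Lemma coord_le_enorm x i : `|x ord0 i| <= enorm x.
Proof.
rewrite -sqrtr_sqr ler_wsqrtr// (bigD1 i)//= lerDl.
by rewrite sumr_ge0// => j _; exact: sqr_ge0.
Qed.

Lemma enorm_cauchy x y : \sum_(i < n) x ord0 i * y ord0 i <= enorm x * enorm y.
Proof.
have [->|x0] := eqVneq x 0.
  by rewrite enorm0 mul0r big1// => i _; rewrite mxE mul0r.
have [->|y0] := eqVneq y 0.
  by rewrite enorm0 mulr0 big1// => i _; rewrite mxE mulr0.
have ex : 0 < enorm x.
  by rewrite lt_neqAle enorm_ge0 andbT eq_sym; apply: contraNneq x0 => /enorm0_eq0 ->.
have ey : 0 < enorm y.
  by rewrite lt_neqAle enorm_ge0 andbT eq_sym; apply: contraNneq y0 => /enorm0_eq0 ->.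
set a := enorm x in ex *; set b := enorm y in ey *.
have h : \sum_(i < n) (2 * a * b) * (x ord0 i * y ord0 i) <=
   \sum_(i < n) (b ^+ 2 * x ord0 i ^+ 2 + a ^+ 2 * y ord0 i ^+ 2).
  by apply: ler_sum => i _; have := sqr_ge0 (b * x ord0 i - a * y ord0 i); nra.
move: h; rewrite big_split/= -!mulr_sumr -!enorm_sqr -/a -/b => h.
have ab : 0 < 2 * a * b by rewrite !mulr_gt0.
by rewrite -(ler_pM2l ab); nra.
Qed.

Lemma enormD x y : enorm (x + y) <= enorm x + enorm y.
Proof.
rewrite -(@ler_pXn2r _ 2) ?nnegrE ?addr_ge0 ?enorm_ge0// sqrrD !enorm_sqr.
have -> : \sum_i (x + y) ord0 i ^+ 2 = \sum_i x ord0 i ^+ 2 +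
    2 * (\sum_i x ord0 i * y ord0 i) + \sum_i y ord0 i ^+ 2.
  by rewrite mulr_sumr -!big_split; apply: eq_bigr => i _ /=; rewrite mxE; ring.
by rewrite lerD2r lerD2l -[leRHS]mulr_natl ler_wpM2l// enorm_cauchy.
Qed.

Lemma enorm_le_sum x : enorm x <= \sum_(i < n) `|x ord0 i|.
Proof.
rewrite -(@ler_pXn2r _ 2) ?nnegrE ?enorm_ge0 ?sumr_ge0// enorm_sqr expr2 mulr_suml.
apply: ler_sum => i _; rewrite -(ger0_norm (sqr_ge0 (x ord0 i))) normrX expr2 ler_wpM2l// (bigD1 i)//= lerDl.
exact: sumr_ge0.
Qed.

Lemma enorm_continuous : continuous (@enorm R n).
Proof.
move=> x; apply: (@continuous_comp _ _ _ (fun y : V => \sum_(i < n) y ord0 i ^+ 2) (@Num.sqrt R)); last exact: sqrt_continuous.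
have C : continuous (fun y : V => \sum_(i < n) y ord0 i ^+ 2).
  apply: continuous_big => [|i _]; first exact: add_continuous.
  move=> y; apply: (@continuous_comp _ _ _ (fun y : V => y ord0 i) (fun t : R => t ^+ 2)).
    exact: coord_continuous.
  exact: exprn_continuous.
exact: C.
Qed.

Lemma continuous_affine (c : R) (d : V) : continuous (fun x : V => c *: x + d).
Proof.
move=> x; apply: continuousD; last exact: cst_continuous.
exact: scaler_continuous.
Qed.

Lemma continuous_enormB x : continuous (fun y => enorm (y - x)).
Proof.
move=> y; apply: (@continuous_comp _ _ _ (fun y : V => y - x) (@enorm R n)).
  have := @continuous_affine 1 (- x) y.
  by rewrite (_ : (fun z => 1 *: z - x) = (fun z => z - x))//; apply/funext => z; rewrite scale1r.
exact: enorm_continuous.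
Qed.

Lemma eball_open x (r : R) : open (eball x r).
Proof.
apply: (@open_comp _ _ (fun y => enorm (y - x)) [set t | t < r]); last exact: open_lt.
by move=> y _; exact: continuous_enormB.
Qed.

Lemma eball_convex x (r e : R) (y z : V) : 0 <= e -> e <= 1 ->
  eball x r y -> eball x r z -> eball x r ((1 - e) *: y + e *: z).
Proof.
move=> e0 e1; rewrite /eball/= => xy xz.
have -> : (1 - e) *: y + e *: z - x = (1 - e) *: (y - x) + e *: (z - x).
  by rewrite !scalerBr addrACA -opprD -scalerDl subrK scale1r.
apply: le_lt_trans (enormD _ _) _; rewrite !enormZ !ger0_norm ?subr_ge0//.
have [->|en1] := eqVneq e 1; first by rewrite subrr mul0r add0r mul1r.
have : (1 - e) * enorm (y - x) < (1 - e) * r.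
  by rewrite ltr_pM2l// subr_gt0 lt_neqAle en1.
have : e * enorm (z - x) <= e * r by rewrite ler_wpM2l// ltW.
lra.
Qed.

End enorm_theory.

(** * Image measures and affine changes of variables *)

Section scaled_pushforward.
Local Open Scope ereal_scope.
Context d1 d2 (T1 : measurableType d1) (T2 : measurableType d2) (R : realType).
Variables (k : {nonneg R}) (m : {measure set T1 -> \bar R}).
Variables (f : T1 -> T2) (mf : measurable_fun setT f).

(** The measurability proof is an argument so that the measure structure can be attached to the
    definition itself. *)
Definition scaled_pushforward of measurable_fun setT f : set T2 -> \bar R :=
  fun A => k%:num%:E * m (f @^-1` A).
Local Notation spf := (scaled_pushforward mf).

Let sp0 : spf set0 = 0.
Proof. by rewrite /scaled_pushforward preimage_set0 measure0 mule0. Qed.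

Let sp_ge0 A : 0 <= spf A.
Proof. by apply: mule_ge0; rewrite ?lee_fin//; exact: measure_ge0. Qed.

Let sp_sigma_additive : semi_sigma_additive spf.
Proof.
move=> F mF tF mUF; rewrite /scaled_pushforward preimage_bigcup.
rewrite [X in X @ _ --> _](_ : _ = (fun j => k%:num%:E * \sum_(0 <= i < j) m (f @^-1` F i))); last first.
  by apply/funext => j; rewrite ge0_sume_distrr.
apply: cvgeZl => //; apply: measure_semi_sigma_additive.
- by move=> i; rewrite -[X in measurable X]setTI; exact: mf.
- apply/trivIsetP => /= i j _ _ ij; rewrite -preimage_setI.
  by move/trivIsetP : tF => /(_ _ _ _ _ ij) ->//; rewrite preimage_set0.
- by rewrite -preimage_bigcup -[X in measurable X]setTI; exact: mf.
Qed.

HB.instance Definition _ := isMeasure.Build _ _ _ spf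
  sp0 sp_ge0 sp_sigma_additive.

Lemma ge0_integral_scaled_pushforward (g : T2 -> \bar R) :
  measurable_fun setT g -> (forall x, 0 <= g x) ->
  \int[spf]_x g x = k%:num%:E * \int[m]_x g (f x).
Proof.
move=> mg g0.
pose pm : {measure set T2 -> \bar R} := ltac:(unshelve refine [the {measure set T2 -> \bar R} of pushforward m f]; exact: mf).
transitivity (\int[mscale k pm]_x g x).
  exact: eq_measure_integral.
rewrite ge0_integral_mscale//; congr (_ * _).
by rewrite ge0_integral_pushforward// preimage_setT.
Qed.

End scaled_pushforward.

Section affine_change.
Context {R : realType} {n : nat}.
Local Notation V := 'rV[R]_n.
Local Notation mu := (lebesgue_rV R n).
Implicit Types (c : R) (d x : V).

Lemma measurable_affine c d : measurable_fun setT (fun x : V => c *: x + d).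
Proof.
apply: measurable_fun_rVP => i.
under eq_fun do rewrite !mxE.
apply: measurable_funD => //; apply: measurable_funM => //.
exact: measurable_coord.
Qed.

(** By uniqueness of Lebesgue measure only half-open intervals have to be tested. A negative [c]
    exchanges the open and the closed end, hence the two cases. *)
Lemma lebesgue_measure_affine (c d : R) (A : set (measurableTypeR R)) : c != 0 ->
  measurable A ->
  lebesgue_measure A = (`|c|%:E * lebesgue_measure ((fun t => (c * t + d)%R) @^-1` A))%E.
Proof.
move=> c0 mA.
pose phi := fun t : measurableTypeR R => (c * t + d : measurableTypeR R).
have mphi : measurable_fun setT phi.
  by apply: measurable_funD => //; apply: measurable_funM.
pose m := scaled_pushforward (NngNum (normr_ge0 c)) lebesgue_measure mphi.
apply: (@lebesgue_measure_unique _ m) => // _ [[a b] _ <-].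
rewrite -[RHS]/(_ * lebesgue_measure (phi @^-1` _))%E/= !lebesgue_measure_itv/= lte_fin.
have [cgt|clt] : 0 < c \/ c < 0 by case: (ltgtP c 0) c0 => //; [right|left].
- have -> : phi @^-1` [set` `]a, b]%R] = [set` `](a - d) / c, (b - d) / c]%R].
    apply/seteqP; split => t /=; rewrite !in_itv/= ltr_pdivrMr// ler_pdivlMr//;
      by rewrite ltrBlDr lerBrDr mulrC.
  rewrite lebesgue_measure_itv/= lte_fin ltr_pM2r ?invr_gt0// ltrD2r.
  case: ifP => ab; last by rewrite mule0.
  rewrite -!EFinB -EFinM gtr0_norm//; congr EFin; by field; rewrite gt_eqF.
- have -> : phi @^-1` [set` `]a, b]%R] = [set` `[(b - d) / c, (a - d) / c[%R].
    apply/seteqP; split => t /=; rewrite !in_itv/= ltr_ndivlMr// ler_ndivrMr//;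
      by rewrite ltrBlDr lerBrDr mulrC andbC.
  rewrite lebesgue_measure_itv/= lte_fin ltr_nM2r ?invr_lt0// ltrD2r.
  case: ifP => ab; last by rewrite mule0.
  rewrite -!EFinB -EFinM ltr0_norm//; congr EFin; by field; rewrite lt_eqF.
Qed.

Definition rV_box (A : set V) := exists2 B : 'I_n -> set R,
  forall i, measurable (B i) & A = [set x | forall i, B i (x ord0 i)].

Lemma rV_boxI : setI_closed rV_box.
Proof.
move=> _ _ [B mB ->] [C mC ->]; exists (fun i => B i `&` C i).
  by move=> i; exact: measurableI.
by apply/seteqP; split => [x [Bx Cx] i|x BC]; [split|split => i; case: (BC i)].
Qed.

Lemma measurable_rV_box (B : 'I_n -> set R) :
  (forall i, measurable (B i)) -> measurable [set x : V | forall i, B i (x ord0 i)].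
Proof.
move=> mB; rewrite (_ : [set x | _] = \big[setI/setT]_(i < n)
    ((fun x : V => x ord0 i) @^-1` B i)).
  apply: bigsetI_measurable => i _; rewrite -[X in measurable X]setTI.
  by apply: measurable_coord => //; exact: mB.
rewrite -bigcap_seq; apply/seteqP; split => x /= H i.
  by move=> _; exact: H.
by apply: (H i); rewrite /= mem_index_enum.
Qed.

Lemma measurable_rV_boxE : @measurable _ V = <<s rV_box >>.
Proof.
apply/seteqP; split => [A|]; last first.
  apply: smallest_sub; first exact: sigma_algebra_measurable.
  by move=> _ [B mB ->]; exact: measurable_rV_box.
apply: smallest_sub; first exact: smallest_sigma_algebra.
move=> B; rewrite -bigcup_seq/= => -[i _ [C mC <-]].
apply: sub_sigma_algebra; exists (fun j => if j == i then C else setT).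
  by move=> j; case: ifP.
rewrite setTI; apply/seteqP; split => x /=.
  by move=> Cx j; case: eqP => // ->.
by move/(_ i); rewrite eqxx.
Qed.

Definition rV_cube (c : V) (r : R) : set V := [set x | forall i, `|x ord0 i - c ord0 i| < r].

Lemma rV_cubeE (c : V) (r : R) : rV_cube c r =
  [set x | forall i, (`](c ord0 i - r), (c ord0 i + r)[%classic : set R) (x ord0 i)].
Proof.
by apply/seteqP; split => x /= h i; move: (h i); rewrite in_itv/= ltr_distl.
Qed.

Lemma lebesgue_rV_cube (c : V) (r : R) : 0 <= r -> mu (rV_cube c r) = ((2 * r) ^+ n)%:E.
Proof.
move=> r0; rewrite rV_cubeE (@lebesgue_rV_box _ _ (fun i => `](c ord0 i - r), (c ord0 i + r)[%classic)); last by move=> i; exact: measurable_itv.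
under eq_bigr => i _.
  rewrite lebesgue_measure_itv/= lte_fin.
  have -> : (if (c ord0 i - r < c ord0 i + r)%R
    then (c ord0 i + r)%:E - (c ord0 i - r)%:E else 0)%E = (2 * r)%:E.
    case: ltP => h; first by rewrite -EFinB; congr EFin; lra.
    by congr EFin; lra.
  over.
by rewrite big_const card_ord; elim: {+}n => //= k ->; rewrite -EFinM exprS.
Qed.

(** Both sides are measures that agree on boxes, where they are products of one-dimensional
    measures. Boxes form a generating pi-system, and the cubes around 0 exhaust the space with
    finite measure, so uniqueness of measures applies. *)
Lemma lebesgue_rV_affine c d (A : set V) : c != 0 -> measurable A ->
  mu A = ((`|c| ^+ n)%:E * mu ((fun x => c *: x + d)%R @^-1` A))%E.
Proof.
move=> c0 mA.
pose phi := fun x : V => (c *: x + d : V).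
have mphi : measurable_fun setT phi by exact: measurable_affine.
pose m := scaled_pushforward (NngNum (exprn_ge0 n (normr_ge0 c))) mu mphi.
apply: (@measure_unique _ _ _ rV_box (fun k => rV_cube 0 k%:R) measurable_rV_boxE rV_boxI _ _ mu m) => //.
- by move=> k; rewrite rV_cubeE; exists (fun i => `]((0 : V) ord0 i - k%:R), ((0 : V) ord0 i + k%:R)[%classic) => // i; exact: measurable_itv.
- apply/seteqP; split => // x _; exists (Num.truncn (\sum_i `|x ord0 i|)).+1 => //= i.
  rewrite mxE subr0; apply: le_lt_trans (truncnS_gt _).
  by rewrite (bigD1 i)//= lerDl sumr_ge0.
- move=> _ [B mB ->]; rewrite -[RHS]/(_ * mu (phi @^-1` _))%E/= lebesgue_rV_box//.
  have -> : phi @^-1` [set x | forall i, B i (x ord0 i)] =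
     [set x | forall i, ((fun t => c * t + d ord0 i) @^-1` B i) (x ord0 i)].
    by apply/seteqP; split => x /= h i; move: (h i); rewrite !mxE.
  rewrite (@lebesgue_rV_box _ _ (fun i => (fun t => c * t + d ord0 i) @^-1` B i)); last first.
    move=> i; rewrite -[X in measurable X]setTI.
    have mf : measurable_fun setT (fun t : measurableTypeR R => c * t + d ord0 i : measurableTypeR R).
      by apply: measurable_funD => //; apply: measurable_funM.
    exact: (mf measurableT _ (mB i)).
  rewrite (eq_bigr (fun i : 'I_n => (`|c|%:E *
      lebesgue_measure ((fun t : R => (c * t + d ord0 i)%R) @^-1` B i)))%E); last first.
    by move=> i _; exact: (lebesgue_measure_affine (d ord0 i) c0 (mB i)).
  rewrite big_split/= big_const card_ord; congr (_ * _)%E.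
  by elim: {+}n => //= k ->; rewrite -EFinM exprS.
- move=> k; apply: (@le_lt_trans _ _ ((2 * k%:R) ^+ n)%:E); last exact: ltry.
  by rewrite -(lebesgue_rV_cube 0).
Qed.

Section integral_affine.
Variables (c : R) (d : V).
Hypothesis c0 : c != 0.

Lemma ge0_integral_affine (f : V -> \bar R) :
  measurable_fun setT f -> (forall x, 0 <= f x)%E ->
  (\int[mu]_x f x = (`|c| ^+ n)%:E * \int[mu]_x f (c *: x + d)%R)%E.
Proof.
move=> mf f0; pose k := NngNum (exprn_ge0 n (normr_ge0 c)).
rewrite -(@ge0_integral_scaled_pushforward _ _ _ _ _ k mu _ (measurable_affine c d))//.
by apply: eq_measure_integral => A mA _; exact: lebesgue_rV_affine.
Qed.

Lemma integrable_affine (f : V -> \bar R) : mu.-integrable setT f ->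
  mu.-integrable setT (fun x => f (c *: x + d)).
Proof.
move=> /integrableP[mf]; rewrite ge0_integral_affine//; last exact: measurableT_comp.
move=> h; apply/integrableP; split.
  exact: (measurableT_comp mf (measurable_affine c d)).
case: (ltgtP (\int[mu]_x `|f (c *: x + d)%R|)%E +oo%E) => //; first by rewrite ltNge leey.
move=> E; move: h; rewrite E gt0_muley ?ltxx// lte_fin.
by rewrite exprn_gt0// normr_gt0.
Qed.

Lemma integral_affine (f : V -> \bar R) : mu.-integrable setT f ->
  (\int[mu]_x f x = (`|c| ^+ n)%:E * \int[mu]_x f (c *: x + d)%R)%E.
Proof.
move=> intf; have intf' := integrable_affine intf.
have mf := measurable_int _ intf.
rewrite integralE [in RHS]integralE muleBr//; last first.
  by rewrite fin_num_adde_defr//; exact: integrable_pos_fin_num.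
rewrite (@ge0_integral_affine (f^\+)%E)//; last exact: measurable_funepos.
rewrite (@ge0_integral_affine (f^\-)%E)//; last exact: measurable_funeneg.
have -> : ((fun x : V => f (c *: x + d)%R)^\+ = (fun x => f^\+ (c *: x + d)%R))%E.
  exact: (@funepos_comp _ _ _ f (fun x => c *: x + d)).
rewrite (_ : ((fun x : V => f (c *: x + d)%R)^\- = (fun x => f^\- (c *: x + d)%R))%E)//.
exact: (@funeneg_comp _ _ _ f (fun x => c *: x + d)).
Qed.

End integral_affine.

End affine_change.

(** * Smooth kernels *)

Section smooth_functions.
Context {R : realType}.
Implicit Types (f g : R -> R) (k m : nat).

(** Nothing is required at order 0: the functions in use satisfy this for every [k], and continuity
    at one order is read off differentiability at the next. *)
Fixpoint smoothk k f : Prop :=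
  if k is k'.+1 then (forall x, derivable f x 1) /\ smoothk k' (derive1 f)
  else True.

Lemma smoothkW k f : smoothk k.+1 f -> smoothk k f.
Proof.
elim: k f => [//|k IH] f [df sf]; split => //; exact: IH.
Qed.

Lemma smoothkD k f g : smoothk k f -> smoothk k g -> smoothk k (f \+ g).
Proof.
elim: k f g => [//|k IH] f g [df sf] [dg sg]; split.
  by move=> x; exact: derivableD.
rewrite (_ : derive1 _ = derive1 f \+ derive1 g); first exact: IH.
by apply/funext => x; rewrite /= !derive1E deriveD.
Qed.

Lemma smoothkZ k (c : R) f : smoothk k f -> smoothk k (fun x => c * f x).
Proof.
elim: k f => [//|k IH] f [df sf]; split.
  by move=> x; exact: derivableZ.
rewrite (_ : derive1 _ = (fun x => c * derive1 f x)); first exact: IH.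
by apply/funext => x; rewrite /= !derive1E; exact: deriveZ.
Qed.

Lemma smoothkM k f g : smoothk k f -> smoothk k g -> smoothk k (fun x => f x * g x).
Proof.
elim: k f g => [//|k IH] f g sf sg.
have [df sdf] := sf; have [dg sdg] := sg; split.
  by move=> x; exact: derivableM.
rewrite (_ : derive1 _ = (fun x => f x * derive1 g x) \+ (fun x => g x * derive1 f x)).
  by apply: smoothkD; apply: IH => //; exact: smoothkW.
by apply/funext => x; rewrite /= !derive1E; exact: deriveM.
Qed.

Lemma is_derive_affine f (c d x : R) : derivable f (c * x + d) 1 ->
  is_derive x 1 (fun t => f (c * t + d)) (c * derive1 f (c * x + d)).
Proof.
move=> df.
have d1 : is_derive (c * x + d) 1 f (derive1 f (c * x + d)).
  by rewrite derive1E; exact: derivableP.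
have d2 : is_derive x 1 (fun t : R => c * t + d) c.
  have d3 : is_derive x 1 (fun t : R => c * t) c.
    by rewrite -[X in is_derive _ _ _ X]mulr1; exact: is_deriveZ.
  have := @is_deriveD _ _ _ (fun t : R => c * t) (cst d) x 1 c 0 d3 (is_derive_cst _ _ _).
  by rewrite addr0.
rewrite mulrC; exact: (@is_derive1_comp _ f (fun t => c * t + d)).
Qed.

Lemma smoothk_affine k f (c d : R) : smoothk k f -> smoothk k (fun t => f (c * t + d)).
Proof.
elim: k f => [//|k IH] f [df sf]; split.
  by move=> x; have [] := is_derive_affine (df (c * x + d)).
rewrite (_ : derive1 _ = fun x => c * derive1 f (c * x + d)).
  by apply: smoothkZ; exact: IH.
apply/funext => x; rewrite derive1E.
by apply: derive_val; exact: is_derive_affine.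
Qed.

(** The derivative of a member of this family is a linear combination of the next two, so smoothness
    of exp(-1/t) extended by 0 follows by induction over the whole family. *)
Definition expinv k (t : R) := if 0 < t then t ^- k * expR (- t^-1) else 0.

(** One term of the exponential series. Applied to [k.+1], it shows that the difference quotient of
    [expinv k] at 0 tends to 0. *)
Lemma expinv_le k (t : R) : 0 < t -> expinv k t <= (k.+1)`!%:R * t.
Proof.
move=> t0; rewrite /expinv t0.
have := @expR_ge1Dxn R t^-1 k; rewrite invr_ge0 (ltW t0) => /(_ isT) h.
have h2 : t^-1 ^+ k.+1 / (k.+1)`!%:R <= expR t^-1.
  by apply: le_trans h; rewrite lerDr.
have f0 : 0 < (k.+1)`!%:R :> R by rewrite ltr0n fact_gt0.
rewrite expRN ler_pdivrMr ?expR_gt0//.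
move: h2; rewrite ler_pdivrMr// => h2.
rewrite -ler_pdivrMl ?mulr_gt0// invfM.
apply: le_trans (_ : (k.+1`!%:R)^-1 * (t^-1 ^+ k.+1) <= _).
  by rewrite exprS -exprVn; lra.
by rewrite ler_pdivrMl// mulrC.
Qed.

Lemma is_derive_expinv k (t : R) :
  is_derive t 1 (expinv k) (expinv k.+2 t - k%:R * expinv k.+1 t).
Proof.
have [t0|t0|->] := ltgtP t 0.
- apply: (@near_eq_is_derive _ _ _ (cst 0)).
  + near=> y; rewrite /expinv ifF//; apply/negbTE; rewrite -leNgt ltW//.
    by near: y; exact: lt_nbhsl.
  + rewrite /expinv !ifF ?mulr0 ?subr0; first exact: is_derive_cst.
    * by apply/negbTE; rewrite -leNgt ltW.
    * by apply/negbTE; rewrite -leNgt ltW.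
- apply: (@near_eq_is_derive _ _ _ (fun t : R => t ^- k * expR (- t^-1))).
  + near=> y; rewrite /expinv ifT//.
    by near: y; exact: lt_nbhsr.
  + rewrite /expinv t0.
    have xn0 : t ^+ k != 0 by rewrite expf_neq0// gt_eqF.
    have dX : is_derive t 1 (fun y : R => y ^+ k) ((k%:R * t ^+ k.-1) *: (1 : R)).
      have : is_derive t (1 : R) ((id : R -> R) ^+ k) ((k%:R * t ^+ k.-1) *: (1 : R)).
        exact: is_deriveX.
      by rewrite exprfctE.
    have d2 : is_derive t 1 (fun y : R => (y ^+ k)^-1)
        (- (t ^+ k) ^- 2 *: ((k%:R * t ^+ k.-1) *: (1 : R))).
      apply: DeriveDef; first by apply: derivableV => //; case: dX.
      by rewrite deriveV// (@derive_val _ _ _ _ _ _ _ dX).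
    have dV : is_derive t 1 (fun y : R => - y^-1) (t ^- 2).
      rewrite -[X in is_derive _ _ _ X]opprK -[t ^- 2]mulr1 -mulNr.
      apply: is_deriveN; apply: DeriveDef; first by apply: derivableV; rewrite ?gt_eqF.
      by rewrite deriveV ?gt_eqF// derive_id.
    have dE : is_derive t 1 (fun y : R => expR (- y^-1)) (t ^- 2 * expR (- t^-1)).
      rewrite mulrC; exact: (@is_derive1_comp _ expR (fun y : R => - y^-1)).
    rewrite (_ : _ - _ = t ^- k *: (t ^- 2 * expR (- t^-1)) +
       expR (- t^-1) *: (- (t ^+ k) ^- 2 *: ((k%:R * t ^+ k.-1) *: (1 : R)))).
      exact: is_deriveM.
    have t1 : t != 0 by rewrite gt_eqF.
    rewrite /GRing.scale/= mulr1; case: k xn0 {dX d2} => [|k] xn0.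
      by rewrite !expr0 !mul0r mulr0 mulr0 subr0 addr0 invr1 mul1r.
    rewrite !exprS/= in xn0 *; have zn : t ^+ k != 0 by rewrite expf_neq0.
    move: (expR _) (t ^+ k) zn => e z zn; field; rewrite t1 zn //.
- rewrite /expinv ltxx mulr0 subr0.
  suff H : h^-1 *: ((expinv k \o shift 0) (h *: 1) - expinv k 0) @[h --> 0^'] --> (0 : R).
    by apply: DeriveDef; [apply/cvg_ex; exists 0|apply/cvg_lim].
  apply/cvgrPdist_le => e e0; near=> h.
  have hn0 : h != 0 by near: h; exact: nbhs_dnbhs_neq.
  rewrite sub0r normrN /= addr0 /GRing.scale/= mulr1 /expinv ltxx subr0.
  case: ifPn => h0; last by rewrite mulr0 normr0 ltW.
  have := expinv_le k.+1 h0; rewrite /expinv h0 => H.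
  rewrite ger0_norm ?mulr_ge0 ?invr_ge0 ?exprn_ge0 ?expR_ge0 ?(ltW h0)//.
  rewrite mulrA -invfM -exprS; apply: (le_trans H).
  rewrite -ler_pdivlMl ?ltr0n ?fact_gt0//.
  apply: le_trans (ler_norm h) _; rewrite ltW//.
  near: h; apply: dnbhs0_lt; rewrite mulr_gt0// invr_gt0 ltr0n fact_gt0//.
Unshelve. all: by end_near. Qed.

Lemma smoothk_expinv m k : smoothk m (expinv k).
Proof.
elim: m k => [//|m IH] k; split.
  by move=> x; have [] := is_derive_expinv k x.
rewrite (_ : derive1 _ = (fun t => expinv k.+2 t) \+ (fun t => - (k%:R : R) * expinv k.+1 t)).
  by apply: smoothkD; [exact: IH|apply: smoothkZ; exact: IH].
by apply/funext => x; rewrite derive1E (@derive_val _ _ _ _ _ _ _ (is_derive_expinv k x)) /= mulNr.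
Qed.

Definition bump1 (t : R) := expinv 0 (t + 1) * expinv 0 (1 - t).

Lemma smoothk_bump1 m : smoothk m bump1.
Proof.
rewrite (_ : bump1 = fun t => expinv 0 (1 * t + 1) * expinv 0 (-1 * t + 1)).
  by apply: smoothkM; apply: smoothk_affine; exact: smoothk_expinv.
by apply/funext => t; rewrite /bump1 mul1r mulN1r (addrC (-t)).
Qed.

Lemma bump1_ge0 t : 0 <= bump1 t.
Proof. by rewrite /bump1 /expinv mulr_ge0//; case: ifP => // _; rewrite expr0 invr1 mul1r expR_ge0. Qed.

Lemma bump1_gt0 t : (0 < bump1 t) = (`|t| < 1).
Proof.
rewrite ltr_norml /bump1 /expinv subr_gt0 -ltrBlDr sub0r.
case: ifP => h1; case: ifP => h2 /=; rewrite ?mulr0 ?mul0r ?ltxx ?andbF//.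
by rewrite !expr0 invr1 !mul1r mulr_gt0 ?expR_gt0.
Qed.

Lemma bump1_neq0 t : (bump1 t != 0) = (`|t| < 1).
Proof. by rewrite -bump1_gt0 lt_neqAle bump1_ge0 andbT eq_sym. Qed.

Lemma bump1N t : bump1 (- t) = bump1 t.
Proof. by rewrite /bump1 opprK mulrC addrC (addrC (-t)). Qed.

End smooth_functions.

Section Ck_theory.
Context {R : realType} {n : nat}.
Local Notation V := 'rV[R]_n.
Implicit Types (phi : V -> R) (x y d : V).

Lemma cvg_mulr_dnbhs0 (c : R) : c != 0 -> c * s @[s --> 0^'] --> (0 : R)^'.
Proof.
move=> c0 A [e /= e0 eA]; exists (e / `|c|) => /=; first by rewrite divr_gt0 ?normr_gt0.
move=> s /=; rewrite sub0r normrN => se s0; apply: eA => /=; last by rewrite mulf_neq0.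
by rewrite sub0r normrN normrM mulrC -ltr_pdivlMr ?normr_gt0.
Qed.

(** Proved on difference quotients because only derivability in the single direction [e] is assumed;
    multiplication by [c] preserves the punctured neighbourhoods of 0. *)
Lemma is_derive_comp_affine phi (c : R) d x (e : V) : c != 0 ->
  derivable phi (c *: x + d) e ->
  is_derive x e (fun y => phi (c *: y + d)) (c * 'D_e phi (c *: x + d)).
Proof.
move=> c0 df.
suff H : h^-1 *: (((fun y => phi (c *: y + d)) \o shift x) (h *: e) - phi (c *: x + d))
    @[h --> 0^'] --> c * 'D_e phi (c *: x + d).
  by apply: DeriveDef; [apply/cvg_ex; eexists; exact: H|apply/cvg_lim].
have H0 : h^-1 *: ((phi \o shift (c *: x + d)) (h *: e) - phi (c *: x + d))
    @[h --> 0^'] --> 'D_e phi (c *: x + d) by exact: df.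
have := cvgM (cvg_cst c) (cvg_comp _ _ (cvg_mulr_dnbhs0 c0) H0).
move=> /(_ (dnbhs_filter _) (dnbhs_filter _)).
apply: cvg_trans; apply: near_eq_cvg; near=> h.
have hn0 : h != 0 by near: h; exact: nbhs_dnbhs_neq.
rewrite /= /GRing.scale/= invfM mulrA mulrA divff// mul1r; congr (_ * (phi _ - _)).
by apply/rowP => j; rewrite !mxE; ring.
Unshelve. all: by end_near. Qed.

Lemma C_k_continuous k phi : C_k k phi -> continuous phi.
Proof. by case: k => [|k] []. Qed.

Lemma C_kZ k phi (c : R) : C_k k phi -> C_k k (fun x => c * phi x).
Proof.
elim: k phi => [|k IH] f [cf Hf]; split => //.
- by move=> x; apply: continuousM; [exact: cst_continuous|exact: cf].
- by move=> x; apply: continuousM; [exact: cst_continuous|exact: cf].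
- move=> i; have [df sf] := Hf i; split; first by move=> x; exact: derivableZ.
  rewrite (_ : partial_derive i _ = (fun x => c * partial_derive i f x)); first exact: IH.
  by apply/funext => x; exact: deriveZ.
Qed.

Lemma C_k_comp_affine k phi (c : R) d : c != 0 -> C_k k phi ->
  C_k k (fun y => phi (c *: y + d)).
Proof.
move=> c0.
elim: k phi => [|k IH] phi [cf Hf]; split => //.
- by move=> x; apply: (@continuous_comp _ _ _ (fun y : V => c *: y + d) phi); [exact: continuous_affine|exact: cf].
- by move=> x; apply: (@continuous_comp _ _ _ (fun y : V => c *: y + d) phi); [exact: continuous_affine|exact: cf].
- move=> i; have [df sf] := Hf i; split.
    by move=> x; have [] := is_derive_comp_affine c0 (df (c *: x + d)).
  rewrite (_ : partial_derive i _ = (fun y => c * partial_derive i phi (c *: y + d))).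
    by apply: C_kZ; exact: IH.
  by apply/funext => y; apply: derive_val; exact: is_derive_comp_affine.
Qed.

Definition prodf (h : 'I_n -> R -> R) x := \prod_i h i (x ord0 i).

Lemma continuous_prodf h : (forall i, continuous (h i)) -> continuous (prodf h).
Proof.
move=> ch; apply: continuous_big => [|i _ x]; first exact: mul_continuous.
apply: (@continuous_comp _ _ _ (fun y : V => y ord0 i) (h i)); last exact: ch.
exact: coord_continuous.
Qed.

Lemma is_derive_prodf h i x : derivable (h i) (x ord0 i) 1 ->
  is_derive x (delta_mx ord0 i) (prodf h)
    (prodf (fun j => if j == i then derive1 (h i) else h j) x).
Proof.
move=> dh.
set w := prodf _ _.
suff H : t^-1 *: ((prodf h \o shift x) (t *: delta_mx ord0 i) - prodf h x)
    @[t --> 0^'] --> w.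
  by apply: DeriveDef; [apply/cvg_ex; eexists; exact: H|apply/cvg_lim].
have -> : w = (\prod_(j < n | j != i) h j (x ord0 j)) * 'D_1 (h i) (x ord0 i).
  rewrite /w /prodf (bigD1 i)//= eqxx derive1E mulrC; congr (_ * _).
  by apply: eq_bigr => j /negbTE ->.
have H0 : t^-1 *: ((h i \o shift (x ord0 i)) (t *: 1) - h i (x ord0 i))
    @[t --> 0^'] --> 'D_1 (h i) (x ord0 i) by exact: dh.
have := cvgM (cvg_cst (\prod_(j < n | j != i) h j (x ord0 j))) H0.
move=> /(_ (dnbhs_filter _) (dnbhs_filter _)).
apply: cvg_trans; apply: near_eq_cvg; near=> t.
rewrite /= /GRing.scale/= mulr1 mulrCA; congr (_ * _).
have E y : prodf h y = (\prod_(j < n | j != i) h j (y ord0 j)) * h i (y ord0 i).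
  by rewrite /prodf (bigD1 i)//= mulrC.
rewrite !E mulrBr !mxE !eqxx mulr1; congr (_ * _ - _).
by apply: eq_bigr => j ji; rewrite !mxE (negbTE ji) mulr0 add0r.
Unshelve. all: by end_near. Qed.

(** A partial derivative of a tensor product is a tensor product with one factor differentiated, so
    the induction stays within the class. *)
Lemma C_k_prodf k h : (forall i m, smoothk m (h i)) -> C_k k (prodf h).
Proof.
have ch (g : 'I_n -> R -> R) : (forall i m, smoothk m (g i)) -> continuous (prodf g).
  move=> sg; apply: continuous_prodf => i t.
  by have [dg _] := sg i 1%N; exact/differentiable_continuous/derivable1_diffP.
elim: k h => [|k IH] h sh; first by split; [exact: ch|].
split; first exact: ch.
move=> i; have [dh _] := sh i 1%N; split.
  by move=> x; have [] := @is_derive_prodf h i x (dh _).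
rewrite (_ : partial_derive i _ = prodf (fun j => if j == i then derive1 (h i) else h j)).
  by apply: IH => j m; case: ifP => // _; have [] := sh i m.+1.
by apply/funext => x; apply: derive_val; exact: is_derive_prodf.
Qed.

End Ck_theory.

(** * Test functions and the averaging kernel *)

Section test_functions.
Context {R : realType} {n : nat}.
Local Notation V := 'rV[R]_n.
Local Notation mu := (lebesgue_rV R n).
Implicit Types (U : set V) (phi : V -> R) (x y d : V).

Lemma compactly_containedS (A B U W : set V) : A `<=` B -> U `<=` W ->
  compactly_contained B U -> compactly_contained A W.
Proof.
move=> AB UW [cB BU]; have AB' := closure_subset AB; split.
  exact: (subclosed_compact (@closed_closure _ _) cB AB').
by move=> x /AB' /BU /UW.
Qed.

Lemma compactly_containedW (A U : set V) : compactly_contained A U -> A `<=` U.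
Proof. by move=> [_ AU] x Ax; apply: AU; exact: subset_closure. Qed.

Lemma test_functionS U W phi : U `<=` W -> test_function U phi -> test_function W phi.
Proof. by move=> UW [sphi cphi]; split => //; apply: compactly_containedS cphi. Qed.

Lemma test_function_out U phi x : test_function U phi -> ~ U x -> phi x = 0.
Proof.
move=> [_ /compactly_containedW pU] Ux; apply/eqP; apply: contrapT => /negP.
by move/pU.
Qed.

Lemma test_function_measurable U phi : test_function U phi -> measurable_fun setT phi.
Proof.
move=> [/(_ 0%N)/C_k_continuous cphi _].
by apply: continuous_measurable_rV => [|x _]; [exact: openT|exact: cphi].
Qed.

Lemma test_function_bounded U phi : test_function U phi ->
  exists M, forall x, `|phi x| <= M.
Proof.
move=> [/(_ 0%N)/C_k_continuous cphi [cS _]].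
have : compact (phi @` closure [set x | phi x != 0]).
  by apply: continuous_compact => //; exact: continuous_subspaceT.
move=> /compact_bounded[M [_ HM]]; exists (Num.max (M + 1) 0) => x.
rewrite le_max; have [->|px] := eqVneq (phi x) 0; first by rewrite normr0 lexx orbT.
apply/orP; left; apply: HM; first by rewrite ltrDl.
by exists x => //; exact: subset_closure.
Qed.

Lemma test_function_partial U phi i : test_function U phi ->
  test_function U (partial_derive i phi).
Proof.
move=> [sphi cphi]; split.
  by move=> k; have [_ /(_ i)[]] := sphi k.+1.
have [cS SU] := cphi.
have : compactly_contained (closure [set x | phi x != 0]) U.
  by split; rewrite -(closure_id _).1//; exact: closed_closure.
apply: compactly_containedS => // x /=; apply: contraNP => xS.
have /nbhs_ballP : \forall y \near x, phi y = 0.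
  have := @closed_closure V [set x | phi x != 0]; rewrite -openC openE => /(_ x xS).
  apply: filterS => y yS; apply/eqP; apply: contrapT => /negP py.
  by apply: yS; exact: subset_closure.
move=> /nbhs_ballP xphi; apply/eqP; apply: derive_val.
apply: (@near_eq_is_derive R V R (cst 0)).
  by apply: filterS xphi => y ->.
Qed.

Lemma test_function_comp_affine U W phi (c : R) d : c != 0 -> test_function U phi ->
  (forall y, U (c *: y + d) -> W y) ->
  test_function W (fun y => phi (c *: y + d)).
Proof.
move=> c0 [sphi [cS SU]] UW; split; first by move=> k; exact: C_k_comp_affine.
pose g (z : V) := c^-1 *: z + - (c^-1 *: d).
have gK y : g (c *: y + d) = y.
  by rewrite /g scalerDr scalerA mulVf// scale1r addrK.
have Kg y : c *: g y + d = y.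
  by rewrite /g scalerDr scalerN !scalerA divff// !scale1r subrK.
have cg : compact (g @` closure [set x | phi x != 0]).
  by apply: continuous_compact => //; apply: continuous_subspaceT; exact: continuous_affine.
have clg : closed (g @` closure [set x | phi x != 0]).
  by apply: compact_closed => //; exact: norm_hausdorff.
have S'g : closure [set y | phi (c *: y + d) != 0] `<=` g @` closure [set x | phi x != 0].
  rewrite [X in _ `<=` X](closure_id _).1//; apply: closure_subset => y /= py.
  by exists (c *: y + d) => //; exact: subset_closure.
split; first exact: (subclosed_compact (@closed_closure _ _) cg S'g).
by move=> y /S'g[z zS <-]; apply: UW; rewrite Kg; exact: SU.
Qed.

Lemma compact_closed_cube x (k : R) : compact [set y : V | forall i, `|y ord0 i - x ord0 i| <= k].
Proof.
have -> : [set y : V | forall i, `|y ord0 i - x ord0 i| <= k] =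
    [set y : V | forall i, `[x ord0 i - k, x ord0 i + k]%classic (y ord0 i)].
  by apply/seteqP; split => y /= h i; move: (h i); rewrite in_itv/= ler_distl.
by apply: (@rV_compact _ n (fun i => `[x ord0 i - k, x ord0 i + k]%classic)) => i; exact: segment_compact.
Qed.

Lemma integrable_bounded_support (A : set V) (f : V -> R) (M : R) :
  measurable A -> (mu A < +oo)%E -> measurable_fun setT f ->
  (forall x, `|f x| <= M) -> (forall x, ~ A x -> f x = 0) ->
  mu.-integrable setT (EFin \o f).
Proof.
move=> mA Aoo mf fM f0.
have -> : EFin \o f = (EFin \o f) \_ A.
  apply/funext => x; rewrite patchE; case: ifPn => // /negP; rewrite inE => /f0.
  by move=> /= ->.
apply/(integrable_mkcond _ mA).1; apply: measurable_bounded_integrable => //.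
  exact: measurable_funS mf.
exists M; split; first exact: num_real.
by move=> M' MM' x _; apply: le_trans (fM x) (ltW MM').
Qed.

(** The half-side is r / (n + 1) instead of r / n: on the closed cube the Euclidean norm is at most
    n k < r, so even the closure fits in the open ball. *)
Lemma closure_cube_eball x (k r : R) : n.+1%:R * k = r -> 0 < r ->
  compactly_contained [set y : V | forall i, `|y ord0 i - x ord0 i| < k] (eball x r).
Proof.
move=> nkr r0.
have k0 : 0 < k by rewrite -(pmulr_rgt0 _ (ltr0Sn R n)) nkr.
have cc := @compact_closed_cube x k.
have sub : closure [set y : V | forall i, `|y ord0 i - x ord0 i| < k] `<=`
    [set y : V | forall i, `|y ord0 i - x ord0 i| <= k].
  rewrite [X in _ `<=` X](closure_id _).1; last first.
    by apply: compact_closed => //; exact: norm_hausdorff.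
  by apply: closure_subset => y /= h i; exact: ltW.
split; first exact: (subclosed_compact (@closed_closure _ _) cc sub).
move=> y /sub /= h; rewrite /eball/=; apply: le_lt_trans (enorm_le_sum _) _.
apply: (@le_lt_trans _ _ (\sum_(i < n) k)).
  by apply: ler_sum => i _; rewrite !mxE.
by rewrite sumr_const card_ord -mulr_natl -nkr ltr_pM2r// ltr_nat.
Qed.

(** A product of one-dimensional bumps on a small cube, divided by its integral. The symmetry about
    [x] comes from [bump1] being even and will give the partial derivatives mean zero. *)
Lemma exists_kernel x (r : R) : 0 < r -> exists rho : V -> R,
  [/\ test_function (eball x r) rho, forall w, 0 <= rho w,
      (\int[mu]_w (rho w)%:E = 1)%E & forall w, rho (x + x - w) = rho w].
Proof.
move=> r0; pose k := r / n.+1%:R.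
have k0 : 0 < k by rewrite divr_gt0.
have nk : n.+1%:R * k = r by rewrite mulrC divfK.
pose h i t := @bump1 R (k^-1 * t + - (k^-1 * x ord0 i)).
pose rho0 := prodf h.
have hge0 i t : 0 <= h i t by exact: bump1_ge0.
have rho0_ge0 w : 0 <= rho0 w by apply: prodr_ge0.
have rho0E w : (rho0 w != 0) = [forall i, `|w ord0 i - x ord0 i| < k].
  rewrite /rho0 /prodf; apply/prodf_neq0/forallP => H i; move: (H i).
    move=> /(_ isT); rewrite /h bump1_neq0 -mulrBr normrM gtr0_norm ?invr_gt0//.
    by rewrite mulrC ltr_pdivrMr// mul1r.
  rewrite /h bump1_neq0 -mulrBr normrM gtr0_norm ?invr_gt0//.
  by rewrite mulrC ltr_pdivrMr// mul1r.
have Ck0 m : C_k m rho0.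
  by apply: C_k_prodf => i p; apply: smoothk_affine; exact: smoothk_bump1.
have trho0 : test_function (eball x r) rho0.
  split => //; apply: compactly_containedS (@closure_cube_eball x k r nk r0) => // w /=.
  by rewrite rho0E => /forallP.
have [M hM] := test_function_bounded trho0.
have mrho0 := test_function_measurable trho0.
have mcube : measurable (rV_cube x k).
  by rewrite rV_cubeE; apply: (@measurable_rV_box _ _ (fun i => `](x ord0 i - k), (x ord0 i + k)[%classic)) => i; exact: measurable_itv.
have mucube := lebesgue_rV_cube x (ltW k0).
have irho0 : mu.-integrable setT (EFin \o rho0).
  apply: (integrable_bounded_support mcube _ mrho0 hM) => [|w wk].
    by rewrite mucube ltry.
  apply/eqP; apply: contrapT => /negP; rewrite rho0E => /forallP; exact: wk.
have [I IE] : exists I : R, (\int[mu]_w (rho0 w)%:E = I%:E)%E.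
  by exists (fine (\int[mu]_w (rho0 w)%:E)); rewrite fineK//; exact: integrable_fin_num.
(* If the integral were 0, the nonnegative [rho0] would vanish almost everywhere, although it is
   nonzero on a cube of positive measure. *)
have I0 : 0 < I.
  rewrite lt_neqAle -lee_fin -IE integral_ge0//; last first.
    by move=> w _; rewrite lee_fin.
  rewrite andbT; apply/eqP => I0.
  have : ae_eq mu setT (EFin \o rho0) (cst 0%E).
    apply/(ae_eq_integral_abs mu measurableT); first exact/measurable_EFinP.
    rewrite -[RHS]/(0%:E) I0 -IE; apply: eq_integral => w _ /=.
    by rewrite ger0_norm.
  move=> /(negligibleS _) => H.
  have : mu.-negligible (rV_cube x k).
    apply: H => w wk /=; apply/not_implyP; split => // -[] /eqP.
    by apply/negP; rewrite rho0E; apply/forallP.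
  move=> nk0; have : mu (rV_cube x k) = 0%E by exact/negligibleP.
  rewrite mucube => -[] /eqP.
  by rewrite expf_eq0 mulf_eq0 (gt_eqF k0) pnatr_eq0 andbF.
exists (fun w => I^-1 * rho0 w); split.
- split; first by move=> m; exact: C_kZ.
  have [_] := trho0; apply: compactly_containedS => // w /=.
  by apply: contraNN => /eqP ->; rewrite mulr0.
- by move=> w; rewrite mulr_ge0// invr_ge0 ltW.
- under eq_integral do rewrite EFinM.
  rewrite integralZl//= IE -EFinM mulVf//; by rewrite gt_eqF.
- move=> w; congr (_ * _); apply: eq_bigr => i _; rewrite /h !mxE -bump1N; congr bump1.
  ring.
Qed.

End test_functions.

(** * Integration and continuity of dilations in L1 *)

Section Rintegral_calculus.
Context d (T : measurableType d) (R : realType) (mu : {measure set T -> \bar R}).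
Implicit Types f g : T -> R.
Local Notation intg f := (mu.-integrable setT (EFin \o f)).

Lemma intg_measurable f : intg f -> measurable_fun setT f.
Proof. by move=> /measurable_int/measurable_EFinP. Qed.

Lemma intgD f g : intg f -> intg g -> intg (fun x => f x + g x).
Proof. by move=> h1 h2; have := integrableD measurableT h1 h2; apply: eq_integrable. Qed.

Lemma intgB f g : intg f -> intg g -> intg (fun x => f x - g x).
Proof. by move=> h1 h2; have := integrableB measurableT h1 h2; apply: eq_integrable. Qed.

Lemma intgZ f (c : R) : intg f -> intg (fun x => c * f x).
Proof. by move=> h1; have := integrableZl measurableT c h1; apply: eq_integrable. Qed.

Lemma intg_norm f : intg f -> intg (fun x => `|f x|).
Proof. by move=> h1; have := integrable_abse h1; apply: eq_integrable. Qed.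

Lemma intg_le f g : measurable_fun setT f -> (forall x, `|f x| <= g x) -> intg g -> intg f.
Proof.
move=> mf fg; apply: le_integrable => //; first exact/measurable_EFinP.
by move=> x _; rewrite lee_fin (le_trans (fg x))// ler_norm.
Qed.

Lemma intgM f g (M : R) : measurable_fun setT g -> (forall x, `|g x| <= M) ->
  intg f -> intg (fun x => f x * g x).
Proof.
move=> mg gM intf.
apply: (@intg_le _ (fun x => M * `|f x|)).
- by apply: measurable_funM => //; exact: intg_measurable.
- by move=> x; rewrite normrM mulrC ler_wpM2r.
- exact/intgZ/intg_norm.
Qed.

Lemma intg_sum (I : Type) (s : seq I) (F : I -> T -> R) :
  (forall i, intg (F i)) -> intg (fun x => \sum_(i <- s) F i x).
Proof.
move=> hF; elim: s => [|i s IH].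
  under [X in _.-integrable _ (_ \o X)]eq_fun do rewrite big_nil.
  exact: integrable0.
under [X in _.-integrable _ (_ \o X)]eq_fun do rewrite big_cons.
exact: intgD.
Qed.

Lemma EFin_Rintegral f : intg f -> (\int[mu]_x f x)%:E = (\int[mu]_x (f x)%:E)%E.
Proof. by move=> intf; rewrite /Rintegral fineK//; exact: integrable_fin_num. Qed.

Lemma norm_Rintegral_le_ae f g : intg f -> intg g -> {ae mu, forall x, `|f x| <= g x} ->
  `|\int[mu]_x f x| <= \int[mu]_x g x.
Proof.
move=> intf intgg fg; apply: le_trans (le_normr_Rintegral _ _) _ => //.
have intn := intg_norm intf; have intgn := intg_norm intgg.
apply: (@le_trans _ _ (\int[mu]_x `|g x|)).
  rewrite -lee_fin !EFin_Rintegral//; apply: ae_ge0_le_integral => //.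
  - exact: (measurable_int _ intn).
  - exact: (measurable_int _ intgn).
  - by apply: filterS fg => x h _; rewrite lee_fin; exact: le_trans (ler_norm _).
rewrite le_eqVlt; apply/orP; left; apply/eqP.
apply: EFin_inj; rewrite !EFin_Rintegral//; apply: ae_eq_integral => //.
- exact: (measurable_int _ intgn).
- exact: (measurable_int _ intgg).
- by apply: filterS fg => x h _; rewrite ger0_norm//; exact: le_trans h.
Qed.

Lemma norm_Rintegral_le f g : intg f -> intg g -> (forall x, `|f x| <= g x) ->
  `|\int[mu]_x f x| <= \int[mu]_x g x.
Proof. by move=> ? ? ?; apply: norm_Rintegral_le_ae => //; exact: aeW. Qed.

Lemma dominated_Rintegral (f_ : nat -> T -> R) f g :
  (forall k, measurable_fun setT (f_ k)) -> measurable_fun setT f ->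
  {ae mu, forall x, f_ ^~ x @ \oo --> f x} -> intg g ->
  {ae mu, forall x, forall k, `|f_ k x| <= g x} ->
  [/\ intg f, \int[mu]_x `|f_ k x - f x| @[k --> \oo] --> 0 &
      \int[mu]_x f_ k x @[k --> \oo] --> \int[mu]_x f x].
Proof.
move=> mf_ mf f_f intg' fg.
have [] := @dominated_convergence _ T R mu setT measurableT
  (fun k => EFin \o f_ k) (EFin \o f) (EFin \o g).
- by move=> k; exact/measurable_EFinP.
- exact/measurable_EFinP.
- by apply: filterS f_f => x h _; apply: cvg_EFin => //; exact: nearW.
- exact: intg'.
- by apply: filterS fg => x h k _; rewrite lee_fin.
move=> intf h1 h2; split => //.
- exact: (fine_cvg h1).
- move: h2; rewrite -EFin_Rintegral//; exact: fine_cvg.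
Qed.

End Rintegral_calculus.

Section L1_continuity.
Import HBSimple.
Context {R : realType} {n : nat}.
Local Notation V := 'rV[R]_n.
Local Notation mu := (lebesgue_rV R n).
Local Notation intg f := (mu.-integrable setT (EFin \o f)).
Implicit Types (f g : V -> R) (x w : V).

Lemma Rintegral_affine (c : R) w f : c != 0 -> intg f ->
  \int[mu]_x f x = `|c| ^+ n * \int[mu]_x f (c *: x + w).
Proof.
move=> c0 intf; apply: EFin_inj; rewrite EFinM !EFin_Rintegral//.
  exact: integral_affine.
exact: (integrable_affine _ c0 intf).
Qed.

Lemma intg_affine (c : R) w f : c != 0 -> intg f -> intg (fun x => f (c *: x + w)).
Proof. by move=> c0 intf; exact: (integrable_affine _ c0 intf). Qed.

Lemma open_rV_cube (c : V) (r : R) : open (rV_cube c r).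
Proof.
have [r0|r0] := ltP 0 r; last first.
  case: n c => [|m] c.
    rewrite (_ : rV_cube c r = setT); first exact: openT.
    by apply/seteqP; split => // x _ [].
  rewrite (_ : rV_cube c r = set0); first exact: open0.
  apply/seteqP; split => // x /(_ ord0); rewrite ltNge => /negP; apply.
  exact: le_trans r0 (normr_ge0 _).
rewrite (_ : rV_cube c r = ball c r); first exact: ball_open.
by apply/seteqP; split => x /=; rewrite rV_ballP// => h i; rewrite distrC.
Qed.

Variables (e : nat -> R) (w : V).
Hypotheses (e0 : forall k, 0 < e k) (e1 : forall k, e k <= 2^-1).
Hypothesis ecvg : e @ \oo --> 0.

Let A k x := (1 - e k) *: x + e k *: w.
Let osc k f := \int[mu]_x `|f (A k x) - f x|.
(** This class is shown to be linear and closed under L1 limits and to contain the indicators of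
    open sets of finite measure; Dynkin's lemma and simple functions then exhaust L1. *)
Let osc0 f := osc ^~ f @ \oo --> 0.

Let ec k : 0 < 1 - e k. Proof. by have := e1 k; lra. Qed.
Let ecn k : 1 - e k != 0. Proof. by rewrite gt_eqF. Qed.

Let cvgA x : A ^~ x @ \oo --> x.
Proof.
have e1' : (1 - e k) @[k --> \oo] --> 1 - (0 : R) by apply: cvgB => //; exact: cvg_cst.
have := cvgD (cvgZ e1' (cvg_cst x)) (cvgZ ecvg (cvg_cst w)).
by rewrite subr0 scale1r scale0r addr0; apply.
Qed.

Let intgA k f : intg f -> intg (fun x => f (A k x)).
Proof. exact: intg_affine. Qed.

Let oscE k f : intg f -> intg (fun x => `|f (A k x) - f x|).
Proof. by move=> intf; apply/intg_norm/intgB => //; exact: intgA. Qed.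

Let osc_ge0 k f : 0 <= osc k f.
Proof. by apply: Rintegral_ge0 => x _. Qed.

(** As [e k <= 2^-1], the factor (1 - e)^-n of the change of variables is at most 2^n. This bound,
    uniform in [k], is what makes the class closed under L1 limits. *)
Let RintA k f : intg f -> (forall x, 0 <= f x) ->
  \int[mu]_x f (A k x) <= 2 ^+ n * \int[mu]_x f x.
Proof.
move=> intf f0; rewrite (Rintegral_affine (e k *: w) (ecn k) intf) mulrA ler_peMl//.
  by apply: Rintegral_ge0.
rewrite -exprMn exprn_ege1// ger0_norm ?(ltW (ec k))//.
by have := e1 k; lra.
Qed.

Let osc_le k f : intg f -> osc k f <= (2 ^+ n + 1) * \int[mu]_x `|f x|.
Proof.
move=> intf; have intn := intg_norm intf.
apply: (@le_trans _ _ (\int[mu]_x (`|f (A k x)| + `|f x|))).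
  apply: le_Rintegral => //; [exact: oscE|apply: intgD => //; exact: (intgA k intn)|].
  by move=> x _; exact: ler_normB.
rewrite RintegralD//; last exact: (intgA k intn).
by rewrite mulrDl mul1r lerD2r; apply: RintA.
Qed.

Let osc_tri k f g : intg f -> intg g ->
  osc k f <= osc k g + (2 ^+ n + 1) * \int[mu]_x `|f x - g x|.
Proof.
move=> intf intg'; have intfg := intgB intf intg'.
apply: le_trans (lerD (lexx _) (osc_le k intfg)).
rewrite -RintegralD//; [|exact: oscE|exact: (oscE k intfg)].
apply: le_Rintegral => //; [exact: oscE|apply: intgD; exact: oscE|].
move=> x _; apply: le_trans (ler_normD _ _); rewrite le_eqVlt; apply/orP; left.
by apply/eqP; congr `|_|; ring.
Qed.

Let osc0_dense f : intg f ->
  (forall d, 0 < d -> exists2 g, intg g /\ osc0 g & \int[mu]_x `|f x - g x| <= d) ->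
  osc0 f.
Proof.
move=> intf H; apply/cvgrPdist_le => d d0.
have c0 : 0 < 2 ^+ n + 1 :> R by rewrite addr_gt0// exprn_gt0.
have [g [intg' og] gd] := H (d / 2 / (2 ^+ n + 1)) ltac:(by rewrite !divr_gt0).
move/cvgrPdist_le : og => /(_ (d / 2) ltac:(by rewrite divr_gt0)).
apply: filterS => k; rewrite !sub0r !normrN !ger0_norm// => ok.
apply: le_trans (osc_tri k intf intg') _; rewrite (splitr d) lerD//.
by rewrite mulrC -ler_pdivlMr.
Qed.

Let osc0D f g : intg f -> intg g -> osc0 f -> osc0 g -> osc0 (fun x => f x + g x).
Proof.
move=> intf intg' hof hog.
apply: (@squeeze_cvgr _ _ _ _ (cst 0) (fun k => osc k f + osc k g)).
- apply: nearW => k; rewrite osc_ge0/= -RintegralD//; [|exact: oscE|exact: oscE].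
  apply: le_Rintegral => //; [apply: oscE; exact: intgD|apply: intgD; exact: oscE|].
  move=> x _; apply: le_trans (ler_normD _ _); rewrite le_eqVlt; apply/orP; left.
  by apply/eqP; congr `|_|; ring.
- exact: cvg_cst.
- by have := cvgD hof hog; rewrite addr0; apply.
Qed.

Let osc0Z f (c : R) : intg f -> osc0 f -> osc0 (fun x => c * f x).
Proof.
move=> intf hof.
have E k : osc k (fun x => c * f x) = `|c| * osc k f.
  rewrite -RintegralZl//; last exact: oscE.
  by apply: eq_Rintegral => x _; rewrite -mulrBr normrM.
rewrite /osc0; under eq_fun do rewrite E.
by have := cvgM (cvg_cst `|c|) hof; rewrite mulr0; apply.
Qed.

Let osc0_sum (I : Type) (s : seq I) (F : I -> V -> R) :
  (forall i, intg (F i)) -> (forall i, osc0 (F i)) ->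
  osc0 (fun x => \sum_(i <- s) F i x).
Proof.
move=> iF oF; elim: s => [|i s IH].
  rewrite /osc0 /osc (_ : (fun k => _) = cst 0); first exact: cvg_cst.
  apply/funext => k; under eq_Rintegral do rewrite !big_nil subrr normr0.
  by rewrite Rintegral_cst// mul0r.
under [X in osc0 X]eq_fun do rewrite big_cons.
by apply: osc0D => //; exact: intg_sum.
Qed.

Let indic_intg (E : set V) : measurable E -> (mu E < +oo)%E -> intg (\1_E : V -> R).
Proof.
move=> mE Eoo; apply: (@integrable_bounded_support _ _ E _ 1 mE Eoo) => [|x|x Ex].
- exact: measurable_indic.
- by rewrite indicE normr_nat lern1; case: (_ \in _).
- by rewrite indicE memNset.
Qed.

(** For a function with values 0 and 1, |f(A) - f| = f(A) + f - 2 f f(A). The integral of f(A) is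
    computed by change of variables; the product is dominated by f and converges pointwise, as only
    points of the open set [U] matter for it. *)
Let osc0_open (U : set V) : open U -> (mu U < +oo)%E -> osc0 (\1_U : V -> R).
Proof.
move=> oU Uoo.
have mU := open_measurable_rV oU.
have iU := indic_intg mU Uoo.
pose f := (\1_U : V -> R).
have f01 x : f x = 0 \/ f x = 1 by rewrite /f indicE; case: (_ \in _); [right|left].
have mfA k : measurable_fun setT (fun x => f (A k x)) by exact: intg_measurable (intgA k iU).
have intfA k : intg (fun x => f x * f (A k x)).
  apply: (@intgM _ _ _ mu f _ 1) => // x.
  by have [->|->] := f01 (A k x); rewrite ?normr0 ?normr1.
have E k : osc k f = \int[mu]_x f (A k x) + \int[mu]_x f x - 2 * \int[mu]_x (f x * f (A k x)).
  rewrite -RintegralZl// -RintegralD//; last exact: intgA.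
  rewrite -RintegralB//; [|by apply: intgD => //; exact: intgA|exact: intgZ].
  apply: eq_Rintegral => x _.
  by have [->|->] := f01 (A k x); have [->|->] := f01 x;
     rewrite ?subr0 ?sub0r ?subrr ?normr0 ?normrN ?normr1; ring.
have c1 : \int[mu]_x f (A k x) @[k --> \oo] --> \int[mu]_x f x.
  have E1 k : \int[mu]_x f (A k x) = (1 - e k) ^- n * \int[mu]_x f x.
    rewrite (Rintegral_affine (e k *: w) (ecn k) iU) ger0_norm ?(ltW (ec k))//.
    by rewrite mulrA mulVf ?mul1r// expf_neq0.
  under eq_fun do rewrite E1.
  have e1' : (1 - e k) @[k --> \oo] --> 1 - (0 : R) by apply: cvgB => //; exact: cvg_cst.
  have h1 : (1 - e k) ^+ n @[k --> \oo] --> (1 - 0 : R) ^+ n.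
    apply: (@cvg_comp _ _ _ (fun k => 1 - e k) (fun t : R => t ^+ n) _ (nbhs (1 - 0 : R))) => //.
    exact: exprn_continuous.
  rewrite subr0 expr1n in h1.
  have := cvgM (cvgV (oner_neq0 _) h1) (cvg_cst (\int[mu]_x f x)).
  by rewrite invr1 mul1r; apply.
have c2 : \int[mu]_x (f x * f (A k x)) @[k --> \oo] --> \int[mu]_x f x.
  have [] := @dominated_Rintegral _ _ _ mu (fun k x => f x * f (A k x)) f f => //.
  - by move=> k; exact: intg_measurable.
  - exact: (intg_measurable iU).
  - apply: aeW => x; have [xU|xU] := pselect (U x); last first.
      have fx : f x = 0 by rewrite /f indicE memNset.
      by rewrite fx; under eq_fun do rewrite mul0r; exact: cvg_cst.
    have fx : f x = 1 by rewrite /f indicE mem_set.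
    have nU : nbhs x U by exact: open_nbhs_nbhs.
    rewrite fx; apply: cvg_near_cst; near=> k; rewrite mul1r /f indicE mem_set//.
    near: k; exact: (@cvgA x _ nU).
  - apply: aeW => x k; have [->|->] := f01 x; have [->|->] := f01 (A k x);
      by rewrite ?mulr0 ?mulr1 ?normr0 ?normr1.
rewrite /osc0; under eq_fun do rewrite E.
have -> : 0 = \int[mu]_x f x + \int[mu]_x f x - 2 * \int[mu]_x f x by ring.
apply: cvgB; first by apply: cvgD => //; exact: cvg_cst.
by apply: cvgM => //; exact: cvg_cst.
Unshelve. all: by end_near. Qed.

(** Dynkin induction from the open sets. The intersection with a fixed cube keeps complements
    integrable. *)
Let oscmeas (N : R) (E : set V) : 0 <= N -> measurable E -> osc0 (\1_(E `&` rV_cube 0 N) : V -> R).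
Proof.
move=> N0; pose Q : set V := rV_cube 0 N.
have oQ : open Q by exact: open_rV_cube.
have mQ := open_measurable_rV oQ.
have Qoo : (mu Q < +oo)%E by rewrite lebesgue_rV_cube// ltry.
have EQoo (F : set V) : measurable F -> (mu (F `&` Q) < +oo)%E.
  by move=> mF; apply: le_lt_trans Qoo; apply: le_measure; rewrite ?inE//; exact: measurableI.
have iF (F : set V) : measurable F -> intg (\1_(F `&` Q) : V -> R).
  by move=> mF; apply: indic_intg; [exact: measurableI|exact: EQoo].
rewrite [in X in X -> _]measurable_rV_open => sE.
apply: (@dynkin_induction _ V open (fun E => osc0 (\1_(E `&` Q) : V -> R))
  measurable_rV_open _ _ _ _ _ E sE).
- exact: openI.
- by rewrite setTI; exact: osc0_open.
- move=> U oU; apply: osc0_open; first exact: openI.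
  by apply: EQoo; exact: open_measurable_rV.
- move=> S mS hS.
  have hQ := osc0_open oQ Qoo.
  have -> : (\1_(~` S `&` Q) : V -> R) = (fun x => \1_Q x + (- 1) * \1_(S `&` Q) x).
    apply/funext => x; rewrite !indicE !in_setI in_setC.
    by case: (x \in S); case: (x \in Q) => /=; rewrite ?mulr0 ?mulr1 ?addr0 ?subrr.
  apply: osc0D => //; [exact: indic_intg|exact/intgZ/iF|].
  by apply: osc0Z => //; exact: iF.
- move=> F mF tF hF.
  have mUF : measurable (\bigcup_k F k) by exact: bigcup_measurable.
  apply: osc0_dense => [|d d0]; first exact: iF.
  (* By disjointness at most one term is nonzero at each point, so the partial sums are dominated by
     the indicator of the union and converge to it in L1. *)
  pose S (m : nat) x : R := \sum_(0 <= i < m) \1_(F i `&` Q) x.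
  have iS m : intg (S m) by apply: intg_sum => i; exact: iF.
  have oS m : osc0 (S m).
    by apply: (@osc0_sum nat (index_iota 0 m) (fun i => \1_(F i `&` Q))) => [i|//]; exact: iF.
  have SE i0 x m : F i0 x -> S m x = (i0 < m)%:R * \1_Q x.
    move=> Fx; rewrite /S; elim: m => [|m IH]; first by rewrite big_geq// mul0r.
    have EQ : \1_(F m `&` Q) x = ((x \in F m) && (x \in Q))%:R :> R.
      by rewrite indicE in_setI.
    rewrite big_nat_recr//= IH ltnS (leq_eqVlt i0) EQ.
    have -> : (x \in F m) = (i0 == m).
      apply/idP/eqP => [|<-]; last exact: mem_set.
      by rewrite inE => Fmx; apply: (tF i0 m I I); exists x.
    case: eqP => [->|] /=; last by rewrite addr0.
    by rewrite ltnn mul0r add0r mul1r indicE.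
  have S0 x m : ~ (\bigcup_k F k) x -> S m x = 0.
    move=> nF; rewrite /S big1// => i _; rewrite indicE memNset// => -[Fx _].
    by apply: nF; exists i.
  have S01 m x : `|S m x| <= \1_((\bigcup_k F k) `&` Q) x.
    have [[i0 _ Fx]|nF] := pselect ((\bigcup_k F k) x); last first.
      by rewrite S0// normr0 indicE.
    have EU : x \in \bigcup_k F k by apply/mem_set; exists i0.
    rewrite (SE i0 x m Fx) !indicE in_setI EU /=.
    by rewrite normrM !normr_nat ler_piMl// lern1; case: (_ < _)%N.
  have Scvg x : S ^~ x @ \oo --> (\1_((\bigcup_k F k) `&` Q) x : R).
    have [[i0 _ Fx]|nF] := pselect ((\bigcup_k F k) x); last first.
      rewrite (_ : S ^~ x = cst 0); last by apply/funext => m; rewrite S0.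
      by rewrite indicE memNset; [exact: cvg_cst|case].
    have EU : x \in \bigcup_k F k by apply/mem_set; exists i0.
    apply: cvg_near_cst; near=> m; rewrite (SE i0 x m Fx) !indicE in_setI EU /=.
    rewrite (_ : (i0 < m)%N = true) ?mul1r//.
    by near: m; exact: nbhs_infty_gt.
  have [] := @dominated_Rintegral _ _ _ mu S (\1_((\bigcup_k F k) `&` Q)) (\1_((\bigcup_k F k) `&` Q)).
  - by move=> m; exact: intg_measurable.
  - by apply: measurable_indic; exact: measurableI.
  - exact: aeW.
  - exact: iF.
  - exact: aeW.
  move=> _ /cvgrPdist_le/(_ d d0)[m _ /(_ m (leqnn m))] + _.
  rewrite sub0r normrN ger0_norm; last by apply: Rintegral_ge0.
  move=> h; exists (S m) => //; apply: le_trans h; rewrite le_eqVlt; apply/orP; left.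
  by apply/eqP; apply: eq_Rintegral => x _; rewrite distrC.
Unshelve. all: by end_near. Qed.

Lemma L1_affine_le k f : intg f ->
  \int[mu]_x `|f ((1 - e k) *: x + e k *: w) - f x| <= (2 ^+ n + 1) * \int[mu]_x `|f x|.
Proof. exact: osc_le. Qed.

Lemma L1_affine_continuity f : intg f ->
  \int[mu]_x `|f ((1 - e k) *: x + e k *: w) - f x| @[k --> \oo] --> 0.
Proof.
move=> intf; apply: (osc0_dense intf) => d d0.
have [g_ [intg_ _ g_f]] := approximation_sfun_integrable measurableT intf.
have {}g_f : \int[mu]_x `|f x - g_ k x| @[k --> \oo] --> 0.
  have H : fine \o (fun k => \int[mu]_z `|(EFin \o f) z - (g_ k z)%:E|)%E @ \oo --> (0 : R).
    exact: fine_cvg.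
  apply: cvg_trans H; apply: near_eq_cvg.
  by apply: nearW => k; congr fine; apply: eq_integral => x _ /=.
move/cvgrPdist_le : g_f => /(_ d d0)[m _ /(_ m (leqnn m))].
rewrite sub0r normrN ger0_norm; last by apply: Rintegral_ge0.
move=> fg; exists (g_ m) => //; split; first exact: intg_.
pose g : {sfun V >-> R} := g_ m.
have ig : intg g by exact: intg_.
apply: (osc0_dense ig) => d' d'0.
(* A level set of a simple function may have infinite measure, as that of the value 0 does when the
   support is bounded and n > 0; cut by cubes, all level sets fall under [oscmeas]. *)
pose h (N : nat) x := g x * \1_(rV_cube 0 N%:R) x.
have mQ N : measurable (rV_cube (0 : V) N%:R) by apply: open_measurable_rV; exact: open_rV_cube.
have ih N : intg (h N).
  apply: (@intgM _ _ _ mu _ _ 1) => // x.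
  by rewrite indicE normr_nat lern1; case: (_ \in _).
have oh N : osc0 (h N).
  have -> : h N = (fun x => \sum_(y <- finmap.enum_fset (fset_set (range g))) y * \1_(g @^-1` [set y] `&` rV_cube 0 N%:R) x).
    apply/funext => x; rewrite /h {1}fimfunE fsbig_finite//= mulr_suml.
    by apply: eq_bigr => y _; rewrite indicI mulrA.
  have iy y : intg (\1_(g @^-1` [set y] `&` rV_cube 0 N%:R) : V -> R).
    apply: indic_intg; first by apply: measurableI => //; exact: measurable_sfunP.
    apply: (@le_lt_trans _ _ (mu (rV_cube 0 N%:R))); last by rewrite lebesgue_rV_cube// ltry.
    apply: le_measure; rewrite ?inE//; apply: measurableI => //; exact: measurable_sfunP.
  apply: osc0_sum => y; first exact: intgZ.
  by apply: osc0Z => //; apply: oscmeas => //; exact: measurable_sfunP.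
have [] := @dominated_Rintegral _ _ _ mu h g (fun x => `|g x|).
- by move=> N; exact: intg_measurable.
- exact: (intg_measurable ig).
- apply: aeW => x; apply: cvg_near_cst; near=> N.
  rewrite /h indicE mem_set ?mulr1//= => i; rewrite mxE subr0.
  apply: (@le_lt_trans _ _ (\sum_i `|x ord0 i|)).
    by rewrite (bigD1 i)//= lerDl sumr_ge0.
  near: N; exact: nbhs_infty_gtr.
- exact: intg_norm.
- apply: aeW => x N; rewrite /h normrM ler_piMr// indicE normr_nat lern1.
  by case: (_ \in _).
move=> _ /cvgrPdist_le/(_ d' d'0)[N _ /(_ N (leqnn N))] + _.
rewrite sub0r normrN ger0_norm; last by apply: Rintegral_ge0.
move=> hN; exists (h N) => //; apply: le_trans hN; rewrite le_eqVlt; apply/orP; left.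
by apply/eqP; apply: eq_Rintegral => x _; rewrite distrC.
Unshelve. all: by end_near. Qed.

End L1_continuity.

(** * Averages *)

Section averages.
Context {R : realType} {n : nat}.
Local Notation V := 'rV[R]_n.
Local Notation mu := (lebesgue_rV R n).
Local Notation intg f := (mu.-integrable setT (EFin \o f)).
Implicit Types (f g h : V -> R) (x y w : V) (e : R).

Lemma measurable_eball x (r : R) : measurable (eball x r).
Proof. by apply: open_measurable_rV; exact: eball_open. Qed.

Lemma eball_finite x (r : R) : (mu (eball x r) < +oo)%E.
Proof.
have [r0|r0] := ltP 0 r; last first.
  rewrite (_ : eball x r = set0) ?measure0//.
  apply/seteqP; split => // y; rewrite /eball/= => h.
  by have := lt_le_trans h r0; rewrite ltNge enorm_ge0.
apply: (@le_lt_trans _ _ (mu (rV_cube x r))); last by rewrite lebesgue_rV_cube ?ltry// ltW.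
apply: le_measure; rewrite ?inE; [exact: measurable_eball|apply: open_measurable_rV; exact: open_rV_cube|].
move=> y h i; apply: le_lt_trans h; have := coord_le_enorm (y - x) i.
by rewrite !mxE.
Qed.

Lemma test_function_intg x (r : R) phi : test_function (eball x r) phi -> intg phi.
Proof.
move=> tphi; have [M hM] := test_function_bounded tphi.
apply: (@integrable_bounded_support _ _ (eball x r) _ M) => //.
- exact: measurable_eball.
- exact: eball_finite.
- exact: test_function_measurable tphi.
- by move=> w; exact: test_function_out tphi.
Qed.

Lemma measurable_affine2 e : measurable_fun setT
  (fun p : V * V => (1 - e) *: p.1 + e *: p.2).
Proof.
apply: measurable_fun_rVP => i; under eq_fun do rewrite !mxE.
apply: measurable_funD; apply: measurable_funM => //.
- exact: measurableT_comp (measurable_coord i) measurable_fst.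
- exact: measurableT_comp (measurable_coord i) measurable_snd.
Qed.

Variables (x0 : V) (r : R) (rho : V -> R).
Hypotheses (trho : test_function (eball x0 r) rho) (rho_ge0 : forall w, 0 <= rho w).
Hypothesis rho1 : (\int[mu]_w (rho w)%:E = 1)%E.
Local Notation B := (eball x0 r).

(** The kernel is a parameter because averages are taken against [rho] and also against its partial
    derivatives. *)
Definition avg rho' e f x := \int[mu]_w (f ((1 - e) *: x + e *: w) * rho' w).

Lemma kernel_measurable : measurable_fun setT rho.
Proof. exact: test_function_measurable trho. Qed.

Lemma kernel_intg : intg rho.
Proof.
apply/integrableP; split; first by apply/measurable_EFinP; exact: kernel_measurable.
under eq_integral do rewrite /= ger0_norm//.
by rewrite rho1 ltry.
Qed.

Lemma kernel_Rint : \int[mu]_w rho w = 1.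
Proof. by rewrite /Rintegral rho1. Qed.

Section bounded_kernel.
Variable rho' : V -> R.
Hypothesis (trho' : test_function B rho').

Lemma intg_avg e f x : 0 < e -> intg f ->
  intg (fun w => f ((1 - e) *: x + e *: w) * rho' w).
Proof.
move=> e0 intf; have [M hM] := test_function_bounded trho'.
apply: (@intgM _ _ _ mu _ _ M) => //; first exact: test_function_measurable trho'.
under [X in _.-integrable _ (_ \o X)]eq_fun do rewrite addrC.
by apply: intg_affine; rewrite ?gt_eqF.
Qed.

(** The factor e^-n is the Jacobian of the substitution in [w]. It yields the a priori bound on
    G(|Dv_e|) from the energy, and the boundedness of each approximant and of its gradient. *)
Lemma avg_bounded : exists2 M : R, 0 <= M & forall e f x, 0 < e -> intg f ->
  `|avg rho' e f x| <= M * e ^- n * \int[mu]_y `|f y|.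
Proof.
have [M hM] := test_function_bounded trho'.
have M0 : 0 <= M by exact: le_trans (hM 0).
exists M => // e f x e0 intf; have intn := intg_norm intf.
rewrite (Rintegral_affine ((1 - e) *: x) (lt0r_neq0 e0) intn).
rewrite (ger0_norm (ltW e0)) mulrA mulrVK ?unitfE ?expf_neq0 ?gt_eqF//.
have intc : intg (fun w => `|f (e *: w + (1 - e) *: x)|).
  by apply: (@intg_affine _ _ _ _ (fun y => `|f y|)); rewrite ?gt_eqF.
rewrite -RintegralZl//; apply: norm_Rintegral_le.
- exact: intg_avg.
- exact: intgZ.
- by move=> w; rewrite normrM mulrC addrC ler_wpM2r.
Qed.

(** Origin of the scale [2 * r * e]: the displacement is e (x - w), and both [x] and [w] lie in the
    ball. *)
Lemma avg_pt x w e : 0 < e -> e <= 1 -> B x -> rho' w != 0 ->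
  B ((1 - e) *: x + e *: w) /\ enorm (x - ((1 - e) *: x + e *: w)) <= 2 * r * e.
Proof.
move=> e0 e1 Bx rw.
have Bw : B w by apply: contrapT => /(test_function_out trho') /eqP; apply/negP.
split; first by apply: eball_convex => //; exact: ltW.
have -> : x - ((1 - e) *: x + e *: w) = e *: ((x - x0) + - (w - x0)).
  by apply/rowP => j; rewrite !mxE; ring.
rewrite enormZ gtr0_norm// mulrC ler_wpM2r ?(ltW e0)//.
apply: le_trans (enormD _ _) _; rewrite enormN mulr_natl mulr2n.
by apply: lerD; exact: ltW.
Qed.

End bounded_kernel.

Lemma avg_le e f g x : 0 < e -> e <= 1 -> intg f -> intg g -> B x ->
  (forall y, B y -> enorm (x - y) <= 2 * r * e -> f y <= g y) ->
  avg rho e f x <= avg rho e g x.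
Proof.
move=> e0 e1 intf intg' Bx fg; apply: le_Rintegral => //; [exact: intg_avg|exact: intg_avg|].
move=> w _; have [->|rw] := eqVneq (rho w) 0; first by rewrite !mulr0.
by have [By xy] := avg_pt trho e0 e1 Bx rw; rewrite ler_wpM2r// fg.
Qed.

Lemma avgZ e f x (c : R) : 0 < e -> intg f -> avg rho e (fun y => c * f y) x = c * avg rho e f x.
Proof.
move=> e0 intf; rewrite /avg -RintegralZl//; last exact: intg_avg.
by apply: eq_Rintegral => w _; rewrite mulrA.
Qed.

Lemma avg_norm e f x : 0 < e -> intg f -> `|avg rho e f x| <= avg rho e (fun y => `|f y|) x.
Proof.
move=> e0 intf; apply: norm_Rintegral_le; [exact: intg_avg| |].
  by apply: (@intg_avg _ trho _ (fun y => `|f y|)) => //; exact: intg_norm.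
by move=> w; rewrite normrM (ger0_norm (rho_ge0 _)).
Qed.

Lemma avg_ge0 e f x : (forall y, 0 <= f y) -> 0 <= avg rho e f x.
Proof. by move=> f0; apply: Rintegral_ge0 => w _; rewrite mulr_ge0. Qed.

(** In this form [x] occurs only in the kernel, a rescaled test function of [y], so the definition
    of the weak gradient can be applied to it. *)
Lemma avg_cov (rho' : V -> R) e f x : test_function B rho' -> 0 < e -> intg f ->
  avg rho' e f x =
  e ^- n * \int[mu]_y (f y * rho' (e^-1 *: y + - (e^-1 *: ((1 - e) *: x)))).
Proof.
move=> trho' e0 intf; have [M hM] := test_function_bounded trho'.
have en0 : e != 0 by rewrite gt_eqF.
have iF : intg (fun y => f y * rho' (e^-1 *: y + - (e^-1 *: ((1 - e) *: x)))).
  apply: (@intgM _ _ _ mu _ _ M) => //.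
  exact: (measurableT_comp (test_function_measurable trho') (measurable_affine _ _)).
rewrite (Rintegral_affine ((1 - e) *: x) en0 iF) (ger0_norm (ltW e0)) mulKf ?expf_neq0//.
apply: eq_Rintegral => w _; rewrite addrC; congr (_ * rho' _).
by rewrite scalerDr scalerA mulVf// scale1r addrK.
Qed.

Lemma avg_ae_le rho' e f x (c M : R) : test_function B rho' ->
  0 < e -> e <= 1 -> B x -> intg f ->
  {ae mu, forall y, B y -> enorm (x - y) <= 2 * r * e -> `|f y - c| <= M} ->
  `|avg rho' e f x - c * \int[mu]_w rho' w| <= M * \int[mu]_w `|rho' w|.
Proof.
move=> trho' e0 e1 Bx intf fM; have en0 : e != 0 by rewrite gt_eqF.
have ir := test_function_intg trho'.
have fM' : {ae mu, forall w, `|(f ((1 - e) *: x + e *: w) - c) * rho' w| <= M * `|rho' w|}.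
  move: fM => [N [mN N0 hN]].
  (* The preimage of a null set under an invertible affine map is null. A bound known for almost
     every [y] thus holds for almost every [w], at each single [x]. *)
  exists ((fun w => e *: w + (1 - e) *: x) @^-1` N); split.
  - by rewrite -[X in measurable X]setTI; exact: measurable_affine.
  - have := lebesgue_rV_affine ((1 - e) *: x) en0 mN.
    by rewrite N0 => /esym /eqP; rewrite mule_eq0 eqe gt_eqF ?exprn_gt0 ?normr_gt0//= => /eqP.
  - move=> w /= hw; apply: hN => /= H; apply: hw.
    have [->|rw] := eqVneq (rho' w) 0; first by rewrite mulr0 normr0 mulr0.
    have [By xy] := avg_pt trho' e0 e1 Bx rw.
    by rewrite normrM ler_wpM2r//; move: H; rewrite addrC; apply.
have iavg := intg_avg trho' x e0 intf.
have -> : avg rho' e f x - c * \int[mu]_w rho' w =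
    \int[mu]_w ((f ((1 - e) *: x + e *: w) - c) * rho' w).
  rewrite /avg -RintegralZl// -RintegralB//; last exact: intgZ.
  by apply: eq_Rintegral => w _; rewrite mulrBl.
rewrite -RintegralZl//; last exact: intg_norm.
apply: norm_Rintegral_le_ae => //; last exact/intgZ/intg_norm.
have := intgB iavg (intgZ c ir); apply: eq_integrable => // w _.
by rewrite /= mulrBl.
Qed.

Lemma avg_ae_bounded e f x (M : R) : 0 < e -> e <= 1 -> B x -> intg f ->
  {ae mu, forall y, B y -> `|f y| <= M} -> `|avg rho e f x| <= M.
Proof.
move=> e0 e1 Bx intf fM; have := avg_ae_le (c := 0) (M := M) trho e0 e1 Bx intf.
rewrite mul0r subr0; have -> : \int[mu]_w `|rho w| = 1.
  by rewrite -kernel_Rint; apply: eq_Rintegral => w _; rewrite ger0_norm.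
by rewrite mulr1; apply; apply: filterS fM => y h By _; rewrite subr0; exact: h.
Qed.

(** Integration of the supporting line at the mean [m]; its linear term integrates to zero because
    [rho] has mass one. *)
Lemma avg_jensen (Phi : R -> R) e h x : orlicz_function Phi -> 0 < e ->
  (forall y, 0 <= h y) -> intg h -> intg (fun y => Phi (h y)) ->
  Phi (avg rho e h x) <= avg rho e (fun y => Phi (h y)) x.
Proof.
move=> P e0 h0 ih iPh; set m := avg rho e h x.
have m0 : 0 <= m by exact: avg_ge0.
have [p hp] := orlicz_tangent P m0.
have i1 := intg_avg trho x e0 ih.
have irho := kernel_intg.
have -> : Phi m = \int[mu]_w (Phi m * rho w + p * (h ((1 - e) *: x + e *: w) * rho w - m * rho w)).
  rewrite RintegralD//; [|exact: intgZ|]; last first.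
    by apply: intgZ; apply: intgB => //; exact: intgZ.
  rewrite RintegralZl// kernel_Rint mulr1 RintegralZl//; last first.
    by apply: intgB => //; exact: intgZ.
  rewrite RintegralB//; last exact: intgZ.
  by rewrite RintegralZl// kernel_Rint mulr1 -/(avg rho e h x) -/m subrr mulr0 addr0.
apply: le_Rintegral => //.
- by apply: intgD; [exact: intgZ|apply: intgZ; apply: intgB => //; exact: intgZ].
- exact: (intg_avg trho x e0 iPh).
- move=> w _; rewrite -mulrBl mulrA -mulrDl ler_wpM2r//; exact: hp.
Qed.

Lemma intg_avg2 e f : 0 < e -> e <= 2^-1 -> intg f ->
  (mu \x mu)%E.-integrable setT
    (fun p : V * V => (f ((1 - e) *: p.1 + e *: p.2) * rho p.2)%:E).
Proof.
move=> e0 e1 intf; have [M hM] := test_function_bounded trho.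
have mf := intg_measurable intf.
have c0 : 1 - e != 0 by rewrite gt_eqF//; lra.
have mF : measurable_fun setT (fun p : V * V => f ((1 - e) *: p.1 + e *: p.2) * rho p.2).
  apply: measurable_funM; first exact: (measurableT_comp mf (measurable_affine2 e)).
  exact: (measurableT_comp kernel_measurable measurable_snd).
apply/integrable21ltyP; first exact/measurable_EFinP.
under eq_integral => w _.
  under eq_integral => x _ do rewrite /= normrM (ger0_norm (rho_ge0 _)) mulrC.
  rewrite -EFin_Rintegral; last by apply/intgZ/intg_norm/(intg_affine _ c0).
  rewrite RintegralZl//; last by apply/intg_norm/(intg_affine _ c0).
  have -> : \int[mu]_x `|f ((1 - e) *: x + e *: w)| = (`|1 - e| ^- n) * \int[mu]_x `|f x|.
    rewrite (Rintegral_affine (e *: w) c0 (intg_norm intf)) mulKf//.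
    by rewrite expf_neq0// normr_eq0.
  rewrite mulrC; over.
rewrite -EFin_Rintegral ?ltry//; exact/intgZ/kernel_intg.
Qed.

Lemma avg_fubini_F e f : 0 < e -> intg f ->
  EFin \o avg rho e f = fubini_F mu (fun p : V * V => (f ((1 - e) *: p.1 + e *: p.2) * rho p.2)%:E).
Proof.
move=> e0 intf; apply/funext => x; rewrite /fubini_F/=.
by rewrite /avg EFin_Rintegral//; exact: intg_avg.
Qed.

Lemma intg_avgT e f : 0 < e -> e <= 2^-1 -> intg f -> intg (avg rho e f).
Proof.
move=> e0 e1 intf; rewrite avg_fubini_F//.
exact: (integrable_fubini_F (intg_avg2 e0 e1 intf)).
Qed.

(** Reduces a pairing with an average to pairings with single dilations, so that weak derivatives
    can be treated one [w] at a time. *)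
Lemma avg_fubini e f g (M : R) : 0 < e -> e <= 2^-1 -> intg f ->
  measurable_fun setT g -> (forall x, `|g x| <= M) ->
  \int[mu]_x (avg rho e f x * g x) =
  \int[mu]_w ((\int[mu]_x (f ((1 - e) *: x + e *: w) * g x)) * rho w).
Proof.
move=> e0 e1 intf mg gM.
have c0 : 1 - e != 0 by rewrite gt_eqF//; lra.
pose F (p : V * V) := (f ((1 - e) *: p.1 + e *: p.2) * rho p.2 * g p.1).
have iF : (mu \x mu)%E.-integrable setT (EFin \o F).
  apply: (@intgM _ _ _ (mu \x mu)%E _ (fun p => g p.1) M) => //.
    exact: (measurableT_comp mg measurable_fst).
  exact: intg_avg2.
have := Fubini iF.
have E1 x : (\int[mu]_w (EFin \o F) (x, w) = (avg rho e f x * g x)%:E)%E.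
  rewrite /F /= /avg -RintegralZr//; last exact: intg_avg.
  rewrite EFin_Rintegral//.
  by apply: (@intgM _ _ _ mu _ (fun=> g x) `|g x|) => //; exact: intg_avg.
have E2 w : (\int[mu]_x (EFin \o F) (x, w) =
    ((\int[mu]_x (f ((1 - e) *: x + e *: w) * g x)) * rho w)%:E)%E.
  have ia : intg (fun x => f ((1 - e) *: x + e *: w) * g x).
    by apply: (@intgM _ _ _ mu _ _ M) => //; exact: intg_affine.
  rewrite /F /= -RintegralZr// EFin_Rintegral//.
    by apply: eq_integral => x _; rewrite mulrAC.
  by apply: (@intgM _ _ _ mu _ (fun=> rho w) `|rho w|).
under eq_integral do rewrite E1.
under [in RHS]eq_integral do rewrite E2.
by rewrite /Rintegral => ->.
Qed.

(** By Tonelli the L1 error is at most the [rho]-mean over [w] of the dilation errors [osc k w].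
    Each of these tends to 0 and all are at most [C], so dominated convergence in [w] concludes. *)
Lemma avg_L1_cvg (e : nat -> R) f : (forall k, 0 < e k) -> (forall k, e k <= 2^-1) ->
  e @ \oo --> 0 -> intg f ->
  \int[mu]_x `|avg rho (e k) f x - f x| @[k --> \oo] --> 0.
Proof.
move=> e0 e1 ecvg intf.
pose osc k w := \int[mu]_x `|f ((1 - e k) *: x + e k *: w) - f x|.
have c0 k : 1 - e k != 0 by rewrite gt_eqF//; have := e1 k; lra.
have iosc k w : intg (fun x => `|f ((1 - e k) *: x + e k *: w) - f x|).
  by apply/intg_norm/intgB => //; exact: intg_affine.
pose K k (p : V * V) := (`|f ((1 - e k) *: p.1 + e k *: p.2) - f p.1| * rho p.2)%:E.
have mK k : measurable_fun setT (K k).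
  apply/measurable_EFinP; apply: measurable_funM; last exact: (measurableT_comp kernel_measurable measurable_snd).
  apply: measurableT_comp => //; apply: measurable_funB.
    exact: (measurableT_comp (intg_measurable intf) (measurable_affine2 (e k))).
  exact: (measurableT_comp (intg_measurable intf) measurable_fst).
have K0 k p : (0 <= K k p)%E by rewrite lee_fin mulr_ge0.
have Ew k w : (\int[mu]_x K k (x, w) = (osc k w * rho w)%:E)%E.
  rewrite /K /= -RintegralZr// EFin_Rintegral//.
  by apply: (@intgM _ _ _ mu _ (fun=> rho w) `|rho w|).
pose C := (2 ^+ n + 1) * \int[mu]_x `|f x|.
have oscC k w : osc k w <= C by exact: L1_affine_le.
have osc_ge0 k w : 0 <= osc k w by apply: Rintegral_ge0.
have mosc k : measurable_fun setT (fun w => osc k w * rho w).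
  apply/measurable_EFinP.
  have := measurable_fun_fubini_tonelli_G (m1 := mu) _ (mK k) (K0 k).
  by apply: eq_measurable_fun => w _; rewrite /fubini_G Ew.
have irC : intg (fun w => C * rho w) by apply/intgZ/kernel_intg.
have [] := @dominated_Rintegral _ _ _ mu (fun k w => osc k w * rho w) (cst 0) (fun w => C * rho w) => //.
- apply: aeW => w; have := cvgM (L1_affine_continuity w e1 ecvg intf) (cvg_cst (rho w)).
  by rewrite mul0r; apply.
- by apply: aeW => w k; rewrite ger0_norm ?mulr_ge0// ler_wpM2r.
rewrite Rintegral_cst// mul0r => _ _ h.
apply: (@squeeze_cvgr _ _ _ _ (cst 0) (fun k => \int[mu]_w (osc k w * rho w))) => //; last exact: cvg_cst.
apply: nearW => k; rewrite Rintegral_ge0//= -lee_fin.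
have iow : intg (fun w => osc k w * rho w).
  apply: (@intg_le _ _ _ mu _ (fun w => C * rho w)) => // w.
  by rewrite ger0_norm ?mulr_ge0// ler_wpM2r.
rewrite !EFin_Rintegral//; last first.
  by apply/intg_norm/intgB => //; exact: intg_avgT.
under [leRHS]eq_integral do rewrite -Ew.
rewrite -fubini_tonelli//.
apply: ge0_le_integral => //.
- apply/measurable_EFinP/measurableT_comp => //; apply: measurable_funB; last exact: (intg_measurable intf).
  by apply: (@intg_measurable _ _ _ mu); exact: intg_avgT.
- exact: (measurable_fun_fubini_tonelli_F (m2 := mu) _ (mK k) (K0 k)).
- move=> x _; rewrite /K /=.
  have ia : intg (fun w => f ((1 - e k) *: x + e k *: w) * rho w) by exact: intg_avg.
  have ir : intg (fun w => f x * rho w) by apply/intgZ/kernel_intg.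
  have id : intg (fun w => `|f ((1 - e k) *: x + e k *: w) - f x| * rho w).
    have := intg_norm (intgB ia ir); apply: eq_integrable => // w _ /=.
    by rewrite -mulrBl normrM (ger0_norm (rho_ge0 w)).
  rewrite -EFin_Rintegral// lee_fin.
  have -> : avg rho (e k) f x - f x = \int[mu]_w (f ((1 - e k) *: x + e k *: w) * rho w - f x * rho w).
    by rewrite RintegralB// RintegralZl ?kernel_Rint ?mulr1//; exact: kernel_intg.
  apply: norm_Rintegral_le => //; first exact: intgB.
  by move=> w; rewrite -mulrBl normrM (ger0_norm (rho_ge0 w)).
Qed.

End averages.

(** * Weak gradients *)

Section weak_gradients.
Context {R : realType} {n : nat}.
Local Notation V := 'rV[R]_n.
Local Notation mu := (lebesgue_rV R n).
Local Notation intg f := (mu.-integrable setT (EFin \o f)).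
Implicit Types (f h phi : V -> R) (g : V -> V) (x y w : V) (e : R) (U A : set V).

Lemma integral_restrict U (F : V -> R) :
  (\int[mu]_(x in U) (F x)%:E = \int[mu]_x ((F \_ U) x)%:E)%E.
Proof.
rewrite integral_mkcond; apply: eq_integral => x _.
by rewrite !patchE; case: ifP.
Qed.

Lemma integral_test U (F : V -> R) A : A `<=` U -> (forall x, ~ A x -> F x = 0) ->
  (\int[mu]_(x in U) (F x)%:E = \int[mu]_(x in A) (F x)%:E)%E.
Proof.
move=> AU F0; rewrite (integral_restrict U) (integral_restrict A); apply: eq_integral => x _; congr EFin.
rewrite !patchE; case: ifPn => xU; case: ifPn => xA//; last first.
  by move: xA; rewrite inE => /AU xU'; move: xU; rewrite notin_setE.
by rewrite F0//; move: xA; rewrite notin_setE.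
Qed.

Lemma L1_locS U A f : measurable U -> measurable A -> A `<=` U -> L1_loc U f -> L1_loc A f.
Proof.
move=> mU mA AU [mf intf]; split; first exact: measurable_funS mf.
by move=> K KA; apply: intf; exact: subset_trans AU.
Qed.

Lemma is_weak_gradS U A f g : open U -> open A -> A `<=` U -> is_weak_grad U f g ->
  is_weak_grad A f g.
Proof.
move=> oU oA AU [L1f L1g wg].
have mU := open_measurable_rV oU; have mA := open_measurable_rV oA.
split; [exact: (L1_locS mU)|by move=> i; exact: (L1_locS mU)|].
move=> phi tphi i; have := wg phi (test_functionS AU tphi) i.
rewrite (integral_test AU); last first.
  by move=> x Ax; rewrite (test_function_out (test_function_partial i tphi))// mulr0.
rewrite (integral_test AU (F := fun x => g x ord0 i * phi x))//.
by move=> x Ax; rewrite (test_function_out tphi)// mulr0.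
Qed.

Lemma intg_restrict_int U f : measurable U -> measurable_fun U f ->
  (\int[mu]_(x in U) `|f x|%:E < +oo)%E -> intg (f \_ U).
Proof.
move=> mU mf foo; have : mu.-integrable U (EFin \o f).
  by apply/integrableP; split => //; exact/measurable_EFinP.
move=> /(integrable_mkcond _ mU).1; apply: eq_integrable => // x _.
by rewrite /= !patchE; case: ifP.
Qed.

Lemma integral_testE U phi f : measurable U -> test_function U phi -> intg (f \_ U) ->
  (\int[mu]_(x in U) (f x * phi x)%:E = (\int[mu]_x ((f \_ U) x * phi x))%:E)%E.
Proof.
move=> mU tphi intf; have [M hM] := test_function_bounded tphi.
rewrite EFin_Rintegral; last first.
  by apply: (@intgM _ _ _ mu _ _ M) => //; exact: test_function_measurable tphi.
rewrite integral_restrict; apply: eq_integral => x _; congr EFin.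
rewrite !patchE; case: ifPn => //; rewrite mul0r//.
Qed.

(** For integrable data the definition becomes an identity of real integrals over the whole space,
    where linearity, Fubini and affine substitutions apply directly. *)
Lemma is_weak_gradP U f g : open U -> measurable_fun U f ->
  (forall i, measurable_fun U (fun x => g x ord0 i)) ->
  intg (f \_ U) -> (forall i, intg ((fun x => g x ord0 i) \_ U)) ->
  is_weak_grad U f g <->
  forall phi, test_function U phi -> forall i,
    \int[mu]_x ((f \_ U) x * partial_derive i phi x) =
    - \int[mu]_x (((fun x => g x ord0 i) \_ U) x * phi x).
Proof.
move=> oU mf mg intf intg_; have mU := open_measurable_rV oU.
have L1 h : measurable_fun U h -> intg (h \_ U) -> L1_loc U h.
  move=> mh ih; split => // K KU cK.
  have mK : measurable K.
    rewrite -[K]setCK; apply: measurableC; apply: open_measurable_rV; rewrite openC.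
    by apply: compact_closed => //; exact: norm_hausdorff.
  move: ih => /integrableP[_]; apply: le_lt_trans.
  rewrite (@integral_restrict K (fun x => `|h x|)).
  apply: ge0_le_integral => //.
  - by move=> x _; rewrite lee_fin patchE; case: ifP.
  - apply/measurable_EFinP; apply: ((measurable_restrictT (fun x => `|h x|) mK).1).
    exact: (measurableT_comp (@normr_measurable R setT) (measurable_funS mU KU mh)).
  - apply: measurableT_comp => //; apply/measurable_EFinP.
    exact: ((measurable_restrictT h mU).1 mh).
  - move=> x _; rewrite lee_fin !patchE.
    case: ifPn => xK; last exact: normr_ge0.
    by rewrite ifT//; apply/mem_set/KU; rewrite -[K x]inE.
split=> [[_ _ wg] phi tphi i|H].
  have := wg phi tphi i.
  rewrite (integral_testE mU (test_function_partial i tphi))//.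
  by rewrite (@integral_testE U phi (fun x => g x ord0 i) mU tphi)// => -[].
split; [exact: L1|by move=> i; exact: L1|].
move=> phi tphi i.
rewrite (integral_testE mU (test_function_partial i tphi))//.
by rewrite (@integral_testE U phi (fun x => g x ord0 i) mU tphi)// H.
Qed.

Lemma intg_patch U f : measurable U -> intg f -> intg (f \_ U).
Proof.
move=> mU intf; apply: (@intg_le _ _ _ mu _ (fun x => `|f x|)); last exact: intg_norm.
  exact: ((measurable_restrictT f mU).1 (measurable_funTS (intg_measurable intf))).
by move=> x; rewrite patchE; case: ifP => // _; rewrite normr0.
Qed.

Lemma test_patchE U phi f : test_function U phi ->
  \int[mu]_x ((f \_ U) x * phi x) = \int[mu]_x (f x * phi x).
Proof.
move=> tphi; apply: eq_Rintegral => x _; rewrite patchE; case: ifPn => // xU.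
by rewrite (test_function_out tphi) ?mulr0//; move: xU; rewrite notin_setE.
Qed.

Lemma partial_comp_affine U phi (c : R) d i y : c != 0 -> test_function U phi ->
  partial_derive i (fun z => phi (c *: z + d)) y = c * partial_derive i phi (c *: y + d).
Proof.
move=> c0 [sphi _]; apply: derive_val; apply: is_derive_comp_affine => //.
by have [_ /(_ i)[dphi _]] := sphi 1%N; exact: dphi.
Qed.

Lemma intg_test_affine U phi f (c : R) d : test_function U phi -> intg f ->
  intg (fun y => f y * phi (c *: y + d)).
Proof.
move=> tphi intf; have [M hM] := test_function_bounded tphi.
apply: (@intgM _ _ _ mu _ _ M) => //.
exact: (measurableT_comp (test_function_measurable tphi) (measurable_affine _ _)).
Qed.

Section kernel.
Variables (x0 : V) (r : R) (rho : V -> R).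
Hypotheses (trho : test_function (eball x0 r) rho) (rho_ge0 : forall w, 0 <= rho w).
Hypothesis rho1 : (\int[mu]_w (rho w)%:E = 1)%E.
Local Notation B := (eball x0 r).

Section weak_grad_averages.
Variables (f : V -> R) (g : V -> V).
Hypotheses (fg : is_weak_grad B f g) (intf : intg (f \_ B)).
Hypothesis intg_ : forall i, intg ((fun x => g x ord0 i) \_ B).
Let gB i := (fun x => g x ord0 i) \_ B.

Let wg phi i : test_function B phi ->
  \int[mu]_x ((f \_ B) x * partial_derive i phi x) = - \int[mu]_x (gB i x * phi x).
Proof.
have [[mf _] L1g _] := fg => tphi.
by apply: (is_weak_gradP _ mf _ intf intg_).1 => // [|j]; [exact: eball_open|case: (L1g j)].
Qed.

Let wg_affine phi i (c : R) d : c != 0 -> test_function B phi ->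
  (forall y, B (c *: y + d) -> B y) ->
  c * \int[mu]_y ((f \_ B) y * partial_derive i phi (c *: y + d)) =
  - \int[mu]_y (gB i y * phi (c *: y + d)).
Proof.
move=> c0 tphi cB; rewrite -(wg i (test_function_comp_affine c0 tphi cB)).
rewrite -RintegralZl//; last exact: (intg_test_affine _ _ (test_function_partial i tphi)).
by apply: eq_Rintegral => y _; rewrite (partial_comp_affine _ _ _ c0 tphi) mulrCA.
Qed.

(** For fixed [w] in [B], the substitution moves the dilation onto the test function. The
    transported function is still a test function on [B], because the dilation toward [w] maps the
    convex set [B] into itself. *)
Lemma weak_grad_avg e : 0 < e -> e <= 2^-1 ->
  is_weak_grad B (avg rho e (f \_ B)) (fun x => \row_i ((1 - e) * avg rho e (gB i) x)).
Proof.
move=> e0 e1.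
have c0 : 1 - e != 0 by rewrite gt_eqF//; lra.
have mB := measurable_eball x0 r.
have iv := intg_avgT trho rho_ge0 rho1 e0 e1 intf.
have ig i := intg_avgT trho rho_ge0 rho1 e0 e1 (intg_ i).
have ig' i : intg (fun x => (\row_j ((1 - e) * avg rho e (gB j) x)) ord0 i).
  by under [X in _.-integrable _ (_ \o X)]eq_fun do rewrite mxE; apply: intgZ; exact: ig.
apply/is_weak_gradP.
- exact: eball_open.
- exact: measurable_funTS (intg_measurable iv).
- by move=> i; exact: measurable_funTS (intg_measurable (ig' i)).
- exact: intg_patch.
- by move=> i; exact: intg_patch.
move=> phi tphi i.
have tpphi := test_function_partial i tphi.
rewrite (test_patchE _ tpphi) (test_patchE _ tphi).
have [M hM] := test_function_bounded tphi.
have [M' hM'] := test_function_bounded tpphi.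
rewrite (avg_fubini trho rho_ge0 rho1 e0 e1 intf (test_function_measurable tpphi) hM').
have igc : intg (fun y => - (1 - e) * gB i y) by exact/intgZ/intg_.
have -> : - (\int[mu]_x ((\row_j ((1 - e) * avg rho e (gB j) x)) ord0 i * phi x)) =
    \int[mu]_x (avg rho e (fun y => - (1 - e) * gB i y) x * phi x).
  rewrite -[LHS]mulN1r -RintegralZl//; last first.
    by apply: (@intgM _ _ _ mu _ _ M) => //; exact: test_function_measurable tphi.
  by apply: eq_Rintegral => x _; rewrite mxE (avgZ trho)//; last exact: intg_; ring.
rewrite (avg_fubini trho rho_ge0 rho1 e0 e1 igc (test_function_measurable tphi) hM).
apply: eq_Rintegral => w _; have [->|rw] := eqVneq (rho w) 0; first by rewrite !mulr0.
have Bw : B w by apply: contrapT => /(test_function_out trho) /eqP; apply/negP.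
congr (_ * _).
(* Coefficients of the inverse of the dilation with centre [w]. *)
pose c := (1 - e)^-1; pose d := - (c *: (e *: w)).
have cc0 : c != 0 by rewrite invr_eq0.
have affK x : c *: ((1 - e) *: x + e *: w) + d = x.
  by rewrite /d scalerDr scalerA mulVf// scale1r addrK.
have Kaff y : (1 - e) *: (c *: y + d) + e *: w = y.
  by apply/rowP => j; rewrite !mxE /c; field.
have cB y : B (c *: y + d) -> B y.
  by move=> By; rewrite -(Kaff y); apply: eball_convex => //; [exact: ltW|lra].
have := wg_affine i cc0 tphi cB.
rewrite (Rintegral_affine (e *: w) c0 (intg_test_affine _ _ tpphi intf)).
rewrite (Rintegral_affine (e *: w) c0 (intg_test_affine _ _ tphi (intg_ i))).
under eq_Rintegral do rewrite affK.
under [in X in _ = X -> _]eq_Rintegral do rewrite affK.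
rewrite -mulrN mulrCA => /(mulfI (expf_neq0 _ _)); rewrite normr_eq0 => /(_ c0).
move=> /(congr1 ( *%R (1 - e))); rewrite mulVKf// => ->.
rewrite mulrN -mulNr -RintegralZl//; last first.
  apply: (@intgM _ _ _ mu _ _ M) => //; first exact: test_function_measurable tphi.
  exact: (intg_affine _ c0 (intg_ i)).
by apply: eq_Rintegral => x _; rewrite mulrA.
Qed.

(** Integration by parts against the rescaled kernel of [avg_cov]. Its derivative brings the factor
    e^-1 found in the gradient bounds for bounded and for Hoelder continuous [v]. *)
Lemma avg_weak_grad e x i : 0 < e -> e <= 1 -> B x ->
  avg rho e (gB i) x = - (e^-1 * avg (partial_derive i rho) e (f \_ B) x).
Proof.
move=> e0 e1 Bx; have en0 : e != 0 by rewrite gt_eqF.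
have cB y : B (e^-1 *: y + - (e^-1 *: ((1 - e) *: x))) -> B y.
  move=> By; have -> : y = (1 - e) *: x + e *: (e^-1 *: y + - (e^-1 *: ((1 - e) *: x))).
    by apply/rowP => j; rewrite !mxE; field.
  by apply: eball_convex => //; exact: ltW.
rewrite (avg_cov x trho e0 (intg_ i)) (avg_cov x (test_function_partial i trho) e0 intf).
by rewrite mulrCA (wg_affine i (invr_neq0 en0) trho cB) mulrN opprK.
Qed.

End weak_grad_averages.

(** The kernel is even about [x0], so its partial derivatives are odd there and reflection changes
    the sign of the integral. *)
Lemma Rint_partial_kernel i : (forall w, rho (x0 + x0 - w) = rho w) ->
  \int[mu]_w partial_derive i rho w = 0.
Proof.
move=> sym; have tp := test_function_partial i trho.
have ip := test_function_intg tp.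
have N1 : -1 != 0 :> R by rewrite oppr_eq0 oner_eq0.
have := Rintegral_affine (x0 + x0) N1 ip.
rewrite normrN1 expr1n mul1r.
have -> : \int[mu]_w partial_derive i rho (-1 *: w + (x0 + x0)) = - \int[mu]_w partial_derive i rho w.
  rewrite -[RHS]mulN1r -RintegralZl//; apply: eq_Rintegral => w _.
  have := @partial_comp_affine B rho (-1) (x0 + x0) i w N1 trho.
  rewrite (_ : (fun z => _) = rho); first by move=> ->; ring.
  by apply/funext => z; rewrite scaleN1r addrC sym.
lra.
Qed.

(** Fundamental lemma of the calculus of variations: at points of [B] an average of [h] is a pairing
    with a test function, hence 0, and the averages converge to [h] in L1. *)
Lemma test_zero_ae (h : V -> R) : intg h -> 
  (forall phi, test_function B phi -> \int[mu]_x (h x * phi x) = 0) ->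
  {ae mu, forall x, B x -> h x = 0}.
Proof.
move=> ih h0; have mB := measurable_eball x0 r.
pose e (k : nat) : R := k.+2%:R^-1.
have e0 k : 0 < e k by rewrite invr_gt0.
have e1 k : e k <= 2^-1 by rewrite lef_pV2 ?posrE// ler_nat.
have e1' k : e k <= 1 by apply: le_trans (e1 k) _; lra.
have ecvg : e @ \oo --> 0.
  apply/cvgrPdist_le => d d0; near=> k; rewrite sub0r normrN ger0_norm ?(ltW (e0 k))//.
  apply: (@le_trans _ _ (k.+1%:R^-1)); first by rewrite lef_pV2 ?posrE// ler_nat.
  by apply: ltW; near: k; exact: (near_infty_natSinv_lt (PosNum d0)).
have avg0 k x : B x -> avg rho (e k) h x = 0.
  move=> Bx; rewrite (avg_cov x trho (e0 k) ih) h0 ?mulr0//.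
  have en0 : e k != 0 by rewrite gt_eqF.
  apply: (test_function_comp_affine _ trho); first exact: invr_neq0.
  move=> y By; have -> : y = (1 - e k) *: x + e k *: ((e k)^-1 *: y + - ((e k)^-1 *: ((1 - e k) *: x))).
    by apply/rowP => j; rewrite !mxE; field.
  by apply: eball_convex => //; exact: ltW.
have hB0 : \int[mu]_x `|(h \_ B) x| = 0.
  apply/eqP; rewrite eq_le Rintegral_ge0// andbT.
  have := avg_L1_cvg trho rho_ge0 rho1 e0 e1 ecvg ih.
  move=> /cvgrPdist_le H; apply/ler_addgt0Pr => d d0; rewrite add0r.
  have [k _ /(_ k (leqnn k))] := H d d0.
  rewrite sub0r normrN ger0_norm ?Rintegral_ge0// => /(le_trans _); apply.
  apply: le_Rintegral => //.
  - by apply/intg_norm/intg_patch.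
  - by apply/intg_norm/intgB => //; exact: (intg_avgT trho rho_ge0 rho1).
  - move=> x _; rewrite patchE; case: ifPn => [|_]; last by rewrite normr0.
    by rewrite inE => /avg0 ->; rewrite sub0r normrN.
have : ae_eq mu setT (EFin \o (h \_ B)) (cst 0%E).
  have ihB := intg_patch mB ih.
  apply/(ae_eq_integral_abs mu measurableT); first exact: (measurable_int _ ihB).
  by rewrite -[RHS]/(0%:E) -hB0 EFin_Rintegral//; exact: intg_norm.
apply: filterS => x /(_ I) /= [] + Bx; rewrite patchE mem_set//.
Unshelve. all: by end_near. Qed.

End kernel.

Lemma compactly_contained_eball x0 (r s : R) : r < s ->
  compactly_contained (eball x0 r) (eball x0 s).
Proof.
move=> rs.
have sub : closure (eball x0 r) `<=` [set y | enorm (y - x0) <= r].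
  rewrite [X in _ `<=` X](closure_id _).1; first by apply: closure_subset => y /ltW.
  apply: (@closed_comp _ _ (fun y => enorm (y - x0)) [set t | t <= r]); last exact: closed_le.
  by move=> y _; exact: continuous_enormB.
split; last by move=> y /sub /= h; exact: le_lt_trans rs.
apply: (subclosed_compact (@closed_closure _ _) (@compact_closed_cube _ _ x0 r)).
move=> y /sub /= h i; apply: le_trans h; have := coord_le_enorm (y - x0) i.
by rewrite !mxE.
Qed.

Lemma L1_loc_intg U A f : measurable U -> open A -> compactly_contained A U -> L1_loc U f ->
  intg (f \_ A).
Proof.
move=> mU oA cAU [mf floc]; have AU := compactly_containedW cAU.
have mA := open_measurable_rV oA.
have mcA : measurable (closure A).
  by rewrite -[X in measurable X]setCK; apply: measurableC; apply: open_measurable_rV; rewrite openC; exact: closed_closure.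
apply: intg_restrict_int => //; first exact: measurable_funS mf.
have [cA cU] := cAU.
apply: le_lt_trans (floc _ cU cA).
apply: ge0_subset_integral => //; last exact: subset_closure.
apply/measurable_EFinP; exact: (measurableT_comp (@normr_measurable R setT) (measurable_funS mU cU mf)).
Qed.

(** Weak gradients are only locally integrable, so the fundamental lemma is applied on the smaller
    concentric balls of radius [s k], which exhaust the ball; [k.+2] keeps these radii positive from
    [k = 0] on. *)
Lemma weak_grad_ae_unique x0 (r : R) f g g' :
  is_weak_grad (eball x0 r) f g -> is_weak_grad (eball x0 r) f g' ->
  {ae mu, forall x, eball x0 r x -> g x = g' x}.
Proof.
move=> wg wg'; have mB := measurable_eball x0 r.
have [r0|r0] := ltP 0 r; last first.
  apply: aeW => x; rewrite /eball/= => h.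
  by have := lt_le_trans h r0; rewrite ltNge enorm_ge0.
pose s (k : nat) := r * (1 - k.+2%:R^-1).
have k01 (k : nat) : 0 < (k.+2%:R^-1 : R) < 1 by rewrite invr_gt0 ltr0n/= invf_lt1// ltr1n.
have s0 k : 0 < s k by have /andP[h1 h2] := k01 k; rewrite mulr_gt0// subr_gt0.
have sr k : s k < r by have /andP[h1 h2] := k01 k; rewrite gtr_pMr//; lra.
have sub k : eball x0 (s k) `<=` eball x0 r by move=> x; rewrite /eball/= => /lt_trans; apply.
suff H : forall (k : nat) (i : 'I_n),
    {ae mu, forall x, eball x0 (s k) x -> g x ord0 i = g' x ord0 i}.
  have {}H : {ae mu, forall x, forall k : nat, forall i, eball x0 (s k) x -> g x ord0 i = g' x ord0 i}.
    apply: ae_foralln => k; apply: filter_forall => i; exact: H.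
  apply: filterS H => x H Bx; apply/rowP => i.
  have q1 : enorm (x - x0) / r < 1 by rewrite ltr_pdivrMr// mul1r.
  have [k hk] := ltr_add_invr q1.
  apply: (H k); rewrite /eball/= /s mulrC -ltr_pdivrMr// ltrBrDr.
  apply: le_lt_trans hk; rewrite lerD2l lef_pV2 ?posrE// ler_nat//.
move=> k i.
have [rho [trho rho0 rho1 _]] := exists_kernel x0 (s0 k).
have [L1f L1g _] := wg; have [_ L1g' _] := wg'.
have cc := compactly_contained_eball x0 (sr k).
have oS := @eball_open _ _ x0 (s k).
have wgS := is_weak_gradS (@eball_open _ _ x0 r) oS (sub k) wg.
have wgS' := is_weak_gradS (@eball_open _ _ x0 r) oS (sub k) wg'.
have i1 := L1_loc_intg mB oS cc L1f.
have i2 j := L1_loc_intg mB oS cc (L1g j).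
have i3 j := L1_loc_intg mB oS cc (L1g' j).
have [[mf _] mg _] := wgS; have [_ mg' _] := wgS'.
have H1 := (is_weak_gradP oS mf (fun j => (mg j).1) i1 i2).1 wgS.
have H2 := (is_weak_gradP oS mf (fun j => (mg' j).1) i1 i3).1 wgS'.
have := test_zero_ae trho rho0 rho1 (intgB (i2 i) (i3 i)) _.
have H3 phi : test_function (eball x0 (s k)) phi ->
   \int[mu]_x ((((fun x => g x ord0 i) \_ (eball x0 (s k))) x -
     ((fun x => g' x ord0 i) \_ (eball x0 (s k))) x) * phi x) = 0.
  move=> tphi; have [M hM] := test_function_bounded tphi.
  have mphi := test_function_measurable tphi.
  under eq_Rintegral do rewrite mulrBl.
  rewrite RintegralB//; [|exact: (intgM mphi hM)|exact: (intgM mphi hM)].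
  have := H1 _ tphi i; rewrite (H2 _ tphi i) => /eqP; rewrite eqr_opp => /eqP ->.
  by rewrite subrr.
move=> /(_ H3); apply: filterS => x h Sx; have /eqP := h Sx.
by rewrite !patchE mem_set// subr_eq0 => /eqP.
Qed.

(** Norms and energies are defined through the representative chosen by [weak_grad]; this replaces
    it by an explicitly computed gradient. *)
Lemma weak_grad_norm_ae x0 (r : R) f g : is_weak_grad (eball x0 r) f g ->
  {ae mu, forall x, eball x0 r x -> weak_grad_norm (eball x0 r) f x = enorm (g x)}.
Proof.
move=> wg.
have wg' : is_weak_grad (eball x0 r) f (weak_grad (eball x0 r) f).
  by rewrite /weak_grad; apply: (@xgetPex _ _ [set g | is_weak_grad (eball x0 r) f g]); exists g.
by apply: filterS (weak_grad_ae_unique wg' wg) => x h Bx; rewrite /weak_grad_norm h.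
Qed.

Lemma is_weak_gradB U f f' g g' : open U ->
  intg (f \_ U) -> intg (f' \_ U) ->
  (forall i, intg ((fun x => g x ord0 i) \_ U)) ->
  (forall i, intg ((fun x => g' x ord0 i) \_ U)) ->
  is_weak_grad U f g -> is_weak_grad U f' g' ->
  is_weak_grad U (f \- f') (fun x => g x - g' x).
Proof.
move=> oU i1 i2 i3 i4 wg wg'; have mU := open_measurable_rV oU.
have [[mf _] mg _] := wg; have [[mf' _] mg' _] := wg'.
have H1 := (is_weak_gradP oU mf (fun j => (mg j).1) i1 i3).1 wg.
have H2 := (is_weak_gradP oU mf' (fun j => (mg' j).1) i2 i4).1 wg'.
have patchB (u v : V -> R) : (fun x => u x - v x) \_ U = (fun x => (u \_ U) x - (v \_ U) x).
  by apply/funext => x; rewrite !patchE; case: ifP => // _; rewrite subrr.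
have E i : (fun x => (g x - g' x) ord0 i) = (fun x => g x ord0 i - g' x ord0 i).
  by apply/funext => x; rewrite !mxE.
have i5 : intg ((f \- f') \_ U) by rewrite patchB; exact: intgB.
have i6 i : intg ((fun x => (g x - g' x) ord0 i) \_ U) by rewrite E patchB; exact: intgB.
apply/is_weak_gradP => //.
- exact: measurable_funB.
- by move=> i; rewrite E; apply: measurable_funB; [case: (mg i)|case: (mg' i)].
move=> phi tphi i; have tp := test_function_partial i tphi.
have [M hM] := test_function_bounded tphi; have mphi := test_function_measurable tphi.
have [M' hM'] := test_function_bounded tp; have mp := test_function_measurable tp.
rewrite E !patchB.
under eq_Rintegral do rewrite mulrBl.
under [in RHS]eq_Rintegral do rewrite mulrBl.
rewrite RintegralB//; [|exact: (intgM mp hM')|exact: (intgM mp hM')].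
rewrite RintegralB//; [|exact: (intgM mphi hM)|exact: (intgM mphi hM)].
by rewrite (H1 _ tphi) (H2 _ tphi); ring.
Qed.

Lemma measurable_enorm U g : measurable U -> (forall i, measurable_fun U (fun x => g x ord0 i)) ->
  measurable_fun U (fun x => enorm (g x)).
Proof.
move=> mU mg.
have ms : measurable_fun setT (@Num.sqrt R) by apply: continuous_measurable_fun; exact: sqrt_continuous.
apply: (measurableT_comp ms); apply: measurable_sum => i.
by apply: measurable_funX.
Qed.

End weak_gradients.

(** * Luxemburg norms and dominated sequences *)

Section summable_L1.
Context d (T : measurableType d) (R : realType) (mu : {measure set T -> \bar R}).
Local Notation intg f := (mu.-integrable setT (EFin \o f)).

(* The sum of the errors is integrable, hence finite almost everywhere, and it
   dominates the whole sequence. *)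
Lemma summable_L1_dominated (f_ : nat -> T -> R) f :
  (forall j, intg (f_ j)) -> intg f ->
  (forall j, \int[mu]_x `|f_ j x - f x| <= 2^-1 ^+ j) ->
  {ae mu, forall x, f_ ^~ x @ \oo --> f x} /\
  exists2 F : T -> R, intg F & {ae mu, forall x, forall j, `|f_ j x| <= F x}.
Proof.
move=> if_ intf Hf.
pose h j x := `|f_ j x - f x|.
have ih j : intg (h j) by apply/intg_norm/intgB.
have h0 j x : 0 <= h j x by exact: normr_ge0.
have mh j : measurable_fun setT (EFin \o h j) by exact: measurable_int (ih j).
pose S x := (\sum_(j <oo) (h j x)%:E)%E.
have S0 x : (0 <= S x)%E by apply: nneseries_ge0 => j _ _; rewrite lee_fin.
have mS : measurable_fun setT S.
  have H0 k x : setT x -> xpredT k -> (0 <= (EFin \o h k) x)%E by rewrite /= lee_fin.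
  exact: (ge0_emeasurable_sum (h := fun k => EFin \o h k) (P := xpredT) H0 (fun k _ => mh k)).
have iS : (\int[mu]_x S x <= 2%:E)%E.
  rewrite integral_nneseries//; last by move=> j x _; rewrite lee_fin.
  apply: lime_le.
    by apply: is_cvg_nneseries => j _ _; apply: integral_ge0 => x _; rewrite lee_fin.
  apply: nearW => m; apply: (@le_trans _ _ (\sum_(0 <= j < m) (2^-1 ^+ j)%:E)%E).
    apply: lee_sum => j _; rewrite -(EFin_Rintegral (ih j)) lee_fin.
    exact: Hf.
  rewrite sumEFin lee_fin.
  suff -> : \sum_(0 <= j < m) 2^-1 ^+ j = 2 - 2 * 2^-1 ^+ m :> R.
    by rewrite gerBl mulr_ge0 ?exprn_ge0.
  elim: m => [|m IH]; first by rewrite big_geq// expr0 mulr1 subrr.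
  by rewrite big_nat_recr//= IH exprS; field.
have intS : mu.-integrable setT S.
  apply/integrableP; split => //; under eq_integral do rewrite gee0_abs//.
  by apply: le_lt_trans iS _; rewrite ltry.
have Sfin : {ae mu, forall x, S x \is a fin_num}.
  by apply: filterS (integrable_ae measurableT intS) => x; apply.
have hS j x : S x \is a fin_num -> h j x <= fine (S x).
  move=> fx; rewrite -lee_fin fineK//.
  have := @nneseries_lim_ge R (fun i => (h i x)%:E) xpredT 0 j.+1 _.
  rewrite -/(S x) => H; apply: le_trans (H _); last by move=> i _ _; rewrite lee_fin.
  rewrite big_nat_recr//= leeDr// sume_ge0// => i _.
  by rewrite lee_fin.
split.
  apply: filterS Sfin => x Sx.
  have H : h ^~ x @ \oo --> 0.
    apply: cvg_series_cvg_0; apply: nondecreasing_is_cvgn.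
      by apply: nondecreasing_series => j _ _; exact: h0.
    exists (fine (S x)) => _ [m _ <-]; rewrite -lee_fin fineK// /series/= -sumEFin.
    by apply: nneseries_lim_ge => j _ _; rewrite lee_fin.
  apply/cvgrPdist_le => e e0; move/cvgrPdist_le : H => /(_ e e0).
  by apply: filterS => j; rewrite sub0r normrN normr_id distrC.
exists (fun x => `|f x| + fine (S x)).
  apply: intgD; first exact: intg_norm.
  apply: (le_integrable measurableT _ _ intS).
    by apply/measurable_EFinP; exact: (measurableT_comp (fine_measurable measurableT) mS).
  move=> x _ /=; have := S0 x; case: (S x) => [s| |] //= _.
  by rewrite normr0 leey.
apply: filterS Sfin => x Sx j; rewrite -[f_ j x](subrK (f x)) addrC.
by apply: le_trans (ler_normD _ _) _; rewrite lerD2l; exact: hS.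
Qed.

End summable_L1.

Section norms.
Context {R : realType} {n : nat}.
Local Notation V := 'rV[R]_n.
Local Notation mu := (lebesgue_rV R n).
Local Notation intg f := (mu.-integrable setT (EFin \o f)).
Implicit Types (u f : V -> R) (U : set V) (G : R -> R).

Lemma intg_le_ae f (F : V -> R) : measurable_fun setT f ->
  {ae mu, forall x, `|f x| <= F x} -> intg F -> intg f.
Proof.
move=> mf fF iF; apply/integrableP; split; first exact/measurable_EFinP.
have iF' := intg_norm iF.
apply: (@le_lt_trans _ _ (\int[mu]_x `|F x|%:E)%E); last first.
  by rewrite -EFin_Rintegral// ltry.
apply: ae_ge0_le_integral => //.
- by apply: measurableT_comp => //; exact/measurable_EFinP.
- exact: (measurable_int _ iF').
- by apply: filterS fF => x h _; rewrite lee_fin (le_trans h)// ler_norm.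
Qed.

Lemma intg_restrict_le U u (F : V -> R) : measurable U -> measurable_fun U u ->
  intg (F \_ U) -> (forall x, U x -> `|u x| <= F x) -> intg (u \_ U).
Proof.
move=> mU mu' iF uF; apply: (@intg_le _ _ _ mu _ (F \_ U)) => //.
  exact: ((measurable_restrictT u mU).1 mu').
by move=> x; rewrite !patchE; case: ifPn => [|_]; rewrite ?normr0// inE => /uF.
Qed.

Lemma intg_restrict_cst U (c : R) : measurable U -> (mu U < +oo)%E -> intg ((fun=> c) \_ U).
Proof.
move=> mU Uoo; apply: (@integrable_bounded_support _ _ U _ `|c|) => //.
- exact: ((measurable_restrictT (fun=> c) mU).1 (measurable_cst _)).
- by move=> x; rewrite patchE; case: ifP; rewrite ?normr0.
- by move=> x Ux; rewrite patchE memNset.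
Qed.

Lemma measurable_orlicz U G u : orlicz_function G -> measurable U -> measurable_fun U u ->
  (forall x, U x -> 0 <= u x) -> measurable_fun U (fun x => G (u x)).
Proof.
move=> P mU mu' u0.
have mG : measurable_fun setT (orlicz_sym G).
  by apply: continuous_measurable_fun; exact: continuous_orlicz_sym.
have := measurableT_comp mG mu'; apply: eq_measurable_fun => x.
by rewrite inE => /u0 ux; rewrite /= orlicz_symE.
Qed.

Lemma cvg_orlicz G (s : nat -> R) (t : R) : orlicz_function G -> (forall k, 0 <= s k) -> 0 <= t ->
  s @ \oo --> t -> G (s k) @[k --> \oo] --> G t.
Proof.
move=> P s0 t0 st; rewrite -(orlicz_symE G t0).
have := cvg_comp _ _ st (continuous_orlicz_sym P (x := t)).
apply: cvg_trans; apply: near_eq_cvg; apply: nearW => k /=.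
by rewrite orlicz_symE.
Qed.

Lemma orlicz_intg U G u : orlicz_function G -> measurable U -> (mu U < +oo)%E ->
  measurable_fun U u -> intg ((fun x => G `|u x|) \_ U) -> intg (u \_ U).
Proof.
move=> P mU Uoo mu' iG; have [C C0 hC] := orlicz_superlinear P.
have := intgD (intg_restrict_cst C mU Uoo) iG => iF.
apply: (@intg_restrict_le U u (fun x => C + G `|u x|)) => //.
  apply: eq_integrable iF => // x _ /=; rewrite !patchE; case: ifP => //.
  by rewrite addr0.
by move=> x _; exact: hC.
Qed.

Lemma luxemburg_ge0 U Psi u : (0 <= luxemburg_norm U Psi u :> \bar R)%E.
Proof.
by apply: le_ereal_inf_tmp => _ [l [l0 _] <-]; rewrite lee_fin ltW.
Qed.

Lemma luxemburg_le U Psi u (l : R) : 0 < l ->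
  (\int[mu]_(x in U) (Psi x (`|u x| / l))%:E <= 1)%E ->
  (luxemburg_norm U Psi u <= l%:E)%E.
Proof. by move=> l0 h; apply: ereal_inf_lbound; exists l. Qed.

Lemma luxemburg_fin U G u : orlicz_function G -> measurable U -> measurable_fun U u ->
  intg ((fun x => G `|u x|) \_ U) -> (luxemburg_norm U (fun=> G) u < +oo)%E.
Proof.
move=> P mU mu' iG.
(* The witness is [I + 1], at least 1: convexity gives G(t / (I + 1)) <= G(t) / (I + 1), hence a
   modular of at most I / (I + 1). *)
pose I := \int[mu]_x ((fun x => G `|u x|) \_ U) x.
have I0 : 0 <= I.
  by apply: Rintegral_ge0 => x _; rewrite patchE; case: ifP => // _; exact: orlicz_ge0.
have l1 : 1 <= I + 1 by rewrite lerDr.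
have l0 : 0 < I + 1 by exact: lt_le_trans l1.
apply: le_lt_trans (luxemburg_le l0 _) (ltry _).
rewrite integral_restrict.
apply: (@le_trans _ _ (\int[mu]_x (((I + 1)^-1 * ((fun x => G `|u x|) \_ U) x)%:E))%E).
  apply: ge0_le_integral => //.
  - by move=> x _; rewrite lee_fin patchE; case: ifP => // _; rewrite (orlicz_ge0 P)// divr_ge0// ltW.
  - apply/measurable_EFinP.
    have m1 : measurable_fun U (fun x => G (`|u x| / (I + 1))).
      apply: (measurable_orlicz P mU) => [|x _]; last by rewrite divr_ge0// ltW.
      by apply: measurable_funM => //; exact: (measurableT_comp (@normr_measurable R setT) mu').
    exact: ((measurable_restrictT _ mU).1 m1).
  - apply: (measurable_int mu); apply: intgZ iG.
  - move=> x _; rewrite lee_fin !patchE; case: ifP => _; last by rewrite mulr0.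
    by rewrite [leRHS]mulrC; apply: (orlicz_divr P).
rewrite -EFin_Rintegral; last exact: intgZ.
by rewrite lee_fin RintegralZl// -/I ler_pdivrMl// mulr1 lerDl.
Qed.

(** A finite norm provides some [l] with modular at most 1, and doubling of [G] undoes the division
    by [l]. *)
Lemma luxemburg_intg U G Psi u : orlicz_function G -> measurable U -> measurable_fun U u ->
  (forall x t, U x -> 0 <= t -> G t <= Psi x t) ->
  (forall l : R, 0 < l -> measurable_fun U (fun x => Psi x (`|u x| / l))) ->
  (luxemburg_norm U Psi u < +oo)%E -> intg ((fun x => G `|u x|) \_ U).
Proof.
move=> P mU mu' GPsi mPsi.
move=> /ereal_inf_lt [_ [l [l0 Hl] <-] _].
have [C C1 hC] := orlicz_mul P (ltW l0).
have iPsi : intg ((fun x => Psi x (`|u x| / l)) \_ U).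
  apply: intg_restrict_int => //; first exact: mPsi.
  apply: (@le_lt_trans _ _ 1%E); last exact: ltry.
  apply: le_trans Hl; apply: ge0_le_integral => //.
  - by apply/measurable_EFinP; apply: measurableT_comp => //; exact: mPsi.
  - by apply/measurable_EFinP; exact: mPsi.
  - move=> x Ux; rewrite lee_fin ger0_norm//.
    apply: le_trans (GPsi x _ Ux _); last by rewrite divr_ge0// ltW.
    by apply: (orlicz_ge0 P); rewrite divr_ge0// ltW.
have mG : measurable_fun U (fun x => G `|u x|).
  apply: (measurable_orlicz P mU) => //.
  exact: (measurableT_comp (@normr_measurable R setT) mu').
apply: (@intg_restrict_le U _ (fun x => C * Psi x (`|u x| / l))) => //.
  apply: eq_integrable (intgZ C iPsi) => // x _ /=; rewrite !patchE; case: ifP => //.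
  by rewrite mulr0.
move=> x Ux; rewrite ger0_norm; last exact: (orlicz_ge0 P).
have tl : 0 <= `|u x| / l by rewrite divr_ge0// ltW.
have -> : G `|u x| = G (l * (`|u x| / l)) by rewrite mulrC divfK// gt_eqF.
apply: le_trans (hC _ tl) _; rewrite ler_wpM2l//; first exact: le_trans C1.
exact: GPsi.
Qed.

(* By the doubling condition modular convergence implies norm convergence. *)
Lemma luxemburg_cvg0 U G (u_ : nat -> V -> R) (F : V -> R) : orlicz_function G ->
  measurable U -> (forall k, measurable_fun U (u_ k)) -> intg F ->
  {ae mu, forall x, U x -> u_ ^~ x @ \oo --> 0} ->
  {ae mu, forall x, U x -> forall k, G `|u_ k x| <= F x} ->
  luxemburg_norm U (fun=> G) (u_ k) @[k --> \oo] --> 0%E.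
Proof.
move=> P mU mu_ iF u0 uF.
(* For fixed [l] the functions G(|u_k| / l) are dominated by a multiple of |F|; their integrals tend
   to 0, hence are eventually at most 1, which means norm at most [l]. *)
have H (l : R) : 0 < l -> \forall k \near \oo, (luxemburg_norm U (fun=> G) (u_ k) <= l%:E)%E.
  move=> l0; have li0 : 0 <= l^-1 by rewrite invr_ge0 ltW.
  have [C C1 hC] := orlicz_mul P li0.
  pose h k := (fun x => G (`|u_ k x| / l)) \_ U.
  have mh k : measurable_fun setT (h k).
    apply: ((measurable_restrictT _ mU).1).
    apply: (measurable_orlicz P mU) => [|x _]; last by rewrite mulr_ge0.
    by apply: measurable_funM => //; exact: (measurableT_comp (@normr_measurable R setT) (mu_ k)).
  have Hae : {ae mu, forall x, forall k, `|h k x| <= C * `|F x|}.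
    apply: filterS uF => x hx k; rewrite /h patchE; case: ifPn => xU; last first.
      by rewrite normr0 mulr_ge0// (le_trans _ C1).
    rewrite ger0_norm; last by apply: (orlicz_ge0 P); rewrite mulr_ge0.
    rewrite mulrC; apply: le_trans (hC _ _) _ => //.
    rewrite ler_wpM2l//; first exact: le_trans C1.
    by apply: le_trans (hx _ k) (ler_norm _); move: xU; rewrite inE.
  have [] := @dominated_Rintegral _ _ _ mu h (cst 0) (fun x => C * `|F x|) => //.
  - apply: filterS u0 => x h0; rewrite /h; have [Ux|Ux] := pselect (U x); last first.
      under eq_fun do rewrite patchE memNset//.
      exact: cvg_cst.
    under eq_fun do rewrite patchE mem_set//.
    have := @cvg_orlicz G (fun k => `|u_ k x| / l) 0 P; rewrite (orlicz0 P); apply => //.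
      by move=> k; rewrite mulr_ge0.
    by have := cvgM (cvg_norm (h0 Ux)) (cvg_cst l^-1); rewrite normr0 mul0r; apply.
  - by apply: intgZ; exact: intg_norm.
  move=> _ _; rewrite Rintegral_cst// mul0r => /cvgrPdist_le /(_ 1 ltr01).
  have ih k : intg (h k).
    apply: (@intg_le_ae _ (fun x => C * `|F x|)) => //; last exact/intgZ/intg_norm.
    by apply: filterS Hae => x; apply.
  apply: filterS => k; rewrite sub0r normrN => /(le_trans (ler_norm _)) hk.
  apply: luxemburg_le => //; rewrite integral_restrict -EFin_Rintegral ?lee_fin//.
  exact: ih.
apply/fine_cvgP; split.
  apply: filterS (H 1 ltr01) => k hk; rewrite ge0_fin_numE ?luxemburg_ge0//.
  by apply: le_lt_trans hk (ltry _).
apply/cvgrPdist_le => e e0; apply: filterS (H e e0) => k hk /=.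
rewrite sub0r normrN ger0_norm ?fine_ge0 ?luxemburg_ge0//.
rewrite -lee_fin fineK// ge0_fin_numE ?luxemburg_ge0//.
by apply: le_lt_trans hk (ltry _).
Qed.

Lemma Linfty_norm_le U u (M : R) : 0 <= M -> {ae mu, forall x, U x -> `|u x| <= M} ->
  (Linfty_norm U u <= M%:E)%E.
Proof.
move=> M0 uM; rewrite /Linfty_norm unlock; case: ifP => // _.
apply/ess_supP; apply: filterS uM => x h /=.
rewrite patchE; case: ifPn => xU /=; rewrite lee_fin ?normr0//.
by apply: h; move: xU; rewrite inE.
Qed.

Lemma Linfty_norm_ae U u : (0 < mu setT)%E -> (Linfty_norm U u < +oo)%E ->
  exists2 M : R, 0 <= M & Linfty_norm U u = M%:E /\ {ae mu, forall x, U x -> `|u x| <= M}.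
Proof.
move=> mu0 Loo; have L0 : (0 <= Linfty_norm U u)%E by exact: Lnorm_ge0.
exists (fine (Linfty_norm U u)); first exact: fine_ge0.
have E : (fine (Linfty_norm U u))%:E = Linfty_norm U u by rewrite fineK// ge0_fin_numE.
split => //.
have : {ae mu, forall x, (`|(EFin \o (u \_ U)) x| <= Linfty_norm U u)%E}.
  (* [mu0] selects the branch of the definition of the norm that is the essential supremum. *)
  rewrite /Linfty_norm unlock mu0; exact: ess_sup_ge.
by apply: filterS => x h Ux; rewrite -lee_fin E; move: h; rewrite /= patchE mem_set.
Qed.

End norms.

(** * The multi-phase density *)

Section moduli.
Context {R : realType}.

(** A concave function that stays nonnegative on the half-line cannot decrease. For given [e], the
    far point [T] makes [t] the convex combination of [s] and [T] with weight w(s) / (e + w(s)) on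
    [s]; dropping the nonnegative term w(T) then costs at most [e]. *)
Lemma modulus_le (w : R -> R) (s t : R) : concave_modulus w -> 0 <= s -> s <= t -> w s <= w t.
Proof.
move=> P s0; rewrite le_eqVlt => /predU1P[->//|st].
have ws0 := modulus_ge0 P s0.
apply/ler_addgt0Pr => e e0.
have ew : 0 < e + w s by rewrite ltr_pwDl.
pose T := s + (t - s) * ((e + w s) / e).
have T0 : 0 <= T.
  by rewrite addr_ge0// mulr_ge0 ?subr_ge0 ?(ltW st)// divr_ge0// ltW.
have l01 : 0 <= w s / (e + w s) <= 1.
  by rewrite divr_ge0 ?(ltW ew)//= ler_pdivrMr// mul1r lerDr ltW.
have /andP[l0 l1] := l01.
have H : - w (w s / (e + w s) * s + (1 - w s / (e + w s)) * T) <=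
    w s / (e + w s) * - w s + (1 - w s / (e + w s)) * - w T.
  have := @modulus_concave _ _ P (Itv01 l0 l1) s T.
  by rewrite !inE/= !in_itv/= !andbT => /(_ s0 T0).
move: H; have -> : w s / (e + w s) * s + (1 - w s / (e + w s)) * T = t.
  by rewrite /T; field; rewrite !gt_eqF.
have wT := modulus_ge0 P T0.
have h1 : 0 <= (1 - w s / (e + w s)) * w T by rewrite mulr_ge0// subr_ge0.
have h2 : w s - e <= w s / (e + w s) * w s.
  by rewrite mulrAC ler_pdivlMr//; nra.
lra.
Qed.

(** The quotient w / (1 + w) is nondecreasing, which replaces [d] by [s]. Its denominator is cleared
    because w(s) is bounded for [s <= m]. Doubling of [Ha] and [Hb] removes [K] on the left, while
    G(t / K) <= G(t) suffices on the right. *)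
Lemma Lambda_gap (G Ha Hb wa wb : R -> R) (K L m : R) :
  orlicz_function G -> orlicz_function Ha -> orlicz_function Hb ->
  concave_modulus wa -> concave_modulus wb -> 1 <= K ->
  exists2 C : R, 0 <= C & forall t s d : R, 0 < t -> 0 <= s -> s <= m -> s <= d ->
    Lambda G Ha Hb wa wb d (t / K) <= L ->
    wa s * Ha t <= C * G t /\ wb s * Hb t <= C * G t.
Proof.
move=> GP HaP HbP waP wbP K1; have K0 : 0 < K by exact: lt_le_trans K1.
have frac (w : R -> R) (P : concave_modulus w) (s d : R) : 0 <= s -> s <= d ->
    w s / (1 + w s) <= w d / (1 + w d).
  move=> s0 sd; have h := modulus_le P s0 sd; have h0 := modulus_ge0 P s0.
  rewrite ler_pdivrMr ?ltr_pwDl// mulrAC ler_pdivlMr ?ltr_pwDl//; last exact: le_trans h.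
  by nra.
have one (H w : R -> R) : orlicz_function H -> concave_modulus w ->
    exists2 C : R, 0 <= C & forall t s d : R, 0 < t -> 0 <= s -> s <= m -> s <= d ->
      w d / (1 + w d) * (H (t / K) / G (t / K)) <= L -> w s * H t <= C * G t.
  move=> HP P; have [C C1 hC] := orlicz_mul HP (ltW K0).
  exists (C * (1 + `|w m|) * `|L|).
    by rewrite !mulr_ge0// (le_trans _ C1).
  move=> t s d t0 s0 sm sd hL; set tau := t / K in hL *.
  have tau0 : 0 < tau by rewrite divr_gt0.
  have Gtau := orlicz_gt0 GP tau0.
  have Htau := orlicz_gt0 HP tau0.
  have ws0 := modulus_ge0 P s0.
  have wsm : w s <= `|w m| by apply: le_trans (modulus_le P s0 sm) (ler_norm _).
  have h1 : w s / (1 + w s) * (H tau / G tau) <= `|L|.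
    apply: le_trans (le_trans hL (ler_norm _)); rewrite ler_wpM2r ?divr_ge0 ?(ltW Gtau) ?(ltW Htau)//.
    exact: frac.
  have w1 : 0 < 1 + w s by rewrite ltr_pwDl.
  have h2 : w s * H tau <= (1 + `|w m|) * `|L| * G tau.
    have : w s / (1 + w s) * (H tau / G tau) * ((1 + w s) * G tau) <= `|L| * ((1 + w s) * G tau).
      by rewrite ler_wpM2r// mulr_ge0 ?(ltW w1) ?(ltW Gtau).
    have -> : w s / (1 + w s) * (H tau / G tau) * ((1 + w s) * G tau) = w s * H tau.
      by field; rewrite !gt_eqF.
    move=> /le_trans; apply; rewrite mulrCA -!mulrA ler_wpM2r ?mulr_ge0 ?(ltW Gtau)//.
    by rewrite lerD2l.
  have Ht : H t <= C * H tau by rewrite -{1}(divfK (lt0r_neq0 K0) t) mulrC; exact/hC/ltW.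
  have GG : G tau <= G t.
    by apply: (orlicz_le GP); [exact: ltW|rewrite ler_pdivrMr// ler_peMr// ltW].
  apply: (@le_trans _ _ (w s * (C * H tau))); first by rewrite ler_wpM2l.
  rewrite mulrCA -!mulrA; apply: ler_wpM2l; first by rewrite (le_trans _ C1).
  apply: le_trans h2 _; rewrite -mulrA; apply: ler_wpM2l; first by rewrite addr_ge0.
  exact: ler_wpM2l.
have [C1 C10 H1] := one Ha wa HaP waP; have [C2 C20 H2] := one Hb wb HbP wbP.
have pos (H w : R -> R) (d t : R) : orlicz_function H -> concave_modulus w -> 0 <= d -> 0 < t ->
    0 <= w d / (1 + w d) * (H (t / K) / G (t / K)).
  move=> HP P d0 t0; have wd := modulus_ge0 P d0.
  have tK : 0 <= t / K by rewrite divr_ge0// ltW.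
  by rewrite mulr_ge0// divr_ge0 ?addr_ge0// ?(orlicz_ge0 HP)// (orlicz_ge0 GP).
exists (C1 + C2); first exact: addr_ge0.
move=> t s d t0 s0 sm sd hL; have d0 := le_trans s0 sd.
have G0 : 0 <= G t by exact/(orlicz_ge0 GP)/ltW.
have pa := pos Ha wa d t HaP waP d0 t0; have pb := pos Hb wb d t HbP wbP d0 t0.
rewrite /Lambda in hL; split.
  apply: le_trans (H1 t s d t0 s0 sm sd _) _; first lra.
  by rewrite ler_wpM2r// lerDl.
apply: le_trans (H2 t s d t0 s0 sm sd _) _; first lra.
by rewrite ler_wpM2r// lerDr.
Qed.

End moduli.

Section multi_phase_density.
Context {R : realType} {n : nat}.
Local Notation V := 'rV[R]_n.

Variables (G Ha Hb : R -> R) (a b : V -> R).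
Hypotheses (GP : orlicz_function G) (HaP : orlicz_function Ha) (HbP : orlicz_function Hb).
Local Notation Psi := (multi_phase G Ha Hb a b).

Lemma multi_phase_ge x (t : R) : 0 <= a x -> 0 <= b x -> 0 <= t ->
  [/\ G t <= Psi x t, a x * Ha t <= Psi x t & b x * Hb t <= Psi x t].
Proof.
move=> a0 b0 t0; rewrite /multi_phase.
have := orlicz_ge0 GP t0; have := mulr_ge0 a0 (orlicz_ge0 HaP t0).
by have := mulr_ge0 b0 (orlicz_ge0 HbP t0); split; lra.
Qed.

Lemma measurable_multi_phase (U : set V) (u : V -> R) : measurable U ->
  measurable_fun U a -> measurable_fun U b ->
  measurable_fun U u -> (forall x, U x -> 0 <= u x) ->
  measurable_fun U (fun x => Psi x (u x)).
Proof.
move=> mU ma mb mu' u0; apply: measurable_funD; first apply: measurable_funD.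
- exact: measurable_orlicz.
- by apply: measurable_funM => //; exact: measurable_orlicz.
- by apply: measurable_funM => //; exact: measurable_orlicz.
Qed.

Lemma multi_phase_cvg x (s : nat -> R) (t : R) : (forall k, 0 <= s k) -> 0 <= t ->
  s @ \oo --> t -> Psi x (s k) @[k --> \oo] --> Psi x t.
Proof.
move=> s0 t0 st; rewrite /multi_phase; apply: cvgD; first apply: cvgD.
- exact: cvg_orlicz.
- by apply: cvgM; [exact: cvg_cst|exact: cvg_orlicz].
- by apply: cvgM; [exact: cvg_cst|exact: cvg_orlicz].
Qed.

End multi_phase_density.

(** * The pointwise bound for the averaged gradient *)

Section approximation.
Context {R : realType} {n : nat}.
Local Notation V := 'rV[R]_n.
Local Notation mu := (lebesgue_rV R n).
Local Notation intg f := (mu.-integrable setT (EFin \o f)).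

Variables (x0 : V) (r : R) (rho : V -> R).
Hypotheses (trho : test_function (eball x0 r) rho).
Hypotheses (rho_ge0 : forall w, 0 <= rho w) (rho1 : (\int[mu]_w (rho w)%:E = 1)%E).
Local Notation B := (eball x0 r).

Variables (G Ha Hb wa wb : R -> R) (a b : V -> R) (v : V -> R) (g : V -> V).
Hypotheses (GP : orlicz_function G) (HaP : orlicz_function Ha) (HbP : orlicz_function Hb).
Hypotheses (a_ge0 : forall x, B x -> 0 <= a x) (b_ge0 : forall x, B x -> 0 <= b x).
Local Notation Psi := (multi_phase G Ha Hb a b).
Hypothesis wg : is_weak_grad B v g.
Let PsiB := (fun x => Psi x (enorm (g x))) \_ B.
Hypothesis iPsi : intg PsiB.

Let hB := (fun x => enorm (g x)) \_ B.
Let gB i := (fun x => g x ord0 i) \_ B.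

(** By [weak_grad_avg], the weak gradient in [B] of the average of [v]. *)
Definition grad_avg e x := \row_i ((1 - e) * avg rho e (gB i) x).

Let mB : measurable B. Proof. exact: measurable_eball. Qed.
Let Boo : (mu B < +oo)%E. Proof. exact: eball_finite. Qed.

Let mg i : measurable_fun B (fun x => g x ord0 i).
Proof. by have [_ /(_ i)[]] := wg. Qed.

Let mv : measurable_fun B v. Proof. by have [[]] := wg. Qed.

Let mhB : measurable_fun B (fun x => enorm (g x)).
Proof. exact: measurable_enorm. Qed.

Let Psi_ge x (t : R) : B x -> 0 <= t ->
  [/\ G t <= Psi x t, a x * Ha t <= Psi x t & b x * Hb t <= Psi x t].
Proof. by move=> Bx t0; apply: multi_phase_ge => //; [exact: a_ge0|exact: b_ge0]. Qed.

Let PsiB_ge0 x : 0 <= PsiB x.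
Proof.
rewrite /PsiB patchE; case: ifPn => //; rewrite inE => Bx.
have [h _ _] := Psi_ge Bx (enorm_ge0 (g x)).
exact: le_trans (orlicz_ge0 GP (enorm_ge0 _)) h.
Qed.

Let hB_ge0 x : 0 <= hB x.
Proof. by rewrite /hB patchE; case: ifP => // _; exact: enorm_ge0. Qed.

Lemma intg_enorm_grad : intg hB.
Proof.
apply: (orlicz_intg GP) => //.
apply: (@intg_restrict_le _ _ _ _ (fun x => Psi x (enorm (g x)))) => //.
  apply: (measurable_orlicz GP) => //.
  exact: (measurableT_comp (@normr_measurable R setT) mhB).
move=> x Bx; rewrite (ger0_norm (enorm_ge0 _)) ger0_norm; last exact/(orlicz_ge0 GP)/enorm_ge0.
by have [] := Psi_ge Bx (enorm_ge0 (g x)).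
Qed.

Lemma intg_grad i : intg (gB i).
Proof.
apply: (@intg_restrict_le _ _ _ _ (fun x => enorm (g x))) => //; first exact: intg_enorm_grad.
by move=> x _; exact: coord_le_enorm.
Qed.

Let gB_hB i x : `|gB i x| <= hB x.
Proof.
by rewrite /gB /hB !patchE; case: ifP => _; [exact: coord_le_enorm|rewrite normr0].
Qed.

(* Jensen's inequality is applied to the truncation of |g| to the points that
   contribute to the average at x: c Phi(|g|) is only controlled there. *)
Lemma avg_orlicz_le Phi : orlicz_function Phi -> exists2 C : R, 1 <= C &
  forall (c e : R) x, 0 <= c -> 0 < e -> e <= 2^-1 -> B x ->
    (forall y, B y -> enorm (x - y) <= 2 * r * e -> c * Phi (enorm (g y)) <= Psi y (enorm (g y))) ->
    c * Phi (enorm (grad_avg e x)) <= C * avg rho e PsiB x.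
Proof.
move=> P; have [C C1 hC] := orlicz_mul P (ler0n R n).
(* The case [c = 0] is separate because integrability of [Phi (h y)] is obtained below from the
   bound by [PsiB y] divided by [c]. *)
exists C => // c e x; rewrite le_eqVlt => /predU1P[<- e0 e1 Bx _|c0 e0 e1 Bx H].
  by rewrite mul0r mulr_ge0 ?(le_trans _ C1)//; exact: avg_ge0.
have e1' : e <= 1 by lra.
pose N := [set y | B y /\ enorm (x - y) <= 2 * r * e].
have NE : N = B `&` [set y | enorm (y - x) <= 2 * r * e].
  apply/seteqP; split => y [By h]; split => //.
    by rewrite /= -opprB enormN.
  by rewrite -opprB enormN.
have mN : measurable N.
  rewrite NE; apply: measurableI => //; rewrite -[X in measurable X]setCK.
  apply: measurableC; apply: open_measurable_rV.
  rewrite (_ : ~` _ = (fun y => enorm (y - x)) @^-1` [set t | 2 * r * e < t]).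
    by apply: open_comp; [move=> y _; exact: continuous_enormB|exact: open_gt].
  by apply/seteqP; split=> y /=; rewrite ltNge => /negP.
pose h := hB \_ N.
have h0 y : 0 <= h y by rewrite /h patchE; case: ifP.
have ih : intg h by apply: intg_patch => //; exact: intg_enorm_grad.
have hN y : N y -> h y = enorm (g y).
  by move=> Ny; rewrite /h /hB !patchE mem_set// mem_set//; case: Ny.
have hnN y : ~ N y -> h y = 0 by move=> Ny; rewrite /h patchE memNset.
have cPh y : c * Phi (h y) <= PsiB y.
  have [Ny|Ny] := pselect (N y); last by rewrite hnN// (orlicz0 P) mulr0.
  by rewrite hN// /PsiB patchE mem_set; case: Ny => // By xy; exact: H.
have iPh : intg (fun y => Phi (h y)).
  apply: (@intg_le _ _ _ mu _ (fun y => c^-1 * PsiB y)); last exact: intgZ.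
    have mh : measurable_fun setT h by exact: intg_measurable ih.
    exact: (measurable_orlicz P).
  move=> y; rewrite ger0_norm; last exact: (orlicz_ge0 P).
  by rewrite ler_pdivlMl.
have m0 : 0 <= avg rho e h x by exact: avg_ge0.
(* Coordinates are averaged one by one, which costs a factor [n] inside [Phi]; the constant [C] is
   chosen to absorb it. *)
have tle : enorm (grad_avg e x) <= n%:R * avg rho e h x.
  apply: le_trans (enorm_le_sum _) _; have -> : n%:R * avg rho e h x = \sum_(i < n) avg rho e h x.
    by rewrite sumr_const card_ord mulr_natl.
  apply: ler_sum => i _; rewrite mxE normrM.
  apply: (@le_trans _ _ `|avg rho e (gB i) x|).
    by rewrite ler_piMl// ger0_norm; lra.
  apply: le_trans (avg_norm trho rho_ge0 x e0 (intg_grad i)) _.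
  apply: (avg_le trho rho_ge0 e0 e1' _ ih Bx); first exact/intg_norm/intg_grad.
  move=> y By xy; rewrite hN//; have := gB_hB i y.
  by rewrite /hB patchE mem_set.
apply: (@le_trans _ _ (c * (C * Phi (avg rho e h x)))).
  rewrite ler_wpM2l ?(ltW c0)//; apply: le_trans (hC _ m0).
  by apply: (orlicz_le P) => //; exact: enorm_ge0.
rewrite mulrCA ler_wpM2l//; first by rewrite (le_trans _ C1).
apply: (@le_trans _ _ (c * avg rho e (fun y => Phi (h y)) x)).
  rewrite ler_wpM2l ?(ltW c0)//.
  exact: (avg_jensen trho rho_ge0 rho1).
rewrite -(avgZ trho)//.
by apply: (avg_le trho rho_ge0 e0 e1' _ iPsi Bx); [exact: intgZ|move=> y _ _; exact: cPh].
Qed.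

Hypotheses (waP : concave_modulus wa) (wbP : concave_modulus wb).
Variables (Ma Mb : R).
Hypotheses (Ma0 : 0 <= Ma) (Mb0 : 0 <= Mb).
Hypothesis aM : forall x y, B x -> B y -> a x - a y <= Ma * wa (enorm (x - y)).
Hypothesis bM : forall x y, B x -> B y -> b x - b y <= Mb * wb (enorm (x - y)).
Variables (Cgap : R).
Hypothesis Cgap0 : 0 <= Cgap.
Hypothesis gap : forall e x, 0 < e -> e <= 2^-1 -> B x ->
  let t := enorm (grad_avg e x) in
  wa (2 * r * e) * Ha t <= Cgap * G t /\ wb (2 * r * e) * Hb t <= Cgap * G t.

Lemma multi_phase_avg_le : exists2 C : R, 0 <= C &
  forall e x, 0 < e -> e <= 2^-1 -> B x ->
    Psi x (enorm (grad_avg e x)) <= C * avg rho e PsiB x.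
Proof.
have [CG CG1 hG] := avg_orlicz_le GP.
have one (c H w : _ -> R) (M : R) : orlicz_function H -> concave_modulus w -> 0 <= M ->
    (forall x, B x -> 0 <= c x) ->
    (forall x y, B x -> B y -> c x - c y <= M * w (enorm (x - y))) ->
    (forall y, B y -> c y * H (enorm (g y)) <= Psi y (enorm (g y))) ->
    exists2 C, 0 <= C & forall e x, 0 < e -> e <= 2^-1 -> B x ->
      c x * H (enorm (grad_avg e x)) <=
      C * avg rho e PsiB x + M * (w (2 * r * e) * H (enorm (grad_avg e x))).
  move=> HP P M0 c0 cM cPsi.
  have [C C1 hH] := avg_orlicz_le HP; exists C; first by rewrite (le_trans _ C1).
  move=> e x e0 e1 Bx; set t := enorm _.
  have Ht : 0 <= H t by exact/(orlicz_ge0 HP)/enorm_ge0.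
  (* Lower bound of the coefficient over the points that contribute at [x], cut off at 0 so that
     [avg_orlicz_le] accepts it as a nonnegative constant. *)
  pose d := Num.max 0 (c x - M * w (2 * r * e)).
  have d0 : 0 <= d by rewrite le_max lexx.
  have cd : c x <= d + M * w (2 * r * e) by rewrite -lerBlDr le_max lexx orbT.
  apply: (@le_trans _ _ ((d + M * w (2 * r * e)) * H t)); first by rewrite ler_wpM2r.
  rewrite mulrDl -(mulrA M) lerD2r; apply: hH => // y By xy.
  apply: le_trans (cPsi y By); rewrite ler_wpM2r; first by [].
    exact/(orlicz_ge0 HP)/enorm_ge0.
  rewrite ge_max c0//= lerBlDr addrC -lerBlDr; apply: le_trans (cM x y Bx By) _.
  by rewrite ler_wpM2l// (modulus_le P)// enorm_ge0.
have [Ca Ca0 hA] := one a Ha wa Ma HaP waP Ma0 a_ge0 aM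
  (fun y By => let: And3 _ h _ := Psi_ge By (enorm_ge0 (g y)) in h).
have [Cb Cb0 hB'] := one b Hb wb Mb HbP wbP Mb0 b_ge0 bM
  (fun y By => let: And3 _ _ h := Psi_ge By (enorm_ge0 (g y)) in h).
have CG0 : 0 <= CG by rewrite (le_trans _ CG1).
exists (CG * (1 + (Ma + Mb) * Cgap) + Ca + Cb).
  by rewrite !addr_ge0// mulr_ge0// addr_ge0// mulr_ge0// addr_ge0.
move=> e x e0 e1 Bx; have [g1 g2] := gap e0 e1 Bx.
have := hA e x e0 e1 Bx; have := hB' e x e0 e1 Bx.
have := hG 1 e x ler01 e0 e1 Bx _; rewrite mul1r.
have hGP y : B y -> enorm (x - y) <= 2 * r * e -> 1 * G (enorm (g y)) <= Psi y (enorm (g y)).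
  by move=> By _; rewrite mul1r; have [] := Psi_ge By (enorm_ge0 (g y)).
move=> /(_ hGP); rewrite /multi_phase; set A := avg _ _ _ _; set t := enorm _ => h1 h2 h3.
have h4 := ler_wpM2l Ma0 g1; have h5 := ler_wpM2l Mb0 g2.
have MC : 0 <= (Ma + Mb) * Cgap by rewrite mulr_ge0// addr_ge0.
have h6 := ler_wpM2l MC h1.
nra.
Qed.

End approximation.

(** * Convergence of averages *)

Section orlicz_sobolev.
Context {R : realType} {n : nat}.
Local Notation V := 'rV[R]_n.
Local Notation mu := (lebesgue_rV R n).
Local Notation intg f := (mu.-integrable setT (EFin \o f)).

Lemma enorm_dist (x y : V) : `|enorm y - enorm x| <= enorm (x - y).
Proof.
have hx : enorm x <= enorm (x - y) + enorm y.
  by apply: le_trans (enormD _ _); rewrite subrK.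
have hy : enorm y <= enorm (x - y) + enorm x.
  by rewrite -(enormN (x - y)) opprB; apply: le_trans (enormD _ _); rewrite subrK.
by rewrite ler_norml; apply/andP; split; lra.
Qed.

Lemma orlicz_add (G : R -> R) : orlicz_function G -> exists2 C : R, 0 <= C &
  forall s t, 0 <= s -> 0 <= t -> G (s + t) <= C * (G s + G t).
Proof.
move=> P; have [C C1 hC] := orlicz_mul P (ler0n R 2).
have C0 : 0 <= C by apply: le_trans C1.
exists C => // s t s0 t0; have Gs := orlicz_ge0 P s0; have Gt := orlicz_ge0 P t0.
have [st|ts] := leP s t.
  apply: (@le_trans _ _ (G (2 * t))); first by apply: (orlicz_le P); lra.
  by apply: le_trans (hC _ t0) _; rewrite ler_wpM2l// lerDr.
apply: (@le_trans _ _ (G (2 * s))); first by apply: (orlicz_le P); lra.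
by apply: le_trans (hC _ s0) _; rewrite ler_wpM2l// lerDl.
Qed.

Lemma weak_gradP U (f : V -> R) : W11_loc U f -> is_weak_grad U f (weak_grad U f).
Proof.
by move=> [g wg]; rewrite /weak_grad; apply: (@xgetPex _ _ [set g | is_weak_grad U f g]); exists g.
Qed.

Lemma measurable_weak_grad_norm U (f : V -> R) : measurable U -> W11_loc U f ->
  measurable_fun U (weak_grad_norm U f).
Proof.
move=> mU /weak_gradP [_ Lg _]; apply: measurable_enorm => // i.
by have [] := Lg i.
Qed.

Variables (G : R -> R) (x0 : V) (r : R).
Hypothesis GP : orlicz_function G.
Local Notation B := (eball x0 r).

Let mB : measurable B. Proof. exact: measurable_eball. Qed.

(** [weak_grad] is determined only almost everywhere, so the integrability known for an explicit
    gradient [g] has to be transferred to it. *)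
Lemma intg_weak_grad_norm (Psi : V -> R -> R) f g :
  (forall u : V -> R, measurable_fun B u -> (forall x, B x -> 0 <= u x) ->
    measurable_fun B (fun x => Psi x (u x))) ->
  is_weak_grad B f g -> intg ((fun x => Psi x (enorm (g x))) \_ B) ->
  intg ((fun x => Psi x (weak_grad_norm B f x)) \_ B) /\
  {ae mu, forall x, (((fun x => Psi x (weak_grad_norm B f x)) \_ B) x =
     ((fun x => Psi x (enorm (g x))) \_ B) x)}.
Proof.
move=> mPsi wg iPsi; have Wf : W11_loc B f by exists g.
have ae : {ae mu, forall x, (((fun x => Psi x (weak_grad_norm B f x)) \_ B) x =
     ((fun x => Psi x (enorm (g x))) \_ B) x)}.
  apply: filterS (weak_grad_norm_ae wg) => x h; rewrite !patchE; case: ifPn => // xB.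
  by rewrite h//; move: xB; rewrite inE.
split => //; apply: (intg_le_ae (F := fun x => `|((fun x => Psi x (enorm (g x))) \_ B) x|)).
- apply: ((measurable_restrictT _ mB).1); apply: mPsi; first exact: measurable_weak_grad_norm.
  by move=> x _; exact: enorm_ge0.
- by apply: filterS ae => x ->.
- exact: intg_norm.
Qed.

Lemma W1_orlicz f g : is_weak_grad B f g -> intg ((fun x => G `|f x|) \_ B) ->
  intg ((fun x => G (enorm (g x))) \_ B) -> W1 B (fun=> G) f.
Proof.
move=> wg iGf iGg; have Wf : W11_loc B f by exists g.
split => //; rewrite /W1_norm lte_add_pinfty//.
  by apply: (luxemburg_fin GP) => //; have [[]] := wg.
apply: (luxemburg_fin GP) => //; first exact: measurable_weak_grad_norm.
under [X in X \_ B]eq_fun do rewrite (ger0_norm (enorm_ge0 _)).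
apply: (intg_weak_grad_norm (Psi := fun=> G) _ wg iGg).1 => u mu' u0.
exact: (measurable_orlicz GP).
Qed.

End orlicz_sobolev.

Section convergence.
Context {R : realType} {n : nat}.
Local Notation V := 'rV[R]_n.
Local Notation mu := (lebesgue_rV R n).
Local Notation intg f := (mu.-integrable setT (EFin \o f)).

Variables (x0 : V) (r : R) (rho : V -> R).
Hypotheses (trho : test_function (eball x0 r) rho).
Hypotheses (rho_ge0 : forall w, 0 <= rho w) (rho1 : (\int[mu]_w (rho w)%:E = 1)%E).
Local Notation B := (eball x0 r).

(** Finiteness of [I] lets one parameter meet all the error bounds at once. The rate 2^-j is the one
    required by [summable_L1_dominated]. *)
Lemma avg_subsequence (I : finType) (F : I -> V -> R) : (forall i, intg (F i)) ->
  exists e : nat -> R, forall j, [/\ 0 < e j, e j <= 2^-1, e j <= 2^-1 ^+ j &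
    forall i, \int[mu]_x `|avg rho (e j) (F i) x - F i x| <= 2^-1 ^+ j].
Proof.
move=> iF; pose e (k : nat) : R := k.+2%:R^-1.
have e0 k : 0 < e k by rewrite invr_gt0.
have e1 k : e k <= 2^-1 by rewrite lef_pV2 ?posrE// ler_nat.
have ecvg : e @ \oo --> 0.
  apply/cvgrPdist_le => d d0; near=> k; rewrite sub0r normrN ger0_norm ?(ltW (e0 k))//.
  apply: (@le_trans _ _ (k.+1%:R^-1)); first by rewrite lef_pV2 ?posrE// ler_nat.
  by apply: ltW; near: k; exact: (near_infty_natSinv_lt (PosNum d0)).
suff H (j : nat) : exists d : R, [/\ 0 < d, d <= 2^-1, d <= 2^-1 ^+ j &
    forall i, \int[mu]_x `|avg rho d (F i) x - F i x| <= 2^-1 ^+ j].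
  by have [f hf] := choice H; exists f.
have d0 : 0 < 2^-1 ^+ j :> R by rewrite exprn_gt0.
have h1 : \forall k \near \oo, `|e k| <= 2^-1 ^+ j.
  move/cvgrPdist_le : ecvg => /(_ _ d0); apply: filterS => k.
  by rewrite sub0r normrN.
have h2 : \forall k \near \oo, forall i,
    \int[mu]_x `|avg rho (e k) (F i) x - F i x| <= 2^-1 ^+ j.
  apply: filter_forall => i.
  have /cvgrPdist_le /(_ _ d0) := avg_L1_cvg trho rho_ge0 rho1 e0 e1 ecvg (iF i).
  by apply: filterS => k; rewrite sub0r normrN => /(le_trans (ler_norm _)).
have [k [k1 k2]] := filter_ex (filterI h1 h2).
by exists (e k); split => //; apply: le_trans (ler_norm _) k1.
Unshelve. all: by end_near. Qed.

Variables (G : R -> R) (Psi : V -> R -> R) (v : V -> R) (g : V -> V).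
Hypothesis GP : orlicz_function G.
Hypothesis mPsi : forall u : V -> R, measurable_fun B u -> (forall x, B x -> 0 <= u x) ->
  measurable_fun B (fun x => Psi x (u x)).
Hypothesis G_le_Psi : forall x (t : R), B x -> 0 <= t -> G t <= Psi x t.
Hypothesis Psi_cvg : forall x (s : nat -> R) (t : R), B x -> (forall k, 0 <= s k) -> 0 <= t ->
  s @ \oo --> t -> Psi x (s k) @[k --> \oo] --> Psi x t.
Hypothesis wg : is_weak_grad B v g.
Hypothesis ivG : intg ((fun x => G `|v x|) \_ B).
Let PsiB := (fun x => Psi x (enorm (g x))) \_ B.
Hypothesis iPsi : intg PsiB.
Let vG := (fun x => G `|v x|) \_ B.
Let gB i := (fun x => g x ord0 i) \_ B.
Variable C : R.
Hypothesis C_ge0 : 0 <= C.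
Hypothesis Psi_avg : forall e x, 0 < e -> e <= 2^-1 -> B x ->
  Psi x (enorm (grad_avg x0 r rho g e x)) <= C * avg rho e PsiB x.

Let mB : measurable B. Proof. exact: measurable_eball. Qed.
Let Boo : (mu B < +oo)%E. Proof. exact: eball_finite. Qed.

Lemma avg_approximation : exists2 e : nat -> R, (forall j, 0 < e j /\ e j <= 2^-1) &
  let v_ j := avg rho (e j) (v \_ B) in
  [/\ forall k, W1_infty B (v_ k), W1_cvg B (fun=> G) v_ v &
      energy Psi B (v_ k) B @[k --> \oo] --> (\int[mu]_(x in B) (Psi x (enorm (g x)))%:E)%E].
Proof.
have [[mv _] Lg _] := wg.
have mg i : measurable_fun B (fun x => g x ord0 i) by case: (Lg i).
have mh : measurable_fun B (fun x => enorm (g x)) by exact: measurable_enorm.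
have iv : intg (v \_ B) by exact: orlicz_intg ivG.
have iGg : intg ((fun x => G (enorm (g x))) \_ B).
  apply: (intg_restrict_le mB _ iPsi).
    by apply: (measurable_orlicz GP) => // x _; exact: enorm_ge0.
  move=> x Bx; rewrite ger0_norm; last exact/(orlicz_ge0 GP)/enorm_ge0.
  exact/G_le_Psi/enorm_ge0.
have ih : intg ((fun x => enorm (g x)) \_ B).
  apply: (orlicz_intg GP) => //.
  by under [X in X \_ B]eq_fun do rewrite (ger0_norm (enorm_ge0 _)).
have ig i : intg (gB i).
  apply: (intg_restrict_le mB _ ih) => // x _; exact: coord_le_enorm.
(* The function [v] and the coordinates of [g] supply pointwise convergence; [vG] and [PsiB] supply
   the dominating functions. All of them need the same sequence [e]. *)
pose F (i : option (option (option 'I_n))) :=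
  match i with None => v \_ B | Some None => vG | Some (Some None) => PsiB
  | Some (Some (Some i)) => gB i end.
have iF i : intg (F i) by case: i => [[[i|]|]|] //=.
have [e He] := avg_subsequence iF.
have e0 j : 0 < e j by case: (He j).
have e1 j : e j <= 2^-1 by case: (He j).
have ecvg : e @ \oo --> 0.
  have hh : (fun j => 2^-1 ^+ j : R) @ \oo --> 0.
    by apply: cvg_expr; rewrite ger0_norm// invf_lt1// ltr1n.
  apply: (squeeze_cvgr _ (cvg_cst 0) hh); apply: nearW => j.
  by rewrite (ltW (e0 j)); case: (He j).
have iavg i j : intg (avg rho (e j) (F i)) by exact: (intg_avgT trho rho_ge0 rho1).
have D i := summable_L1_dominated (iavg i) (iF i) (fun j => let: And4 _ _ _ h := He j in h i).
exists e => // v_.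
pose g_ j := grad_avg x0 r rho g (e j).
have wg_ j : is_weak_grad B (v_ j) (g_ j).
  exact: (weak_grad_avg trho rho_ge0 rho1 wg iv ig (e0 j) (e1 j)).
have PsiB0 x : 0 <= PsiB x.
  rewrite /PsiB patchE; case: ifPn => //; rewrite inE => Bx.
  exact: le_trans (orlicz_ge0 GP (enorm_ge0 _)) (G_le_Psi Bx (enorm_ge0 _)).
have mv_ j : measurable_fun B (v_ j) by have [[]] := wg_ j.
have mg_ j i : measurable_fun B (fun x => g_ j x ord0 i).
  by have [_ /(_ i)[]] := wg_ j.
(* Jensen for |v| extended by 0; as [G] vanishes at 0, composing with [G] commutes with the
   extension. *)
have Gv_ j x : G `|v_ j x| <= avg rho (e j) vG x.
  have iav : intg (fun y => `|(v \_ B) y|) by exact: intg_norm.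
  have E : (fun y => G `|(v \_ B) y|) = vG.
    apply/funext => y; rewrite /vG !patchE; case: ifP => //.
    by rewrite normr0 (orlicz0 GP).
  apply: (@le_trans _ _ (G (avg rho (e j) (fun y => `|(v \_ B) y|) x))).
    by apply: (orlicz_le GP) => //; exact: (avg_norm trho rho_ge0 x (e0 j) iv).
  rewrite -E; apply: (avg_jensen trho rho_ge0 rho1) => //.
  by rewrite E.
have [DP [FP iFP HFP]] := D (Some (Some None)).
have [DG [FG iFG HFG]] := D (Some None).
have [Dv _] := D None.
have Dg : {ae mu, forall x, forall i, (fun j => avg rho (e j) (gB i) x) @ \oo --> gB i x}.
  by apply: filter_forall => i; have [] := D (Some (Some (Some i))).
have g_cvg : {ae mu, forall x, B x -> enorm (g_ j x - g x) @[j --> \oo] --> 0}.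
  apply: filterS Dg => x h Bx.
  have hi i : `|g_ j x ord0 i - g x ord0 i| @[j --> \oo] --> 0.
    have -> : (fun j => `|g_ j x ord0 i - g x ord0 i|) =
      (fun j => `|(1 - e j) * avg rho (e j) (gB i) x - g x ord0 i|).
      by apply/funext => j; rewrite /g_ /grad_avg mxE.
    have -> : (0 : R) = `|(1 - 0) * g x ord0 i - g x ord0 i|.
      by rewrite subr0 mul1r subrr normr0.
    apply: cvg_norm; apply: cvgB; last exact: cvg_cst.
    apply: cvgM; first by apply: cvgB => //; exact: cvg_cst.
    by have := h i; rewrite /gB patchE mem_set.
  have hs : (fun j => \sum_(i < n) `|g_ j x ord0 i - g x ord0 i|) @ \oo --> 0.
    rewrite -[X in _ --> X](_ : \sum_(i < n) (0 : R) = 0); last by rewrite big1.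
    by apply: cvg_big => [|i _]; [exact: add_continuous|exact: hi].
  apply: (squeeze_cvgr _ (cvg_cst 0) hs); apply: nearW => j.
  rewrite enorm_ge0 /=; apply: le_trans (enorm_le_sum _) _.
  by apply: ler_sum => i _; rewrite !mxE.
have v_cvg : {ae mu, forall x, B x -> (v_ j \- v) x @[j --> \oo] --> 0}.
  apply: filterS Dv => x h Bx.
  rewrite -(subrr (v x)); apply: cvgB; last exact: cvg_cst.
  by move: h; rewrite /= patchE mem_set.
have Psi_g_ j x : B x -> Psi x (enorm (g_ j x)) <= C * avg rho (e j) PsiB x.
  by move=> Bx; exact: Psi_avg.
have iPsi_ j : intg ((fun x => Psi x (enorm (g_ j x))) \_ B).
  apply: (@intg_restrict_le _ _ _ _ (fun x => C * avg rho (e j) PsiB x)) => //.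
  - by apply: mPsi => [|x _]; [exact: measurable_enorm|exact: enorm_ge0].
  - apply: intg_patch => //; apply: intgZ; exact: (iavg (Some (Some None)) j).
  - move=> x Bx; rewrite ger0_norm; first exact: Psi_g_.
    exact: le_trans (orlicz_ge0 GP (enorm_ge0 _)) (G_le_Psi Bx (enorm_ge0 _)).
have iGv_ j : intg ((fun x => G `|v_ j x|) \_ B).
  apply: (@intg_restrict_le _ _ _ _ (avg rho (e j) vG)) => //.
  - apply: (measurable_orlicz GP) => //; exact: (measurableT_comp (@normr_measurable R setT) (mv_ j)).
  - apply: intg_patch => //; exact: (iavg (Some None) j).
  - move=> x Bx; have G0 : 0 <= G `|v_ j x| by exact: (orlicz_ge0 GP).
    by rewrite (ger0_norm G0); exact: Gv_.
have iGg_ j : intg ((fun x => G (enorm (g_ j x))) \_ B).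
  apply: (intg_restrict_le mB _ (iPsi_ j)).
    by apply: (measurable_orlicz GP) => // [|x _]; [exact: measurable_enorm|exact: enorm_ge0].
  move=> x Bx; rewrite ger0_norm; last exact/(orlicz_ge0 GP)/enorm_ge0.
  exact/G_le_Psi/enorm_ge0.
have W1v_ j : W1 B (fun=> G) (v_ j) by exact: (W1_orlicz GP (wg_ j)).
have W1v : W1 B (fun=> G) v by exact: (W1_orlicz GP wg).
split.
- move=> k; have [Mr Mr0 hMr] := avg_bounded trho.
  pose C1 := Mr * e k ^- n.
  have C10 : 0 <= C1 by rewrite mulr_ge0// invr_ge0 exprn_ge0// ltW.
  have hC1 f x : intg f -> `|avg rho (e k) f x| <= C1 * \int[mu]_y `|f y|.
    by move=> intf; exact: hMr.
  split; first by exists (g_ k).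
    apply: le_lt_trans (ltry (C1 * \int[mu]_y `|(v \_ B) y|)).
    apply: Linfty_norm_le; first by rewrite mulr_ge0// Rintegral_ge0.
    by apply: aeW => x _; exact: hC1.
  pose M := \sum_(i < n) C1 * \int[mu]_y `|gB i y|.
  have M0 : 0 <= M by apply: sumr_ge0 => i _; rewrite mulr_ge0// Rintegral_ge0.
  apply: le_lt_trans (ltry M); apply: Linfty_norm_le => //.
  apply: filterS (weak_grad_norm_ae (wg_ k)) => x h Bx; rewrite h//.
  rewrite ger0_norm ?enorm_ge0//; apply: le_trans (enorm_le_sum _) _.
  apply: ler_sum => i _; rewrite /g_ /grad_avg mxE normrM.
  apply: le_trans (hC1 _ x (ig i)); rewrite ler_piMl//.
  by rewrite ger0_norm; have := e0 k; have := e1 k; lra.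
- have [CA CA0 hCA] := orlicz_add GP.
  split => //; rewrite /W1_norm -[0%E]adde0; apply: cvgeD => //.
    apply: (@luxemburg_cvg0 _ _ _ _ _ (fun x => CA * (FG x + vG x))) => //.
    + by move=> k; exact: measurable_funB.
    + by apply: intgZ; exact: intgD.
    + apply: filterS HFG => x h Bx k; apply: (@le_trans _ _ (G (`|v_ k x| + `|v x|))).
        by apply: (orlicz_le GP) => //; exact: ler_normB.
      apply: le_trans (hCA _ _ _ _) _ => //; rewrite ler_wpM2l//.
      rewrite /vG patchE mem_set// lerD2r; apply: le_trans (Gv_ k x) _.
      exact: le_trans (ler_norm _) (h k).
  have wgB k : is_weak_grad B (v_ k \- v) (fun x => g_ k x - g x).
    apply: is_weak_gradB => //; first exact: eball_open.
      by apply: intg_patch => //; exact: (iavg None k).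
    move=> i; apply: (@intg_restrict_le _ _ _ _ (fun x => enorm (g_ k x))) => //.
      apply: (orlicz_intg GP) => //; first exact: measurable_enorm.
      by under [X in X \_ B]eq_fun do rewrite (ger0_norm (enorm_ge0 _)).
    by move=> x _; exact: coord_le_enorm.
  (* Countably many null sets, one for each choice of a weak gradient, are merged into one. *)
  have wae : {ae mu, forall x k, B x -> weak_grad_norm B (v_ k \- v) x = enorm (g_ k x - g x)}.
    by apply/ae_foralln => k; exact: weak_grad_norm_ae (wgB k).
  apply: (@luxemburg_cvg0 _ _ _ _ _ (fun x => CA * (C * FP x + PsiB x))) => //.
  + by move=> k; apply: measurable_weak_grad_norm => //; exists (fun x => g_ k x - g x).
  + by apply: intgZ; apply: intgD => //; exact: intgZ.
  + apply: filterS2 g_cvg wae => x h E Bx.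
    by under eq_fun do rewrite E//; exact: h.
  + apply: filterS2 HFP wae => x h E Bx k; rewrite E// (ger0_norm (enorm_ge0 _)).
    apply: (@le_trans _ _ (G (enorm (g_ k x) + enorm (g x)))).
      apply: (orlicz_le GP); first exact: enorm_ge0.
      by apply: le_trans (enormD _ _) _; rewrite enormN.
    apply: le_trans (hCA _ _ (enorm_ge0 _) (enorm_ge0 _)) _; rewrite ler_wpM2l// lerD//.
      apply: le_trans (G_le_Psi Bx (enorm_ge0 _)) _; apply: le_trans (Psi_g_ k x Bx) _.
      by rewrite ler_wpM2l//; exact: le_trans (ler_norm _) (h k).
    by rewrite /PsiB patchE mem_set//; exact/G_le_Psi/enorm_ge0.
- pose P_ k := (fun x => Psi x (weak_grad_norm B (v_ k) x)) \_ B.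
  have HP k := intg_weak_grad_norm mPsi (wg_ k) (iPsi_ k).
  have wae : {ae mu, forall x k, P_ k x = ((fun x => Psi x (enorm (g_ k x))) \_ B) x}.
    by apply/ae_foralln => k; exact: (HP k).2.
  have EP k : energy Psi B (v_ k) B = (\int[mu]_x P_ k x)%:E.
    by rewrite /energy integral_restrict EFin_Rintegral//; exact: (HP k).1.
  rewrite integral_restrict -EFin_Rintegral//.
  under eq_fun do rewrite EP.
  apply/fine_cvgP; split; first by apply: nearW.
  have [] := @dominated_Rintegral _ _ _ mu P_ PsiB (fun x => C * FP x).
  + by move=> k; exact: (intg_measurable (HP k).1).
  + exact: (intg_measurable iPsi).
  + apply: filterS2 g_cvg wae => x h E.
    have [Bx|Bx] := pselect (B x); last first.
      rewrite (_ : PsiB x = 0); last by rewrite /PsiB patchE memNset.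
      rewrite (_ : P_ ^~ x = cst 0); first exact: cvg_cst.
      by apply/funext => k; rewrite /P_ patchE memNset.
    rewrite (_ : PsiB x = Psi x (enorm (g x))); last by rewrite /PsiB patchE mem_set.
    rewrite (_ : P_ ^~ x = fun k => Psi x (enorm (g_ k x))); last first.
      by apply/funext => k; rewrite E patchE mem_set.
    apply: Psi_cvg => //; [by move=> k; exact: enorm_ge0|exact: enorm_ge0|].
    apply/cvgrPdist_le => d d0; move/cvgrPdist_le : (h Bx) => /(_ _ d0).
    apply: filterS => k; rewrite sub0r normrN (ger0_norm (enorm_ge0 _)); apply: le_trans.
    exact: enorm_dist.
  + exact: intgZ.
  + apply: filterS2 HFP wae => x h E k; rewrite E.
    rewrite patchE; case: ifPn => [|_]; last first.
      rewrite normr0 mulr_ge0//; exact: le_trans (normr_ge0 _) (h 0).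
    rewrite inE => Bx; rewrite ger0_norm.
      apply: le_trans (Psi_g_ k x Bx) _.
      by rewrite ler_wpM2l//; exact: le_trans (ler_norm _) (h k).
    exact: le_trans (orlicz_ge0 GP (enorm_ge0 _)) (G_le_Psi Bx (enorm_ge0 _)).
  by [].
Qed.

End convergence.

(** * The three gap conditions *)

Section coefficients.
Context {R : realType} {n : nat}.
Local Notation V := 'rV[R]_n.
Local Notation mu := (lebesgue_rV R n).

Lemma C_modulus_le (U : set V) (sigma : R -> R) f : (forall t, 0 <= t -> 0 <= sigma t) ->
  C_modulus U sigma f -> exists2 M : R, 0 <= M &
  forall x y, U x -> U y -> `|f x - f y| <= M * sigma (enorm (x - y)).
Proof.
move=> s0 [_ _ [M hM]]; exists `|M| => // x y Ux Uy.
have [->|xy] := eqVneq x y.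
  by rewrite subrr normr0 mulr_ge0// s0// enorm_ge0.
apply: le_trans (hM x y Ux Uy xy) _.
by rewrite ler_wpM2r ?ler_norm// s0// enorm_ge0.
Qed.

Lemma C_modulus_measurable (U : set V) (sigma : R -> R) f : open U -> C_modulus U sigma f ->
  measurable_fun U f.
Proof.
move=> oU [uc _ _]; apply: continuous_measurable_rV => // x; rewrite inE => Ux.
have F : Filter (nbhs x) by exact: nbhs_filter.
apply: (cvgrPdist_lt (F := nbhs x) f (f x)).2 => e e0; have [d d0 hd] := uc e e0.
have oD : open (U `&` eball x d) by apply: openI => //; exact: (@eball_open _ _ x d).
have xD : (U `&` eball x d) x by split => //; rewrite /eball/= subrr enorm0.
apply: filterS (open_nbhs_nbhs (conj oD xD)) => y [Uy xy]; apply: hd => //.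
by rewrite -enormN opprB.
Qed.

Lemma limn_esup_le (u : nat -> \bar R) (l : \bar R) : (forall k, (u k <= l)%E) ->
  (limn_esup u <= l)%E.
Proof.
move=> ul; rewrite limn_esup_lim; apply: lime_le; first exact: is_cvg_esups.
by apply: nearW => k; apply: ge_ereal_sup => _ [m _ <-].
Qed.

Lemma W1_norm_luxemburg (U : set V) Psi f : (W1_norm U Psi f < +oo)%E ->
  (luxemburg_norm U Psi f < +oo)%E.
Proof.
apply: le_lt_trans; rewrite /W1_norm leeDl//; exact: luxemburg_ge0.
Qed.

Lemma lebesgue_rV_setT_gt0 : (0 < mu setT)%E.
Proof.
apply: (@lt_le_trans _ _ (mu (rV_cube 0 1))).
  by rewrite lebesgue_rV_cube// lte_fin exprn_gt0// mulr_gt0.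
apply: le_measure => //; rewrite inE //.
by apply: open_measurable_rV; exact: open_rV_cube.
Qed.

End coefficients.

Section balls.
Context {R : realType} {n : nat}.
Local Notation V := 'rV[R]_n.
Local Notation mu := (lebesgue_rV R n).
Local Notation intg f := (mu.-integrable setT (EFin \o f)).

Variables (x0 : V) (r : R) (rho : V -> R).
Hypotheses (r_gt0 : 0 < r) (trho : test_function (eball x0 r) rho).
Hypotheses (rho_ge0 : forall w, 0 <= rho w) (rho1 : (\int[mu]_w (rho w)%:E = 1)%E).
Hypothesis rho_sym : forall w, rho (x0 + x0 - w) = rho w.
Local Notation B := (eball x0 r).

(* As the partial derivatives of rho have mean zero, a constant c can be
   subtracted from v before the derivative falls on the kernel. *)
Lemma grad_avg_osc (v : V -> R) g : is_weak_grad B v g -> intg (v \_ B) ->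
  (forall i, intg ((fun x => g x ord0 i) \_ B)) ->
  exists2 K : R, 0 <= K & forall e x (c M : R), 0 < e -> e <= 1 -> B x ->
    {ae mu, forall y, B y -> enorm (x - y) <= 2 * r * e -> `|v y - c| <= M} ->
    enorm (grad_avg x0 r rho g e x) <= K * M / e.
Proof.
move=> wg iv ig; exists (\sum_(i < n) \int[mu]_w `|partial_derive i rho w|).
  by apply: sumr_ge0 => i _; exact: Rintegral_ge0.
move=> e x c M e0 e1 Bx osc; apply: le_trans (enorm_le_sum _) _.
rewrite -mulrA mulr_suml; apply: ler_sum => i _.
rewrite mxE (avg_weak_grad trho wg iv ig i e0 e1 Bx) normrM normrN normrM.
have tp := test_function_partial i trho.
have := avg_ae_le (c := c) (M := M) tp e0 e1 Bx iv.
rewrite (Rint_partial_kernel trho i rho_sym) mulr0 subr0 => H.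
have {}H : `|avg (partial_derive i rho) e (v \_ B) x| <= M * \int[mu]_w `|partial_derive i rho w|.
  by apply: H; apply: filterS osc => y h By xy; rewrite patchE mem_set//; exact: h.
have ei : 0 <= e^-1 by rewrite invr_ge0 ltW.
rewrite (ger0_norm ei) ger0_norm ?subr_ge0//.
apply: (@le_trans _ _ (e^-1 * `|avg (partial_derive i rho) e (v \_ B) x|)).
  by rewrite ler_piMl ?mulr_ge0// lerBlDr lerDl ltW.
set I := \int[mu]_w _ in H *; have -> : I * (M / e) = e^-1 * (M * I) by ring.
exact: ler_wpM2l.
Qed.

Variables (G Ha Hb wa wb : R -> R) (a b : V -> R) (v : V -> R) (g : V -> V).
Hypotheses (GP : orlicz_function G) (HaP : orlicz_function Ha) (HbP : orlicz_function Hb).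
Hypotheses (waP : concave_modulus wa) (wbP : concave_modulus wb).
Variable U : set V.
Hypotheses (oU : open U) (BU : B `<=` U).
Hypotheses (aP : C_modulus U wa a) (bP : C_modulus U wb b).
Hypotheses (a_ge0 : forall x, U x -> 0 <= a x) (b_ge0 : forall x, U x -> 0 <= b x).
Local Notation Psi := (multi_phase G Ha Hb a b).
Hypothesis wg : is_weak_grad B v g.
Hypothesis ivG : intg ((fun x => G `|v x|) \_ B).
Let PsiB := (fun x => Psi x (enorm (g x))) \_ B.
Hypothesis iPsi : intg PsiB.

Let mU : measurable U. Proof. exact: open_measurable_rV. Qed.
Let mB : measurable B. Proof. exact: measurable_eball. Qed.
Let ma : measurable_fun B a.
Proof. exact: (measurable_funS mU BU (C_modulus_measurable oU aP)). Qed.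
Let mb : measurable_fun B b.
Proof. exact: (measurable_funS mU BU (C_modulus_measurable oU bP)). Qed.
Let aB x : B x -> 0 <= a x. Proof. by move=> /BU; exact: a_ge0. Qed.
Let bB x : B x -> 0 <= b x. Proof. by move=> /BU; exact: b_ge0. Qed.

(** The a priori bound for the first condition on Lambda: Jensen with [Phi = G] and constant 1, then
    the supremum bound for the average of an integrable function. *)
Lemma grad_avg_orlicz : exists2 E : R, 0 <= E & forall e x, 0 < e -> e <= 2^-1 -> B x ->
  G (enorm (grad_avg x0 r rho g e x)) <= E * e ^- n.
Proof.
have [C C1 hC] := avg_orlicz_le trho rho_ge0 rho1 GP HaP HbP aB bB wg iPsi GP.
have C0 : 0 <= C by apply: le_trans C1.
have [M M0 hM] := avg_bounded trho.
have I0 : 0 <= \int[mu]_y `|PsiB y| by exact: Rintegral_ge0.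
exists (C * (M * \int[mu]_y `|PsiB y|)); first by rewrite !mulr_ge0.
move=> e x e0 e1 Bx; rewrite -[X in X <= _]mul1r.
apply: le_trans (hC 1 e x ler01 e0 e1 Bx _) _.
  move=> y By _; rewrite mul1r.
  by have [] := multi_phase_ge GP HaP HbP (aB By) (bB By) (enorm_ge0 (g y)).
rewrite -!mulrA ler_wpM2l//; apply: le_trans (ler_norm _) _.
apply: le_trans (hM _ _ x e0 iPsi) _.
by rewrite mulrAC -mulrA.
Qed.

(** What remains for each gap condition is to find, whenever the averaged gradient has norm t > 0, a
    scale [d] above [2 * r * e] such that [d] and t / K lie on the curve where Lambda is bounded.
    [K] may depend on all the a priori constants, but not on [e] or [x]. *)
Lemma multi_phase_approximation (K L : R) : 1 <= K ->
  (forall e x, 0 < e -> e <= 2^-1 -> B x -> 0 < enorm (grad_avg x0 r rho g e x) ->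
    exists2 d : R, 2 * r * e <= d &
      Lambda G Ha Hb wa wb d (enorm (grad_avg x0 r rho g e x) / K) <= L) ->
  exists2 e : nat -> R, (forall j, 0 < e j /\ e j <= 2^-1) &
  let v_ j := avg rho (e j) (v \_ B) in
  [/\ forall k, W1_infty B (v_ k), W1_cvg B (fun=> G) v_ v &
      energy Psi B (v_ k) B @[k --> \oo] --> (\int[mu]_(x in B) (Psi x (enorm (g x)))%:E)%E].
Proof.
move=> K1 gap.
have [Ma Ma0 hMa] := C_modulus_le (modulus_ge0 waP) aP.
have [Mb Mb0 hMb] := C_modulus_le (modulus_ge0 wbP) bP.
have [Cg Cg0 hCg] := Lambda_gap L r GP HaP HbP waP wbP K1.
have [C C0 hC] : exists2 C : R, 0 <= C & forall e x, 0 < e -> e <= 2^-1 -> B x ->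
    Psi x (enorm (grad_avg x0 r rho g e x)) <= C * avg rho e PsiB x.
  apply: (multi_phase_avg_le trho rho_ge0 rho1 GP HaP HbP aB bB wg iPsi waP wbP Ma0 Mb0 _ _ Cg0).
  - by move=> x y /BU Ux /BU Uy; apply: le_trans (ler_norm _) (hMa _ _ Ux Uy).
  - by move=> x y /BU Ux /BU Uy; apply: le_trans (ler_norm _) (hMb _ _ Ux Uy).
  move=> e x e0 e1 Bx; have := enorm_ge0 (grad_avg x0 r rho g e x).
  (* At t = 0 both sides vanish; the curve is only available for t > 0. *)
  rewrite le_eqVlt => /predU1P[<-|t0] /=.
    by rewrite (orlicz0 GP) (orlicz0 HaP) (orlicz0 HbP) !mulr0.
  have [d hd hL] := gap e x e0 e1 Bx t0.
  have s0 : 0 <= 2 * r * e by rewrite !mulr_ge0// ltW.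
  apply: (hCg _ _ d t0 s0 _ hd hL).
  have : e * (2 * r) <= 2^-1 * (2 * r) by rewrite ler_wpM2r// mulr_ge0// ltW.
  lra.
apply: (avg_approximation trho rho_ge0 rho1 GP _ _ _ wg ivG iPsi C0 hC).
- by move=> u mu' u0; exact: measurable_multi_phase.
- move=> x t Bx t0.
  by have [] := multi_phase_ge GP HaP HbP (aB Bx) (bB Bx) t0.
- by move=> x s t Bx s0 t0 st; exact: multi_phase_cvg.
Qed.


Local Notation approximable := (exists2 e : nat -> R, (forall j, 0 < e j /\ e j <= 2^-1) &
  let v_ j := avg rho (e j) (v \_ B) in
  [/\ forall k, W1_infty B (v_ k), W1_cvg B (fun=> G) v_ v &
      energy Psi B (v_ k) B @[k --> \oo] --> (\int[mu]_(x in B) (Psi x (enorm (g x)))%:E)%E]).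

(** The scale solves G(t / K) = d^-n. Then d >= 2 r e amounts to G(t / K) <= (2 r e)^-n, which
    follows from G(t / K) <= G(t) / K and G(t) <= E e^-n once K >= E (2 r)^n. *)
Lemma approximation_sobolev : (0 < n)%N ->
  has_ubound [set Lambda G Ha Hb wa wb t (orlicz_inv G (t ^- n)) | t in [set t : R | 0 < t]] ->
  approximable.
Proof.
move=> n0 [L HL]; have [E E0 hE] := grad_avg_orlicz.
pose K := Num.max 1 (E * (2 * r) ^+ n).
have K1 : 1 <= K by rewrite le_max lexx.
have K0 : 0 < K by exact: lt_le_trans K1.
have EK : E * (2 * r) ^+ n <= K by rewrite le_max lexx orbT.
apply: (multi_phase_approximation (L := L) K1) => e x e0 e1 Bx; set t := enorm _ => t0.
have tK0 : 0 < t / K by rewrite divr_gt0.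
have GtK := orlicz_gt0 GP tK0; have Gi : 0 < (G (t / K))^-1 by rewrite invr_gt0.
pose d := (G (t / K))^-1 `^ n%:R^-1.
have d0 : 0 < d by exact: powR_gt0.
have dn : d ^+ n = (G (t / K))^-1.
  rewrite -powR_mulrn ?(ltW d0)// /d -powRrM mulVf ?powRr1 ?(ltW Gi)//.
  by rewrite pnatr_eq0 -lt0n.
exists d; last first.
  apply: HL; exists d => //.
  by rewrite dn invrK (orlicz_invK GP (ltW tK0)).
have s0 : 0 <= 2 * r * e by rewrite !mulr_ge0// ltW.
rewrite -(ler_pXn2r n0) ?nnegrE ?(ltW d0)// dn -[X in X <= _]invrK lef_pV2 ?posrE//; last first.
  by rewrite invr_gt0 exprn_gt0// mulr_gt0// mulr_gt0.
apply: le_trans (orlicz_divr GP K1 (ltW t0)) _.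
rewrite ler_pdivrMr//; apply: le_trans (hE e x e0 e1 Bx) _.
rewrite ler_pdivrMr ?exprn_gt0// exprMn invfM -mulrA mulrAC.
rewrite (_ : _ * _ = K / (2 * r) ^+ n); last by field; rewrite !expf_neq0// ?gt_eqF// mulr_gt0.
by rewrite ler_pdivlMr// exprn_gt0// mulr_gt0.
Qed.

Let iv : intg (v \_ B).
Proof. by have [[mv _] _ _] := wg; apply: orlicz_intg ivG => //; exact: eball_finite. Qed.

Let ig i : intg ((fun x => g x ord0 i) \_ B).
Proof.
have mg j : measurable_fun B (fun x => g x ord0 j) by have [_ /(_ j)[]] := wg.
have mh : measurable_fun B (fun x => enorm (g x)) by exact: measurable_enorm.
apply: (@intg_restrict_le _ _ _ _ (fun x => enorm (g x))) => //; last first.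
  by move=> x _; exact: coord_le_enorm.
exact: (intg_enorm_grad GP HaP HbP aB bB wg iPsi).
Qed.

(** The scale solves d^(1 - gamma) = K / t. Then d >= 2 r e amounts to t (2 r e)^(1 - gamma) <= K,
    and the bound t <= E M (2 r e)^gamma / e of [grad_avg_osc] makes the left side at most E M 2 r,
    whence the choice of [K]. *)
Lemma approximation_osc (gamma M L : R) : 0 <= gamma -> gamma < 1 -> 0 <= M ->
  (forall e x, 0 < e -> e <= 2^-1 -> B x -> exists c : R,
    {ae mu, forall y, B y -> enorm (x - y) <= 2 * r * e ->
      `|v y - c| <= M * (2 * r * e) `^ gamma}) ->
  (forall t : R, 0 < t -> Lambda G Ha Hb wa wb (t `^ (1 - gamma)^-1) t^-1 <= L) ->
  approximable.
Proof.
move=> g0 g1 M0 osc HL; have [E E0 hE] := grad_avg_osc wg iv ig.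
pose K := Num.max 1 (E * M * (2 * r)).
have K1 : 1 <= K by rewrite le_max lexx.
have K0 : 0 < K by exact: lt_le_trans K1.
have EK : E * M * (2 * r) <= K by rewrite le_max lexx orbT.
apply: (multi_phase_approximation (L := L) K1) => e x e0 e1 Bx; set t := enorm _ => t0.
have g1' : 0 < 1 - gamma by rewrite subr_gt0.
have Kt : 0 < K / t by rewrite divr_gt0.
have s0 : 0 < 2 * r * e by rewrite mulr_gt0// mulr_gt0.
exists ((K / t) `^ (1 - gamma)^-1); last by have := HL _ Kt; rewrite invf_div.
have e1' : e <= 1 by apply: le_trans e1 _; lra.
have [c hc] := osc e x e0 e1 Bx.
have ht := hE e x c _ e0 e1' Bx hc.
have -> : 2 * r * e = ((2 * r * e) `^ (1 - gamma)) `^ (1 - gamma)^-1.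
  by rewrite -powRrM mulfV ?powRr1 ?(ltW s0) ?gt_eqF.
apply: ge0_ler_powR; rewrite ?nnegrE ?invr_ge0 ?(ltW g1') ?powR_ge0 ?(ltW Kt)//.
rewrite ler_pdivlMr//; apply: le_trans EK.
have -> : E * M * (2 * r) = (2 * r * e) `^ (1 - gamma) * (E * (M * (2 * r * e) `^ gamma) / e).
  rewrite powRB; last by rewrite gt_eqF// implybT.
  rewrite powRr1 ?(ltW s0)//; field.
  by rewrite !gt_eqF// powR_gt0.
by rewrite ler_wpM2l// powR_ge0.
Qed.

End balls.

(** * Integrability from finite norms and finite energy *)

Section finite_energy.
Context {R : realType} {n : nat}.
Local Notation V := 'rV[R]_n.
Local Notation mu := (lebesgue_rV R n).
Local Notation intg f := (mu.-integrable setT (EFin \o f)).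

Variables (G Ha Hb wa wb : R -> R) (a b : V -> R) (U : set V).
Hypotheses (GP : orlicz_function G) (HaP : orlicz_function Ha) (HbP : orlicz_function Hb).
Hypotheses (oU : open U) (aP : C_modulus U wa a) (bP : C_modulus U wb b).
Hypotheses (a_ge0 : forall x, U x -> 0 <= a x) (b_ge0 : forall x, U x -> 0 <= b x).
Local Notation Psi := (multi_phase G Ha Hb a b).

Let mU : measurable U. Proof. exact: open_measurable_rV. Qed.

Let mPsi A (u : V -> R) : measurable A -> A `<=` U -> measurable_fun A u ->
  (forall x, A x -> 0 <= u x) -> measurable_fun A (fun x => Psi x (u x)).
Proof.
move=> mA AU mu' u0; apply: measurable_multi_phase => //.
  exact: (measurable_funS mU AU (C_modulus_measurable oU aP)).
exact: (measurable_funS mU AU (C_modulus_measurable oU bP)).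
Qed.

Lemma luxemburg_multi_phase_intg A u : measurable A -> A `<=` U -> measurable_fun A u ->
  (luxemburg_norm A Psi u < +oo)%E -> intg ((fun x => G `|u x|) \_ A).
Proof.
move=> mA AU mu'; apply: luxemburg_intg => // [x t /AU Ux t0|l l0].
  by have [] := multi_phase_ge GP HaP HbP (a_ge0 Ux) (b_ge0 Ux) t0.
apply: mPsi => // [|x _]; last by rewrite mulr_ge0// invr_ge0 ltW.
by apply: measurable_funM => //; exact: (measurableT_comp (@normr_measurable R setT) mu').
Qed.

Lemma energy_intg A B v : measurable A -> measurable B -> B `<=` A -> A `<=` U ->
  W11_loc U v -> (energy Psi U v A < +oo)%E ->
  intg ((fun x => Psi x (weak_grad_norm U v x)) \_ B).
Proof.
move=> mA mB BA AU Wv eA; have BU := subset_trans BA AU.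
have mw := measurable_weak_grad_norm mU Wv.
have mPA : measurable_fun A (fun x => Psi x (weak_grad_norm U v x)).
  by apply: mPsi => // [|x _]; [exact: measurable_funS mw|exact: enorm_ge0].
have P0 x : A x -> 0 <= Psi x (weak_grad_norm U v x).
  move=> /AU Ux; have [h _ _] := multi_phase_ge GP HaP HbP (a_ge0 Ux) (b_ge0 Ux) (enorm_ge0 (weak_grad U v x)).
  exact: le_trans (orlicz_ge0 GP (enorm_ge0 _)) h.
apply: intg_restrict_int => //; first exact: measurable_funS mPA.
apply: le_lt_trans eA; rewrite /energy.
rewrite (eq_integral (fun x => (Psi x (weak_grad_norm U v x))%:E)); last first.
  by move=> x; rewrite inE => /BA Ax; rewrite ger0_norm// P0.
apply: ge0_subset_integral => //; first exact/measurable_EFinP.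
Qed.

(** A finite Luxemburg norm on the small ball gives the integrability of G(|v|), and the finite
    energy on [A] that of the density of the gradient. *)
Lemma W1_loc_intg x (r : R) A v : open A -> W1_loc U Psi v ->
  compactly_contained (eball x r) A -> compactly_contained A U ->
  (energy Psi U v A < +oo)%E ->
  [/\ is_weak_grad (eball x r) v (weak_grad U v),
      intg ((fun z => G `|v z|) \_ (eball x r)) &
      intg ((fun z => Psi z (weak_grad_norm U v z)) \_ (eball x r))].
Proof.
move=> oA [Wv Wloc] cBA cAU eA.
have BA := compactly_containedW cBA; have AU := compactly_containedW cAU.
have BU := subset_trans BA AU.
have oB : open (eball x r) by exact: (@eball_open _ _ x r).
have wgB := is_weak_gradS oU oB BU (weak_gradP Wv).
have [_ /W1_norm_luxemburg lv] := Wloc _ oB (compactly_containedS BA (fun _ h => h) cAU).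
have mv : measurable_fun (eball x r) v by have [[]] := wgB.
split => //; first exact: luxemburg_multi_phase_intg (measurable_eball x r) BU mv lv.
exact: energy_intg (open_measurable_rV oA) (measurable_eball x r) BA AU Wv eA.
Qed.

End finite_energy.
Theorem theorem3p1 (R : realType) (n : nat) (Omega : set 'rV[R]_n)
    (G Ha Hb wa wb : R -> R) (a b : 'rV[R]_n -> R)
    (n_ge2 : (2 <= n)%N) (OmegaP : bounded_domain Omega)
    (GP : orlicz_function G) (HaP : orlicz_function Ha)
    (HbP : orlicz_function Hb)
    (waP : concave_modulus wa) (wbP : concave_modulus wb)
    (aP : C_modulus Omega wa a) (bP : C_modulus Omega wb b)
    (a_ge0 : forall x, Omega x -> 0 <= a x)
    (b_ge0 : forall x, Omega x -> 0 <= b x) :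
  [/\ has_ubound [set Lambda G Ha Hb wa wb t (orlicz_inv G (t ^- n))
                 | t in [set t : R | 0 < t]] ->
      forall (v : 'rV[R]_n -> R) (x y : 'rV[R]_n) (r s : R),
        0 < r -> 0 < s ->
        W1_loc Omega (multi_phase G Ha Hb a b) v ->
        compactly_contained (eball x r) (eball y s) ->
        compactly_contained (eball y s) Omega ->
        (energy (multi_phase G Ha Hb a b) Omega v (eball y s) < +oo)%E ->
        exists v_ : nat -> 'rV[R]_n -> R,
          [/\ forall k, W1_infty (eball x r) (v_ k),
              W1_cvg (eball x r) (fun _ => G) v_ v &
              energy (multi_phase G Ha Hb a b) (eball x r) (v_ k) (eball x r)
                @[k --> \oo] -->
              energy (multi_phase G Ha Hb a b) Omega v (eball x r)],
      has_ubound [set Lambda G Ha Hb wa wb t t^-1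
                 | t in [set t : R | 0 < t]] ->
      forall (v : 'rV[R]_n -> R) (x y : 'rV[R]_n) (r s : R),
        0 < r -> 0 < s ->
        W1_loc Omega (multi_phase G Ha Hb a b) v ->
        Linfty_loc Omega v ->
        compactly_contained (eball x r) (eball y s) ->
        compactly_contained (eball y s) Omega ->
        (energy (multi_phase G Ha Hb a b) Omega v (eball y s) < +oo)%E ->
        exists v_ : nat -> 'rV[R]_n -> R,
          [/\ forall k, W1_infty (eball x r) (v_ k),
              W1_cvg (eball x r) (fun _ => G) v_ v,
              energy (multi_phase G Ha Hb a b) (eball x r) (v_ k) (eball x r)
                @[k --> \oo] -->
              energy (multi_phase G Ha Hb a b) Omega v (eball x r) &
              (limn_esup (fun k => Linfty_norm (eball x r) (v_ k)) <=
               Linfty_norm (eball x r) v)%E]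
    & forall (v : 'rV[R]_n -> R) (gamma Q : R),
        0 < gamma -> gamma < 1 -> 1 <= Q ->
        W1 Omega (multi_phase G Ha Hb a b) v ->
        C_modulus Omega (fun t => t `^ gamma) v ->
        local_Qminimizer (multi_phase G Ha Hb a b) Omega Q v ->
        has_ubound [set Lambda G Ha Hb wa wb (t `^ (1 - gamma)^-1) t^-1
                   | t in [set t : R | 0 < t]] ->
        forall (x : 'rV[R]_n) (r : R),
          0 < r -> compactly_contained (eball x r) Omega ->
          exists v_ : nat -> 'rV[R]_n -> R,
            [/\ forall k, W1_infty (eball x r) (v_ k),
                W1_cvg (eball x r) (fun _ => G) v_ v &
                energy (multi_phase G Ha Hb a b) (eball x r) (v_ k) (eball x r)
                  @[k --> \oo] -->
                energy (multi_phase G Ha Hb a b) Omega v (eball x r)]].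
Proof.
have n0 : (0 < n)%N by exact: ltn_trans n_ge2.
have [oO _ _ _] := OmegaP.
have mO := open_measurable_rV oO.
split.
- move=> HL v x y r s r0 _ Wv cxy cyO eys.
  have [rho [trho rho0 rho1 rhos]] := exists_kernel x r0.
  have BU := subset_trans (compactly_containedW cxy) (compactly_containedW cyO).
  have oy : open (eball y s) by exact: (@eball_open _ _ y s).
  have [wgB ivG iPsi] := W1_loc_intg GP HaP HbP oO aP bP a_ge0 b_ge0 oy Wv cxy cyO eys.
  (* The gradient supplied here is [weak_grad Omega v], so the limit integral is by definition the
     energy of [v] computed in [Omega]. *)
  have [e _ He] := approximation_sobolev r0 trho rho0 rho1 GP HaP HbP waP wbP
    oO BU aP bP a_ge0 b_ge0 wgB ivG iPsi n0 HL.
  by exists (fun k => avg rho (e k) (v \_ (eball x r))).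
- move=> [L HL] v x y r s r0 _ Wv Lv cxy cyO eys.
  have [rho [trho rho0 rho1 rhos]] := exists_kernel x r0.
  have xy := compactly_containedW cxy.
  have BU := subset_trans xy (compactly_containedW cyO).
  have oy : open (eball y s) by exact: (@eball_open _ _ y s).
  have oB : open (eball x r) by exact: (@eball_open _ _ x r).
  have [wgB ivG iPsi] := W1_loc_intg GP HaP HbP oO aP bP a_ge0 b_ge0 oy Wv cxy cyO eys.
  have mv : measurable_fun (eball x r) v by have [[]] := wgB.
  have cB := compactly_containedS xy (fun _ h => h) cyO.
  have [M M0 [vM aeM]] := Linfty_norm_ae (lebesgue_rV_setT_gt0) (Lv _ oB cB).
  (* Boundedness is read as an oscillation bound of order 0 around the constant 0, since the power
     with exponent 0 equals 1. *)
  have osc (e : R) z : 0 < e -> e <= 2^-1 -> eball x r z -> exists c : R,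
      {ae lebesgue_rV R n, forall y, eball x r y -> enorm (z - y) <= 2 * r * e ->
        `|v y - c| <= M * (2 * r * e) `^ 0}.
    move=> _ _ _; exists 0; apply: filterS aeM => w h Bw _.
    by rewrite subr0 powRr0 mulr1; exact: h.
  have gap (t : R) : 0 < t -> Lambda G Ha Hb wa wb (t `^ (1 - 0)^-1) t^-1 <= L.
    by move=> t0; apply: HL; exists t => //; rewrite subr0 invr1 powRr1// ltW.
  have [e e0 [He1 He2 He3]] := approximation_osc r0 trho rho0 rho1 rhos GP HaP HbP waP wbP
    oO BU aP bP a_ge0 b_ge0 wgB ivG iPsi (lexx 0) ltr01 M0 osc gap.
  exists (fun k => avg rho (e k) (v \_ (eball x r))); split => //.
  (* Each approximant already satisfies the bound: it is an average of values of [v] with a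
     nonnegative kernel of mass one. *)
  rewrite vM; apply: limn_esup_le => k; apply: Linfty_norm_le => //.
  apply: aeW => z Bz; have [ek0 ek1] := e0 k.
  have iv : (lebesgue_rV R n).-integrable setT (EFin \o (v \_ (eball x r))).
    by apply: orlicz_intg ivG => //; [exact: measurable_eball|exact: eball_finite].
  apply: (avg_ae_bounded trho rho0 rho1 ek0 _ Bz iv); first by apply: le_trans ek1 _; lra.
  by apply: filterS aeM => w h Bw; rewrite patchE mem_set//; exact: h.
- move=> v gamma Q g0 g1 Q1 [Wv /W1_norm_luxemburg lv] Cv [_ iO _] [L HL] x r r0 cB.
  have [rho [trho rho0 rho1 rhos]] := exists_kernel x r0.
  have BU := compactly_containedW cB.
  have oB : open (eball x r) by exact: (@eball_open _ _ x r).
  have wgB := is_weak_gradS oO oB BU (weak_gradP Wv).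
  have mv : measurable_fun Omega v by have [[]] := weak_gradP Wv.
  have mB := measurable_eball x r.
  have ivG : (lebesgue_rV R n).-integrable setT (EFin \o ((fun z => G `|v z|) \_ (eball x r))).
    have := intg_patch mB (luxemburg_multi_phase_intg GP HaP HbP oO aP bP a_ge0 b_ge0 mO (fun _ h => h) mv lv).
    apply: eq_integrable => // z _; rewrite /= !patchE; case: ifPn => // zB.
    by rewrite mem_set//; apply: BU; move: zB; rewrite inE.
  (* Finite energy is part of being a local Q-minimizer; it is restricted here from [Omega] to the
     ball. *)
  have iPsi : (lebesgue_rV R n).-integrable setT (EFin \o ((fun z => multi_phase G Ha Hb a b z (enorm (weak_grad Omega v z))) \_ (eball x r))).
    have := (integrable_mkcond _ mB).1 (integrableS mO mB BU iO).
    by apply: eq_integrable => // z _; rewrite /= !patchE; case: ifP.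
  have [M M0 hM] := C_modulus_le (fun t _ => powR_ge0 t gamma) Cv.
  have osc (e : R) z : 0 < e -> e <= 2^-1 -> eball x r z -> exists c : R,
      {ae lebesgue_rV R n, forall y, eball x r y -> enorm (z - y) <= 2 * r * e ->
        `|v y - c| <= M * (2 * r * e) `^ gamma}.
    (* The constant is the value of [v] at the point itself, so the Hoelder bound at distance
       [2 * r * e] applies everywhere in the ball. *)
    move=> _ _ Bz; exists (v z); apply: aeW => w Bw zw.
    rewrite distrC; apply: le_trans (hM z w (BU _ Bz) (BU _ Bw)) _.
    rewrite ler_wpM2l// ge0_ler_powR ?nnegrE ?enorm_ge0 ?(ltW g0)//.
    exact: le_trans (enorm_ge0 _) zw.
  have gap (t : R) : 0 < t -> Lambda G Ha Hb wa wb (t `^ (1 - gamma)^-1) t^-1 <= L.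
    by move=> t0; apply: HL; exists t.
  have [e _ He] := approximation_osc r0 trho rho0 rho1 rhos GP HaP HbP waP wbP
    oO BU aP bP a_ge0 b_ge0 wgB ivG iPsi (ltW g0) g1 M0 osc gap.
  by exists (fun k => avg rho (e k) (v \_ (eball x r))).
Qed.
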